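(* Let $H>0$ and $N\ge0$ be constants, and suppose that for every $n\ge1$ a sequence of martingale differences $(\eta_i,\mathcal{F}_i)_{i=1,\dots,n}$ (allowed to depend on $n$) is given which satisfies conditions (A1$'$) and (A2$'$) with these constants $H$ and $N$. Then for any constant $\alpha>0$ and $\alpha\sqrt{\log n}\le x=o(n^{1/6})$, i.e. for every sequence $b_n=o(n^{1/6})$ of positive reals and uniformly in $\alpha\sqrt{\log n}\le x\le b_n$, $$\frac{\mathbb{P}\big(\sum_{i=1}^n\eta_i>x\sqrt n\big)}{1-\Phi(x)}=1+O\Big((H+N)\frac{x^3}{\sqrt n}\Big)$$ and $$\frac{\mathbb{P}\big(\sum_{i=1}^n\eta_i<-x\sqrt n\big)}{\Phi(-x)}=1+O\Big((H+N)\frac{x^3}{\sqrt n}\Big)$$ as $n\to\infty$.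
   Context: For each $n$, $(\eta_i,\mathcal{F}_i)_{i=1,\dots,n}$ is a sequence of square integrable real martingale differences on a probability space $(\Omega,\mathcal{F},\mathbb{P})$: $\{\emptyset,\Omega\}=\mathcal{F}_0\subseteq\mathcal{F}_1\subseteq\dots\subseteq\mathcal{F}_n\subseteq\mathcal{F}$ are $\sigma$-fields, $\eta_i$ is $\mathcal{F}_i$-measurable and $\mathbb{E}(\eta_i|\mathcal{F}_{i-1})=0$. (In)equalities between random variables hold almost surely. $\Phi$ is the standard normal distribution function. Condition (A1$'$) (Bernstein's condition) with constant $H>0$: the moments exist and $|\mathbb{E}(\eta_i^k|\mathcal{F}_{i-1})|\le\frac12k!\,H^{k-2}\,\mathbb{E}(\eta_i^2|\mathcal{F}_{i-1})$ for all $k\ge3$ and $1\le i\le n$. Condition (A2$'$) with constant $N\ge0$: $\big|\sum_{i=1}^n\mathbb{E}(\eta_i^2|\mathcal{F}_{i-1})-n\big|\le N^2$. $H$ and $N$ are absolute constants, i.e. they do not depend on $n$. The notation $f=O(g)$ as $n\to\infty$, uniformly in $x$, means that there are $C$ and $n_0$, not depending on $x$ and $n$ (they may depend on $\alpha$, $H$, $N$ and the sequence $(b_n)$), such that $|f|\le Cg$ for all $n\ge n_0$ and all $x$ in the stated range. *)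

(* Defs.v *)
From HB Require Import structures.
From mathcomp Require Import all_boot all_order all_algebra.
From mathcomp Require Import all_classical all_reals all_analysis.
From mathcomp Require Import measurable_realfun random_variable normal_distribution.

Set Implicit Arguments.
Unset Strict Implicit.
Unset Printing Implicit Defensive.

Import Order.TTheory GRing.Theory Num.Theory.
Import numFieldNormedType.Exports.

Local Open Scope classical_set_scope.
Local Open Scope ring_scope.

(* A sub-sigma-algebra of T is a family G : set (set T) with
   sigma_algebra setT G and G `<=` measurable; the measurable sets of
   g_sigma_algebraType G are those of <<s G >>, which is then G itself. *)

Definition is_condexp d (T : measurableType d) (R : realType)
    (P : probability T R) (G : set (set T)) (X Y : T -> R) : Prop :=
  [/\ measurable_fun [set: g_sigma_algebraType G]
        (Y : g_sigma_algebraType G -> R),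
      P.-integrable [set: T] (EFin \o Y) &
      forall A, G A ->
        (\int[P]_(w in A) (Y w)%:E = \int[P]_(w in A) (X w)%:E)%E].

(* The value is a chosen version: for integrable X one exists (condexpP), and
   any two agree almost surely (is_condexp_uniq). *)
Definition condexp d (T : measurableType d) (R : realType)
    (P : probability T R) (G : set (set T)) (X : T -> R) : T -> R :=
  xget (cst 0) [set Y | is_condexp P G X Y].

Section condexp_theory.
Context d (T : measurableType d) (R : realType) (P : probability T R).
Variables (G : set (set T)) (sG : sigma_algebra [set: T] G).
Hypothesis GT : G `<=` measurable.

Local Notation S := (g_sigma_algebraType G).
Let toS (w : T) : S := w.

Let mSE : (measurable : set (set S)) = G.
Proof. exact: (measurable_g_measurableTypeE sG). Qed.

Let mtoS : measurable_fun setT toS.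
Proof. by move=> _ Y; rewrite mSE setTI => /GT. Qed.

Let toS_mfun : {mfun T >-> S} :=
  HB.pack toS (isMeasurableFun.Build _ _ _ _ toS mtoS).

Let mu : probability S R := distribution P toS_mfun.

Let measurable_G A : G A -> measurable (A : set S).
Proof. by rewrite mSE. Qed.

Let integrable_mu (Y : S -> \bar R) : measurable_fun [set: S] Y ->
  P.-integrable [set: T] Y -> mu.-integrable [set: S] Y.
Proof. by move=> mY iY; exact: integrable_pushforward. Qed.

Let integral_mu (Y : S -> \bar R) A : measurable_fun [set: S] Y ->
    P.-integrable [set: T] Y -> G A ->
  (\int[mu]_(w in A) Y w = \int[P]_(w in A) Y w)%E.
Proof.
move=> mY iY GA; rewrite [LHS]integral_pushforward//; last exact: measurable_G.
by apply: (integrableS measurableT) => //; exact: GT.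
Qed.

Lemma condexpP (X : T -> R) : P.-integrable [set: T] (EFin \o X) ->
  is_condexp P G X (condexp P G X).
Proof.
move=> iX; rewrite /condexp; case: xgetP => [Y _ //|noY]; exfalso.
pose nu : {charge set T -> \bar R} := induced_charge iX.
have nuP : nu `<< P.
  apply/null_content_dominatesP => A mA PA0.
  apply: null_set_integral => //.
  by apply: measurable_funTS; exact: measurable_int iX.
have S_T A : measurable (A : set S) -> measurable (A : set T).
  by rewrite mSE => /GT.
have nu_fin A : measurable (A : set S) -> nu A \is a fin_num.
  by move=> /S_T mA; exact: fin_num_measure.
have nu_add : semi_sigma_additive (nu : set S -> \bar R).
  move=> A mA tA mUA; apply: charge_semi_sigma_additive => //.
    by move=> i; apply: S_T; exact: mA.
  exact: S_T.
pose nuS_mixin := isCharge.Build _ S R nu (charge0 nu) nu_fin nu_add.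
pose nuS : {charge set S -> \bar R} :=
  HB.pack (nu : set S -> \bar R) nuS_mixin.
have nuSmu : nuS `<< mu.
  apply/null_content_dominatesP => A mA A0.
  by move/null_content_dominatesP : nuP; apply => //; exact: S_T.
pose f := Radon_Nikodym nuS mu.
have ff w : f w \is a fin_num by exact: Radon_Nikodym_fin_num.
have fE : EFin \o (fine \o f) = f.
  by apply/funext => w /=; rewrite fineK.
have fi : mu.-integrable [set: S] f by exact: Radon_Nikodym_integrable.
have mf : measurable_fun [set: S] f := measurable_int _ fi.
have Pf : P.-integrable [set: T] (f : T -> \bar R).
  apply/integrableP; split.
    move=> _ B mB; rewrite setTI; apply: GT; rewrite -mSE -[X in measurable X]setTI.
    exact: mf.
  case/integrableP : fi => _; apply: le_lt_trans.
  rewrite [leRHS]ge0_integral_pushforward//.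
  exact: measurableT_comp.
apply: (noY (fine \o f)); split.
- exact: measurableT_comp.
- by rewrite fE.
- move=> A GA; transitivity (\int[P]_(w in A) f w)%E.
    by apply: eq_integral => w _ /=; rewrite fineK.
  rewrite -integral_mu// -Radon_Nikodym_integral//; exact: measurable_G.
Qed.

Lemma is_condexp_uniq (X Y Z : T -> R) :
    is_condexp P G X Y -> is_condexp P G X Z ->
  {ae P, forall w, Y w = Z w}.
Proof.
move=> [mY iY YE] [mZ iZ ZE].
have mYS : measurable_fun [set: S] (EFin \o Y : S -> \bar R).
  exact/measurable_EFinP.
have mZS : measurable_fun [set: S] (EFin \o Z : S -> \bar R).
  exact/measurable_EFinP.
have [||N [mN N0 YZ]] := @integral_ae_eq _ S R mu setT measurableT
    (EFin \o Z : S -> \bar R) (EFin \o Y : S -> \bar R) _ mZS.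
- exact: integrable_mu.
- by move=> A _; rewrite mSE => GA; rewrite !integral_mu// YE// ZE.
exists N; split => //; first by apply: GT; rewrite -mSE.
by move=> w /= YZw; apply: YZ => /= /(_ I) [].
Qed.

End condexp_theory.

(* Only the indices i <= n of F and 1 <= i <= n of eta are used. *)
Definition martingale_differences d (T : measurableType d) (R : realType)
    (P : probability T R) (n : nat) (F : nat -> set (set T))
    (eta : nat -> T -> R) : Prop :=
  [/\ F 0%N = [set set0; [set: T]],
      forall i, (i <= n)%N ->
        sigma_algebra [set: T] (F i) /\ F i `<=` measurable,
      forall i, (i < n)%N -> F i `<=` F i.+1 &
      forall i, (1 <= i <= n)%N ->
        [/\ measurable_fun [set: g_sigma_algebraType (F i)]
              (eta i : g_sigma_algebraType (F i) -> R),
            P.-integrable [set: T] (fun w => (eta i w ^+ 2)%:E) &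
            {ae P, forall w, condexp P (F i.-1) (eta i) w = 0}]].

Definition bernstein_condition d (T : measurableType d) (R : realType)
    (P : probability T R) (n : nat) (F : nat -> set (set T))
    (eta : nat -> T -> R) (H : R) : Prop :=
  forall i k, (1 <= i <= n)%N -> (3 <= k)%N ->
    P.-integrable [set: T] (fun w => (eta i w ^+ k)%:E) /\
    {ae P, forall w,
      `|condexp P (F i.-1) (fun v => eta i v ^+ k) w| <=
      2^-1 * k`!%:R * H ^+ (k - 2) *
        condexp P (F i.-1) (fun v => eta i v ^+ 2) w}.

Definition bounded_variance_deviation d (T : measurableType d) (R : realType)
    (P : probability T R) (n : nat) (F : nat -> set (set T))
    (eta : nat -> T -> R) (N : R) : Prop :=
  {ae P, forall w,
    `|\sum_(1 <= i < n.+1) condexp P (F i.-1) (fun v => eta i v ^+ 2) w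
      - n%:R| <= N ^+ 2}.

Definition std_normal_cdf (R : realType) (x : R) : R :=
  fine (normal_prob (0 : R) 1 `]-oo, x]).

(* Main.v *)
From HB Require Import structures.
Require Import Defs.
From mathcomp Require Import all_boot all_order all_algebra.
From mathcomp Require Import all_classical all_reals all_analysis.
From mathcomp Require Import measurable_realfun random_variable normal_distribution.
From mathcomp Require Import ring lra.

Set Implicit Arguments.
Unset Strict Implicit.
Unset Printing Implicit Defensive.

Import Order.TTheory GRing.Theory Num.Theory.
Import numFieldNormedType.Exports.

Local Open Scope classical_set_scope.
Local Open Scope ring_scope.

(** Write [S i] for the partial sums of [eta], [V i] for the partial sums of the
    conditional variances and [lam = x / sqrt n].  The proof replaces the
    increments one by one by Gaussian ones, in the clock of the conditional
    variance.  The function [Phi (y / sqrt t)] solves the backward heat equation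
    [U_t = U_yy / 2], so along the points
    [t = n + N ^ 2 + t0 - V i], [y = S i - x * sqrt n] the conditional mean of
    its first and second order variation vanishes: the increment has
    conditional mean [0], and its conditional variance is exactly the time
    consumed.  At the last step the remaining time is between [t0] and
    [t0 + 2 * N ^ 2], and the function is close to the indicator of the event
    [y > 0]; at the first step it is close to [Phi (- x)].

    What remains of one step are the terms of third order in the increment and
    of second order in time.  They have to be small compared with [Phi (- x)],
    which tends to [0].  So a multiple of a barrier [W] is added to [Phi], a
    positive function with [W_t >= W_yy / 2 + source / 4], where [source]
    controls the third space derivative and the second time derivative of both
    [Phi] and [W].  The barrier ([barrier_jet]) is built from kernels with the
    exponential tilt [lam * y + lam ^ 2 * t / 2], which is the tilt of Cramer's
    change of measure, and from the heat kernel times [ln t].  Its own errors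
    are [defect] times the source, and [defect] is small once
    [x ^ 3 / sqrt n] is small ([defect_le]): this is where [x = o(n ^ (1/6))]
    enters.  The jumps are handled by [exp_moment], which says that the
    conditional mean of [eta ^ 2 * exp (mu * |eta|)] is at most [6] times the
    conditional variance, and by [condexp_sqr_le], which bounds the conditional
    variance by [12 * H ^ 2].

    Consequently [Phi + B * W] and [(1 - Phi) + B * W] both decrease in mean
    along the martingale ([one_step], [comparison_integral]).  At the last step
    they are at least [1] on the events [y > 0] and [y <= 0] respectively, so
    they bound the probabilities of these events by their initial values
    ([comparison_probability]): one estimate from above and one from below.
    The initial value of [W] is at most a constant times
    [(x ^ 2 + ln n) * exp (- x ^ 2 / 2) / sqrt n] ([barrier_start]).  The
    hypothesis [x >= alpha * sqrt (ln n)] absorbs [ln n] into [x ^ 2]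
    ([right_tail_estimate]), and the lower bound of Mills' ratio
    ([Phi_ge_gauss]) turns [x ^ 2] into a relative error of order
    [x ^ 3 / sqrt n].  The left tail is the right tail of [- eta]. *)

(** * Pulling bounded factors out of conditional expectations *)

(** The integer part of [v], capped at [n], as a sum of indicators: multiplied by
    another function it can be integrated one level set of [v] at a time. *)
Definition unit_steps (R : realType) (n : nat) (v : R) : R :=
  \sum_(j < n) ((j.+1)%:R <= v)%R%:R.

Lemma unit_steps_full (R : realType) (n : nat) (v : R) :
  n%:R <= v -> unit_steps n v = n%:R.
Proof.
elim: n v => [|n IH] v nv; first by rewrite /unit_steps big_ord0.
rewrite /unit_steps big_ord_recr/= -/(unit_steps n v) nv IH ?natr1//.
by apply: le_trans nv; rewrite ler_nat.
Qed.

Lemma unit_steps_approx (R : realType) (n : nat) (v : R) :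
  0 <= v -> v < n.+1%:R -> `|v - unit_steps n v| <= 1.
Proof.
elim: n v => [|n IH] v v0 vn.
  by rewrite /unit_steps big_ord0 subr0 ger0_norm// ltW.
have [nv|nv] := leP (n.+1%:R) v.
  rewrite unit_steps_full// ger0_norm ?subr_ge0//.
  by rewrite lerBlDl natr1 ltW.
rewrite /unit_steps big_ord_recr/=; move: (nv); rewrite ltNge => nv1.
rewrite (negbTE nv1) addr0 -/(unit_steps n v).
exact: IH.
Qed.

Section conditional.
Context d (T : measurableType d) (R : realType) (P : probability T R).

Lemma integrable_EFinZ (k : R) (f : T -> R) :
  P.-integrable setT (EFin \o f) ->
  P.-integrable setT (EFin \o (fun w => k * f w)).
Proof. by move=> h; exact: (integrableZl measurableT k h). Qed.

Lemma integrable_EFinD (f g : T -> R) :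
  P.-integrable setT (EFin \o f) -> P.-integrable setT (EFin \o g) ->
  P.-integrable setT (EFin \o (fun w => f w + g w)).
Proof. by move=> h k; exact: (integrableD measurableT h k). Qed.

Lemma integrable_EFinB (f g : T -> R) :
  P.-integrable setT (EFin \o f) -> P.-integrable setT (EFin \o g) ->
  P.-integrable setT (EFin \o (fun w => f w - g w)).
Proof. by move=> h k; exact: (integrableB measurableT h k). Qed.

Definition measurable_wrt (G : set (set T)) (f : T -> R) : Prop :=
  measurable_fun [set: g_sigma_algebraType G] (f : g_sigma_algebraType G -> R).

Variables (G : set (set T)) (sG : sigma_algebra [set: T] G).
Hypothesis GT : G `<=` measurable.

Lemma measurable_wrt_preimage f B : measurable_wrt G f -> measurable B ->
  G (f @^-1` B).
Proof.
move=> mf mB; have := mf measurableT _ mB; rewrite setTI.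
by rewrite (measurable_g_measurableTypeE sG).
Qed.

Lemma measurable_wrtW f : measurable_wrt G f -> measurable_fun setT f.
Proof.
by move=> mf _ B mB; rewrite setTI; apply: GT; exact: measurable_wrt_preimage.
Qed.

Lemma integrableM_bounded (xi X : T -> R) (M : R) :
  measurable_fun setT xi -> (forall w, `|xi w| <= M) ->
  P.-integrable setT (EFin \o X) ->
  P.-integrable setT (EFin \o (fun w => xi w * X w)).
Proof.
move=> mxi xiM iX.
have mX : measurable_fun setT X by exact/measurable_EFinP/(measurable_int _ iX).
have iMX : P.-integrable setT (fun w => M%:E * (EFin \o X) w)%E.
  exact: integrableZl.
apply: (le_integrable measurableT _ _ iMX).
  by apply/measurable_EFinP; exact: measurable_funM.
move=> w _ /=; rewrite lee_fin !normrM ler_wpM2r//.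
by rewrite (le_trans (xiM w))// ler_norm.
Qed.

Lemma Rintegral_indic_mul (A : set T) (X : T -> R) : measurable A ->
  \int[P]_w (\1_A w * X w) = \int[P]_(w in A) X w.
Proof.
move=> mA; rewrite [RHS]Rintegral_mkcond; congr fine; apply: eq_integral => w _.
by rewrite patchE indicE; case: ifPn => _; rewrite ?mul1r ?mul0r.
Qed.

Lemma Rintegral_sum_mul (X : T -> R) (n : nat) (h : 'I_n -> T -> R) :
  (forall j, measurable_fun setT (h j)) ->
  (forall j w, `|h j w| <= 1) ->
  P.-integrable setT (EFin \o X) ->
  \int[P]_w ((\sum_(j < n) h j w) * X w) =
  \sum_(j < n) \int[P]_w (h j w * X w).
Proof.
move=> mh hb iX; elim: n h mh hb => [|n IH] h mh hb.
  rewrite big_ord0 (_ : (fun _ => _) = cst 0) ?Rintegral_cst ?mul0r//.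
  by apply/funext => w; rewrite big_ord0 mul0r.
rewrite big_ord_recr/= -IH//.
rewrite -RintegralD//.
- by apply: eq_Rintegral => w _; rewrite big_ord_recr/= mulrDl.
- apply: (@integrableM_bounded _ _ (n%:R)) => //.
  + by apply: measurable_sum => i; exact: mh.
  + move=> w; apply: (le_trans (ler_norm_sum _ _ _)).
    rewrite (le_trans (ler_sum _ (fun i _ => hb _ w)))//.
    by rewrite sumr_const card_ord.
- exact: (@integrableM_bounded _ _ 1).
Qed.

(** Discretizing [xi] in steps of size [1 / m] reduces the identity to the sets of
    [G], where it is the definition of the conditional expectation; the error is
    at most the integral of [|X| + |Y|] divided by [m]. *)
Lemma pullout_ge0 (X Y xi : T -> R) (M : R) :
  P.-integrable setT (EFin \o X) -> is_condexp P G X Y ->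
  measurable_wrt G xi -> (forall w, 0 <= xi w <= M) ->
  \int[P]_w (xi w * X w) = \int[P]_w (xi w * Y w).
Proof.
move=> iX [mY iY XY] mxi xib.
have mxiT := measurable_wrtW mxi.
have [K MK] : exists K : nat, M < K%:R.
  by exists (Num.truncn M).+1; exact: truncnS_gt.
pose z m w := m.+1%:R^-1 * unit_steps (m.+1 * K) (m.+1%:R * xi w).
have m0 m : 0 < m.+1%:R :> R by [].
have zxi m w : `|xi w - z m w| <= m.+1%:R^-1.
  have mn0 : m.+1%:R != 0 :> R by rewrite gt_eqF.
  rewrite /z -[X in X - _](mulKf mn0 (xi w)) -mulrBr normrM.
  rewrite gtr0_norm ?invr_gt0// ler_piMr ?invr_ge0//.
  have /andP[x0 xM] := xib w.
  apply: unit_steps_approx; first by rewrite mulr_ge0.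
  apply: (@lt_le_trans _ _ (m.+1%:R * K%:R)).
    by rewrite ltr_pM2l// (le_lt_trans xM).
  by rewrite -natrM ler_nat leqnSn.
have GA m (j : nat) : G [set w | j.+1%:R <= m.+1%:R * xi w].
  rewrite (_ : mkset _ = xi @^-1` `[j.+1%:R / m.+1%:R, +oo[%classic).
    exact: measurable_wrt_preimage.
  by apply/seteqP; split=> w /=; rewrite in_itv/= andbT ler_pdivrMr// mulrC.
have mz m : measurable_fun setT (z m).
  apply: measurable_funM => //; apply: measurable_sum => j.
  rewrite (_ : (fun _ => _) = \1_[set w | j.+1%:R <= m.+1%:R * xi w]).
    by apply: measurable_indic; exact: GT.
  by apply/funext => w; rewrite indicE mem_setE.
have zE m (Z : T -> R) : P.-integrable setT (EFin \o Z) ->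
    \int[P]_w (z m w * Z w) = m.+1%:R^-1 * \sum_(j < m.+1 * K)
      \int[P]_(w in [set w | j.+1%:R <= m.+1%:R * xi w]) Z w.
  move=> iZ.
  have -> : \sum_(j < m.+1 * K)
      \int[P]_(w in [set w | j.+1%:R <= m.+1%:R * xi w]) Z w =
    \sum_(j < m.+1 * K)
      \int[P]_w (\1_[set w | j.+1%:R <= m.+1%:R * xi w] w * Z w).
    by apply: eq_bigr => j _; rewrite Rintegral_indic_mul//; exact: GT.
  rewrite -Rintegral_sum_mul//; last 2 first.
  - by move=> j; apply: measurable_indic; exact: GT.
  - by move=> j w; rewrite indicE; case: (_ \in _); rewrite ?normr1 ?normr0.
  rewrite -RintegralZl//; last first.
    apply: (@integrableM_bounded _ _ ((m.+1 * K)%:R)) => //.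
      by apply: measurable_sum => j; apply: measurable_indic; exact: GT.
    move=> w; apply: (le_trans (ler_norm_sum _ _ _)).
    apply: (@le_trans _ _ (\sum_(j < m.+1 * K) 1)); last first.
      by rewrite sumr_const card_ord.
    apply: ler_sum => j _.
    by rewrite indicE; case: (_ \in _); rewrite ?normr1 ?normr0.
  apply: eq_Rintegral => w _; rewrite /z /unit_steps -mulrA; congr (_ * (_ * _)).
  apply: eq_bigr => j _; rewrite indicE.
  by congr (_ %:R); rewrite mem_setE.
have zb m w : `|z m w| <= M + 1.
  have /andP[x0 xM] := xib w.
  have := zxi m w; rewrite ler_norml => /andP[h1 h2].
  have : m.+1%:R^-1 <= 1 :> R by rewrite invf_le1// ler1n.
  move: (z m w) (m.+1%:R^-1) h1 h2 => a c h1 h2 h3.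
  by rewrite ler_norml; apply/andP; split; lra.
have zXY m : \int[P]_w (z m w * X w) = \int[P]_w (z m w * Y w).
  rewrite !zE//; congr (_ * _); apply: eq_bigr => j _.
  rewrite /Rintegral XY//.
have xb w : `|xi w| <= M by have /andP[? ?] := xib w; rewrite ger0_norm.
have dist m (Z : T -> R) : P.-integrable setT (EFin \o Z) ->
    `|\int[P]_w (xi w * Z w) - \int[P]_w (z m w * Z w)|
      <= m.+1%:R^-1 * \int[P]_w `|Z w|.
  move=> iZ.
  have i1 := integrableM_bounded mxiT xb iZ.
  have i2 := integrableM_bounded (mz m) (zb m) iZ.
  rewrite -RintegralB//.
  apply: (le_trans (le_normr_Rintegral _ _)) => //.
    exact: integrable_EFinB.
  rewrite -RintegralZl//; last exact: integrable_norm.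
  apply: le_Rintegral => //.
  - apply: integrable_norm => //.
    exact: integrable_EFinB.
  - by apply: integrable_EFinZ; exact: integrable_norm.
  - by move=> w _; rewrite -mulrBl normrM ler_wpM2r.
have key m : `|\int[P]_w (xi w * X w) - \int[P]_w (xi w * Y w)|
    <= m.+1%:R^-1 * (\int[P]_w `|X w| + \int[P]_w `|Y w|).
  have h1 := dist m _ iX; have h2 := dist m _ iY.
  rewrite zXY in h1.
  rewrite mulrDr; apply: le_trans (lerD h1 h2).
  rewrite -[X in _ <= _ + X]normrN.
  apply: le_trans (ler_normD _ _).
  by rewrite le_eqVlt; apply/orP; left; apply/eqP; congr (`| _ |); ring.
apply/eqP; rewrite -subr_eq0 -normr_le0.
set A := \int[P]_w `|X w| + _ in key.
set D := `| _ | in key *.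
have A0 : 0 <= A by rewrite addr_ge0// Rintegral_ge0.
rewrite leNgt; apply/negP => D0.
pose m := Num.truncn (A / D).
have := key m; have := truncnS_gt (A / D); rewrite -/m.
rewrite ltr_pdivrMr// => h; rewrite leNgt => /negP; apply.
by rewrite mulrC ltr_pdivrMr// mulrC.
Qed.

Lemma pullout (X Y xi : T -> R) (M : R) :
  P.-integrable setT (EFin \o X) -> is_condexp P G X Y ->
  measurable_wrt G xi -> (forall w, `|xi w| <= M) ->
  \int[P]_w (xi w * X w) = \int[P]_w (xi w * Y w).
Proof.
move=> iX XY mxi xib.
have mxiT := measurable_wrtW mxi.
have [_ iY _] := XY.
have h : \int[P]_w ((xi w + M) * X w) = \int[P]_w ((xi w + M) * Y w).
  apply: (@pullout_ge0 _ _ _ (M + M)) => //.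
    by apply: measurable_funD => //.
  move=> w; have := xib w; rewrite ler_norml => /andP[h1 h2].
  apply/andP; split; lra.
have h1 : \int[P]_w ((cst M) w * X w) = \int[P]_w ((cst M) w * Y w).
  rewrite /= !RintegralZl//; congr (_ * _).
  have [_ _ e] := XY.
  rewrite /Rintegral e//.
  by rewrite (_ : setT = xi @^-1` setT)//; exact: measurable_wrt_preimage.
have sp Z : P.-integrable setT (EFin \o Z) ->
    \int[P]_w ((xi w + M) * Z w) =
    \int[P]_w (xi w * Z w) + \int[P]_w (cst M w * Z w).
  move=> iZ; rewrite -RintegralD//; last 2 first.
  - exact: integrableM_bounded xib iZ.
  - by apply: (@integrableM_bounded _ _ `|M|).
  by apply: eq_Rintegral => w _; rewrite mulrDl.
by move: h; rewrite !sp// h1 => /addIr.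
Qed.

End conditional.

(** * Conditional moments under Bernstein's condition *)

Section conditional_moments.
Context d (T : measurableType d) (R : realType) (P : probability T R).

Lemma le_Rintegral_ae (f g : T -> R) :
  P.-integrable setT (EFin \o f) -> P.-integrable setT (EFin \o g) ->
  {ae P, forall w, f w <= g w} -> \int[P]_w f w <= \int[P]_w g w.
Proof.
move=> i1 i2 fg.
have m1 : measurable_fun setT f by exact/measurable_EFinP/(measurable_int _ i1).
have m2 : measurable_fun setT g by exact/measurable_EFinP/(measurable_int _ i2).
have mm : measurable_fun setT (fun w => Num.max (f w) (g w)).
  exact: measurable_maxr.
have im : P.-integrable setT (EFin \o (fun w => Num.max (f w) (g w))).
  have i3 : P.-integrable setT (EFin \o (fun w => `|f w| + `|g w|)).
    by apply: integrable_EFinD; exact: integrable_norm.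
  apply: (le_integrable measurableT _ _ i3); first exact/measurable_EFinP.
  move=> w _ /=; rewrite lee_fin (ger0_norm (addr_ge0 _ _))//.
  by rewrite maxEle; case: ifP => _; rewrite ?lerDr ?lerDl.
rewrite [leRHS](_ : _ = \int[P]_w (Num.max (f w) (g w))).
  by apply: le_Rintegral => // w _; rewrite le_max lexx.
congr fine; apply: ae_eq_integral => //; [exact/measurable_EFinP|exact/measurable_EFinP|].
apply: filterS fg => w fgw _ /=; congr EFin.
by rewrite max_r.
Qed.

Lemma integrable_of_sqr (X : T -> R) : measurable_fun setT X ->
  P.-integrable setT (fun w => (X w ^+ 2)%:E) ->
  P.-integrable setT (EFin \o X).
Proof.
move=> mX iX2.
have i1 : P.-integrable setT (EFin \o (cst 1 : T -> R)).
  exact: finite_measure_integrable_cst.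
have i2 := integrable_EFinD i1 iX2.
apply: (le_integrable measurableT _ _ i2); first exact/measurable_EFinP.
move=> w _ /=; rewrite lee_fin (ger0_norm (addr_ge0 _ (sqr_ge0 _)))//.
rewrite -(real_normK (num_real (X w))).
move: (`|X w|) => a; have := sqr_ge0 (a - 1); rewrite sqrrB1; nra.
Qed.

Variables (G : set (set T)) (sG : sigma_algebra [set: T] G).
Hypothesis GT : G `<=` measurable.

Lemma measurable_wrt_indic (A : set T) : G A ->
  measurable_wrt G (\1_A : T -> R).
Proof.
move=> GA; apply: (@measurable_indic _ (g_sigma_algebraType G) R setT A).
by rewrite (measurable_g_measurableTypeE sG).
Qed.

Lemma measurable_condexp (X : T -> R) : P.-integrable setT (EFin \o X) ->
  measurable_wrt G (condexp P G X).
Proof. by move=> iX; have [] := condexpP sG GT iX. Qed.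

Lemma integrable_condexp (X : T -> R) : P.-integrable setT (EFin \o X) ->
  P.-integrable setT (EFin \o condexp P G X).
Proof. by move=> iX; have [] := condexpP sG GT iX. Qed.

Variables (X : T -> R) (H : R).
Hypothesis mX : measurable_fun setT X.
Hypothesis iX2 : P.-integrable setT (fun w => (X w ^+ 2)%:E).
Hypothesis H0 : 0 < H.
Hypothesis X0 : {ae P, forall w, condexp P G X w = 0}.
Hypothesis bern : forall k, (3 <= k)%N ->
    P.-integrable [set: T] (fun w => (X w ^+ k)%:E) /\
    {ae P, forall w, `|condexp P G (fun v => X v ^+ k) w| <=
      2^-1 * k`!%:R * H ^+ (k - 2) * condexp P G (fun v => X v ^+ 2) w}.

Let s2 := condexp P G (fun v => X v ^+ 2).

Let is2 : P.-integrable setT (EFin \o s2).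
Proof. exact: integrable_condexp. Qed.

Let ms2 : measurable_wrt G s2.
Proof. exact: measurable_condexp. Qed.

Let iXk k : (2 <= k)%N -> P.-integrable setT (EFin \o (fun w => X w ^+ k)).
Proof.
rewrite leq_eqVlt => /orP[/eqP <-//|k3].
by have [] := bern k3.
Qed.

Lemma condexp_sqr_ge0 : {ae P, forall w, 0 <= s2 w}.
Proof.
have [_ h] := bern (isT : (3 <= 3)%N).
apply: filterS h => w; rewrite -/s2 => /(le_trans (normr_ge0 _)).
rewrite pmulr_rge0//.
by rewrite !mulr_gt0 ?invr_gt0 ?exprn_gt0// ltr0n fact_gt0.
Qed.

Lemma condexp_mean0 (xi : T -> R) M : measurable_wrt G xi ->
  (forall w, `|xi w| <= M) -> \int[P]_w (xi w * X w) = 0.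
Proof.
move=> mxi xib; have iX := integrable_of_sqr mX iX2.
have cX := condexpP sG GT iX.
rewrite (pullout sG GT iX cX mxi xib) /Rintegral.
rewrite (ae_eq_integral (cst 0%E)) ?integral0//.
- apply/measurable_EFinP; apply: measurable_funM; apply: (measurable_wrtW sG GT) => //.
  exact: measurable_condexp.
- by apply: filterS X0 => w -> _ /=; rewrite mulr0.
Qed.

Lemma condexp_var (xi : T -> R) M : measurable_wrt G xi ->
  (forall w, `|xi w| <= M) ->
  \int[P]_w (xi w * X w ^+ 2) = \int[P]_w (xi w * s2 w).
Proof.
by move=> mxi xib; apply: (pullout sG GT iX2 (condexpP sG GT iX2) mxi xib).
Qed.

Lemma signed_moment (xi : T -> R) M m : measurable_wrt G xi ->
  (forall w, 0 <= xi w <= M) -> (2 <= m)%N ->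
  \int[P]_w (xi w * X w ^+ m) <=
  2^-1 * m`!%:R * H ^+ (m - 2) * \int[P]_w (xi w * s2 w).
Proof.
move=> mxi xib; have xb w : `|xi w| <= M.
  by have /andP[? ?] := xib w; rewrite ger0_norm.
have mxiT := measurable_wrtW sG GT mxi.
rewrite leq_eqVlt => /orP[/eqP <-|m3].
  by rewrite (condexp_var mxi xb) expr0 mulr1 mulVf ?mul1r.
have [im bm] := bern m3.
rewrite (pullout sG GT im (condexpP sG GT im) mxi xb).
have ixs := integrableM_bounded mxiT xb is2.
rewrite -RintegralZl//.
apply: le_Rintegral_ae.
- by apply: integrableM_bounded mxiT xb _; exact: integrable_condexp.
- exact: integrable_EFinZ.
- apply: filterS bm => w h; have /andP[x0 _] := xib w.
  rewrite mulrCA; apply: ler_wpM2l => //; exact: le_trans (ler_norm _) h.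
Qed.

Let iaXk k : (2 <= k)%N -> P.-integrable setT (EFin \o (fun w => `|X w| ^+ k)).
Proof.
move=> k2; rewrite (_ : _ \o _ = EFin \o (fun w => `|X w ^+ k|)).
  by apply: integrable_norm => //; exact: iXk.
by apply/funext => w /=; rewrite normrX.
Qed.

(** Bernstein's condition says nothing about the absolute moments of odd order.
    They are interpolated between their even neighbours by
    [2 * a ^ m <= H * a ^ (m - 1) + a ^ (m + 1) / H], at the price of one more
    factor in the factorial. *)
Lemma abs_moment (xi : T -> R) M m : measurable_wrt G xi ->
  (forall w, 0 <= xi w <= M) -> (2 <= m)%N ->
  \int[P]_w (xi w * `|X w| ^+ m) <=
  2^-1 * m.+1`!%:R * H ^+ (m - 2) * \int[P]_w (xi w * s2 w).
Proof.
move=> mxi xib m2; have xb w : `|xi w| <= M.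
  by have /andP[? ?] := xib w; rewrite ger0_norm.
have mxiT := measurable_wrtW sG GT mxi.
set S := \int[P]_w (xi w * s2 w).
have S0 : 0 <= S.
  rewrite /S -(condexp_var mxi xb); apply: Rintegral_ge0 => w _.
  by apply: mulr_ge0; [have /andP[] := xib w|exact: sqr_ge0].
have [om|em] := boolP (odd m); last first.
  rewrite (_ : \int[P]_w _ = \int[P]_w (xi w * X w ^+ m)); last first.
    apply: eq_Rintegral => w _; rewrite -normrX ger0_norm//.
    exact: exprn_even_ge0.
  apply: le_trans (signed_moment mxi xib m2) _.
  rewrite -/S ler_wpM2r// ler_wpM2r ?exprn_ge0 ?(ltW H0)//.
  by rewrite ler_wpM2l ?invr_ge0// ler_nat factS leq_pmull.
have m3 : (3 <= m)%N by case: m m2 om => [|[|[|]]].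
have e1 := signed_moment mxi xib (_ : (2 <= m.-1)%N).
have e2 := signed_moment mxi xib (_ : (2 <= m.+1)%N).
have {}e1 := e1 ltac:(by case: m m3 {m2 om e1 e2} => [|[|[|]]]).
have {}e2 := e2 ltac:(by case: m m3 {m2 om e1 e2} => [|[|[|]]]).
have k1 : P.-integrable setT (EFin \o (fun w => xi w * X w ^+ m.-1)).
  apply: integrableM_bounded mxiT xb _; apply: iXk.
  by case: m m3 {m2 om e1 e2} => [|[|[|]]].
have k2 : P.-integrable setT (EFin \o (fun w => xi w * X w ^+ m.+1)).
  by apply: integrableM_bounded mxiT xb _; apply: iXk; rewrite ltnW.
apply: (@le_trans _ _ (\int[P]_w (2^-1 * H * (xi w * X w ^+ m.-1) +
    2^-1 * H^-1 * (xi w * X w ^+ m.+1)))).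
  apply: le_Rintegral => //.
  - by apply: integrableM_bounded mxiT xb _; exact: iaXk.
  - by apply: integrable_EFinD; apply: integrable_EFinZ.
  move=> w _; have /andP[x0 _] := xib w.
  rewrite !(mulrCA _ (xi w)) -mulrDr ler_wpM2l//.
  have -> : X w ^+ m.-1 = `|X w| ^+ m.-1.
    rewrite -normrX ger0_norm// exprn_even_ge0//.
    by case: m om {m2 m3 e1 e2 k1 k2} => [|m]//= /negPn.
  have -> : X w ^+ m.+1 = `|X w| ^+ m.+1.
    by rewrite -normrX ger0_norm// exprn_even_ge0//= om.
  case: m m3 {om m2 e1 e2 k1 k2} => [//|m] _ /=.
  have key (a : R) : 0 <= a ->
      a ^+ m.+1 <= 2^-1 * H * a ^+ m + 2^-1 * H^-1 * a ^+ m.+2.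
    move=> a0; have am0 : 0 <= a ^+ m by rewrite exprn_ge0.
    rewrite -subr_ge0 !exprS [leRHS](_ : _ = (2^-1 * H^-1) * (a - H) ^+ 2 * a ^+ m).
      apply: mulr_ge0 => //; apply: mulr_ge0; last exact: sqr_ge0.
      by rewrite mulr_ge0 ?invr_ge0 ?(ltW H0).
    by field; rewrite gt_eqF.
  exact: key.
rewrite RintegralD//; [|exact: integrable_EFinZ|exact: integrable_EFinZ].
rewrite !RintegralZl//.
have c0 : 0 <= 2^-1 * H by rewrite mulr_ge0 ?invr_ge0// ltW.
have c1 : 0 <= 2^-1 * H^-1 by rewrite mulr_ge0 ?invr_ge0// ltW.
apply: le_trans (lerD (ler_wpM2l c0 e1) (ler_wpM2l c1 e2)) _.
rewrite -/S.
case: m m3 {m2 om e1 e2 k1 k2} => [|[|[|m]]]// _.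
rewrite -[m.+3.-1]/m.+2 !subSS !subn0 !exprS !mulrA -mulrDl ler_wpM2r//.
rewrite [leLHS](_ : _ = 2^-1 * (H * H ^+ m) *
   (2^-1 * (m.+2)`!%:R + 2^-1 * (m.+4)`!%:R)); last by field; rewrite gt_eqF.
rewrite [leRHS](_ : _ = 2^-1 * (H * H ^+ m) * (m.+4)`!%:R); last by ring.
apply: ler_wpM2l.
  by rewrite !mulr_ge0 ?invr_ge0 ?exprn_ge0// ltW.
have : (m.+2)`!%:R <= (m.+4)`!%:R :> R
  by rewrite ler_nat; apply: leq_fact; exact: leq_trans (leqnSn _) (leqnSn _).
by move: (m.+2)`!%:R (m.+4)`!%:R => a b; lra.
Qed.

(** Small enough for the moment bounds to sum to a geometric series of ratio
    [1 / 2], since [(k + 3)! / k!] is at most [6 * 8 ^ k]. *)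
Definition exp_moment_rate : R := (16 * H)^-1.

Let mu := exp_moment_rate.

Let mu0 : 0 < mu.
Proof. by rewrite invr_gt0 mulr_gt0. Qed.

Let q k w := mu ^+ k / k`!%:R * `|X w| ^+ k.+2.

Let q_ge0 k w : 0 <= q k w.
Proof. by rewrite mulr_ge0 ?exprn_ge0// mulr_ge0 ?exprn_ge0 ?(ltW mu0)// invr_ge0. Qed.

Let mq k : measurable_fun setT (q k).
Proof.
apply: measurable_funM => //; apply: measurable_funX.
exact: measurableT_comp.
Qed.

Let q_sum w :
  (\sum_(k <oo) (q k w)%:E)%E = (X w ^+ 2 * expR (mu * `|X w|))%:E.
Proof.
apply/cvg_lim => //; rewrite (_ : (fun _ => _) =
    EFin \o (fun n => X w ^+ 2 * series (exp_coeff (mu * `|X w|)) n)).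
  apply: cvg_EFin; first by apply: nearW.
  apply: cvgMr; exact: is_cvg_series_exp_coeff.
apply/funext => n /=; rewrite sumEFin; congr EFin.
rewrite /series/= mulr_sumr; apply: eq_bigr => k _.
rewrite /q /exp_coeff/= exprMn -(real_normK (num_real (X w))) -addn2 exprD.
by ring.
Qed.

Lemma fact3_le k : (k.+3)`!%:R / k`!%:R <= 6 * 8 ^+ k :> R.
Proof.
have kf : 0 < k`!%:R :> R by rewrite ltr0n fact_gt0.
rewrite ler_pdivrMr// -natrX -!natrM ler_nat.
rewrite !factS mulnA mulnA leq_mul2r; apply/orP; right.
elim: k {kf} => [//|k IH]; rewrite expnS mulnCA.
apply: leq_trans (leq_mul (leqnn 8) IH).
rewrite -mulnA mulnC mulnCA leq_mul2l /= mulnS.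
by apply: (@leq_trans (8 + k)); [rewrite addnC -addn4 leq_add2l|rewrite leq_add2l leq_pmull].
Qed.

(** Sums [abs_moment] over the exponential series.  The bound is by the conditional
    variance itself, so that it can be paid for by the time that the step
    consumes. *)
Lemma exp_moment (xi : T -> R) M : measurable_wrt G xi ->
  (forall w, 0 <= xi w <= M) ->
  (\int[P]_w (xi w * (X w ^+ 2 * expR (mu * `|X w|)))%:E <=
  (6 * \int[P]_w (xi w * s2 w))%:E)%E.
Proof.
move=> mxi xib; have xb w : `|xi w| <= M.
  by have /andP[? ?] := xib w; rewrite ger0_norm.
have mxiT := measurable_wrtW sG GT mxi.
set S := \int[P]_w (xi w * s2 w).
have S0 : 0 <= S.
  rewrite /S -(condexp_var mxi xb); apply: Rintegral_ge0 => w _.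
  by apply: mulr_ge0; [have /andP[] := xib w|exact: sqr_ge0].
have x0 w : 0 <= xi w by have /andP[] := xib w.
rewrite (_ : (\int[P]_w _)%E = (\int[P]_w \sum_(k <oo) (xi w * q k w)%:E)%E).
  rewrite integral_nneseries//; last 2 first.
  - by move=> k; apply/measurable_EFinP; exact: measurable_funM.
  - by move=> k w _; rewrite lee_fin mulr_ge0.
  apply: lime_le.
    by apply: is_cvg_nneseries => k _ _; apply: integral_ge0 => w _; rewrite lee_fin mulr_ge0.
  apply: nearW => n.
  apply: (@le_trans _ _ (\sum_(0 <= k < n) (3 * 2^-1 ^+ k * S)%:E)%E).
    apply: lee_sum => k _.
    have ik : P.-integrable setT (EFin \o (fun w => xi w * `|X w| ^+ k.+2)).
      by apply: integrableM_bounded mxiT xb _; exact: iaXk.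
    have -> : (\int[P]_w (xi w * q k w)%:E =
        (mu ^+ k / k`!%:R * \int[P]_w (xi w * `|X w| ^+ k.+2))%:E)%E.
      rewrite -RintegralZl// /Rintegral fineK.
        by apply: eq_integral => w _; rewrite /q mulrCA.
      by apply: integrable_fin_num => //; exact: integrable_EFinZ.
    rewrite lee_fin.
    have c0 : 0 <= mu ^+ k / k`!%:R by rewrite mulr_ge0 ?exprn_ge0 ?(ltW mu0)// invr_ge0.
    apply: le_trans (ler_wpM2l c0 (abs_moment mxi xib (isT : (2 <= k.+2)%N))) _.
    rewrite -/S !mulrA ler_wpM2r// !subSS subn0.
    rewrite [leLHS](_ : _ = (mu * H) ^+ k / 2 * ((k.+3)`!%:R / k`!%:R)); last first.
      by rewrite exprMn; ring.
    have -> : mu * H = 16^-1 by rewrite /mu /exp_moment_rate; field; rewrite gt_eqF.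
    apply: le_trans (ler_wpM2l _ (fact3_le k)) _ => //.
    rewrite (_ : 2^-1 = 8 / 16 :> R); last by field.
    by rewrite exprMn le_eqVlt; apply/orP; left; apply/eqP; field.
  rewrite sumEFin lee_fin -mulr_suml ler_wpM2r// -mulr_sumr.
  have g : \sum_(0 <= k < n) 2^-1 ^+ k = 2 * (1 - 2^-1 ^+ n) :> R.
    elim: n => [|n IH]; first by rewrite big_nil expr0 subrr mulr0.
    by rewrite big_nat_recr//= IH exprS; field.
  have : 0 <= 2^-1 ^+ n :> R by rewrite exprn_ge0// invr_ge0.
  by rewrite g; lra.
apply: eq_integral => w _.
rewrite EFinM -q_sum -nneseriesZl//.
by move=> k _; rewrite lee_fin.
Qed.

(** The square of the conditional variance is at most the conditional fourth
    moment, which Bernstein's condition bounds by [12 * H ^ 2] times the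
    conditional variance. *)
Lemma condexp_sqr_le : {ae P, forall w, s2 w <= 12 * H ^+ 2}.
Proof.
pose c (m : nat) := 12 * H ^+ 2 + m.+1%:R^-1.
pose A m := [set w | c m <= s2 w].
have GA m : G (A m).
  rewrite (_ : A m = s2 @^-1` `[c m, +oo[%classic).
    exact: measurable_wrt_preimage.
  by apply/seteqP; split=> w /=; rewrite in_itv/= andbT.
have A0 m : P (A m) = 0%E.
  have mA := GT (GA m).
  have mi := measurable_wrt_indic (GA m).
  have ib w : 0 <= (\1_(A m) w : R) <= 1.
    by rewrite indicE; case: (_ \in _); rewrite ?lexx ?ler01.
  have ib' w : `|\1_(A m) w : R| <= 1.
    by have /andP[? ?] := ib w; rewrite ger0_norm.
  have mT := measurable_wrtW sG GT mi.
  have e4 := signed_moment mi ib (isT : (2 <= 4)%N).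
  have e2 := condexp_var mi ib'.
  set S := \int[P]_w (\1_(A m) w * s2 w) in e4 e2.
  have i1 : P.-integrable setT (EFin \o (cst 1 : T -> R)).
    exact: finite_measure_integrable_cst.
  have iA0 := integrableM_bounded mT ib' i1.
  have iA2 := integrableM_bounded mT ib' iX2.
  have iA4 := integrableM_bounded mT ib' (iXk (isT : (2 <= 4)%N)).
  have iAs := integrableM_bounded mT ib' is2.
  have PA : \int[P]_w (\1_(A m) w * cst 1 w) = fine (P (A m)).
    by rewrite Rintegral_indic_mul// Rintegral_cst// mul1r.
  have c0 : 0 < c m by rewrite addr_gt0 ?invr_gt0// mulr_gt0// exprn_gt0.
  have h1 : c m * fine (P (A m)) <= S.
    rewrite -PA -RintegralZl//; apply: le_Rintegral => //.
      exact: integrable_EFinZ.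
    move=> w _; rewrite /= mulr1 indicE; have [|_] := boolP (w \in A m).
      by rewrite inE mulr1 mul1r.
    by rewrite mulr0 mul0r.
  (* Cauchy-Schwarz on [A m], with the level [c m] as multiplier. *)
  have h2 : 0 <= \int[P]_w (\1_(A m) w * (X w ^+ 2 - c m) ^+ 2).
    apply: Rintegral_ge0 => w _; apply: mulr_ge0; last exact: sqr_ge0.
    by have /andP[] := ib w.
  have h3 : \int[P]_w (\1_(A m) w * (X w ^+ 2 - c m) ^+ 2) =
     \int[P]_w (\1_(A m) w * X w ^+ 4) - 2 * c m * S + c m ^+ 2 * fine (P (A m)).
    rewrite -e2 -PA -!RintegralZl// -RintegralB//; last exact: integrable_EFinZ.
    rewrite -RintegralD//; last 2 first.
    - by apply: integrable_EFinB => //; exact: integrable_EFinZ.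
    - exact: integrable_EFinZ.
    by apply: eq_Rintegral => w _ /=; ring.
  rewrite h3 in h2.
  have p0 : 0 <= fine (P (A m)) by rewrite fine_ge0.
  rewrite (_ : 4`! = 24)%N// (_ : (4 - 2)%N = 2)%N// in e4.
  have h4 : (c m * (m.+1%:R^-1)) * fine (P (A m)) <= 0.
    have m0 : 0 < m.+1%:R^-1 :> R by rewrite invr_gt0.
    have key (C p s e h E : R) : C = 12 * h + e -> 0 < C -> 0 < e ->
        C * p <= s -> E <= 2^-1 * 24 * h * s ->
        0 <= E - 2 * C * s + C ^+ 2 * p -> C * e * p <= 0.
      move=> CE C0 e0 k1 k2 k3.
      have : 0 <= (C + e) * (s - C * p).
        by rewrite mulr_ge0 ?subr_ge0// addr_ge0 ?ltW.
      by rewrite CE in k2 k3 *; nra.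
    exact: key (erefl : c m = _) c0 m0 h1 e4 h2.
  have : fine (P (A m)) <= 0.
    by move: h4; rewrite pmulr_rle0// mulr_gt0// invr_gt0.
  move=> p1; have : fine (P (A m)) = 0 by apply/eqP; rewrite eq_le p1.
  by move=> p2; rewrite -(fineK (fin_num_measure P _ mA)) p2.
have nA : P.-negligible (\bigcup_m A m).
  by apply: negligible_bigcup => m; apply/negligibleP; [exact: GT|exact: A0].
apply: negligibleS nA => w /= /negP; rewrite -ltNge => h.
have [m hm] : exists m : nat, (s2 w - 12 * H ^+ 2)^-1 < m.+1%:R.
  by eexists; exact: truncnS_gt.
exists m => //; rewrite /A /c /=.
have d0 : 0 < s2 w - 12 * H ^+ 2 by rewrite subr_gt0.
have := hm; rewrite -ltf_pV2 ?posrE ?invr_gt0// invrK => h5.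
by rewrite -lerBrDl ltW.
Qed.

End conditional_moments.

(** * Taylor estimates from the mean value theorem *)

Section mean_value.
Context {R : realType}.
Implicit Types f df : R -> R.

Lemma mean_value f df (a b : R) :
  (forall x, Num.min a b <= x <= Num.max a b -> is_derive x 1 f (df x)) ->
  exists2 c, Num.min a b <= c <= Num.max a b & f b - f a = df c * (b - a).
Proof.
wlog ab : a b / a <= b => [th|].
  case/orP: (le_total a b) => [/th//|ba h].
  have [|c cab e] := th b a ba; first by rewrite minC maxC.
  by exists c; [rewrite minC maxC|rewrite -opprB e -mulrN opprB].
rewrite min_l// max_r// => h.
have [||c cab e] := @MVT_segment _ f df a b ab.
- by move=> x; rewrite in_itv/= => /andP[ax xb]; apply: h; rewrite !ltW.
- apply: derivable_within_continuous => x; rewrite in_itv/= => xab.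
  by have [] := h x xab.
- by exists c => //; move: cab; rewrite in_itv.
Qed.

(** Three applications of the mean value theorem give the cubic remainder without
    continuity of the third derivative, at the price of the factor [1 / 6]. *)
Lemma taylor3 (f f1 f2 f3 : R -> R) (h M : R) :
  (forall u : R, `|u| <= `|h| -> is_derive u 1 f (f1 u)) ->
  (forall u : R, `|u| <= `|h| -> is_derive u 1 f1 (f2 u)) ->
  (forall u : R, `|u| <= `|h| -> is_derive u 1 f2 (f3 u)) ->
  (forall u : R, `|u| <= `|h| -> `|f3 u| <= M) ->
  `|f h - (f 0 + f1 0 * h + f2 0 / 2 * h ^+ 2)| <= M * `|h| ^+ 3.
Proof.
move=> d1 d2 d3 fM.
have btw (u x : R) : `|u| <= `|h| -> Num.min 0 u <= x <= Num.max 0 u ->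
    `|x| <= `|u| /\ `|x| <= `|h|.
  move=> uh /andP[h1 h2]; suff xu : `|x| <= `|u| by split=> //; exact: le_trans uh.
  have [u0|u0] := leP 0 u.
    by move: h1 h2; rewrite min_l// max_r// => h1 h2; rewrite !ger0_norm.
  move: h1 h2; rewrite min_r ?(ltW u0)// max_l ?(ltW u0)// => h1 h2.
  by rewrite !ler0_norm ?lerN2// ltW.
have M0 : 0 <= M by apply: le_trans (fM 0 _); rewrite ?normr0.
have s2 u : `|u| <= `|h| -> `|f2 u - f2 0| <= M * `|u|.
  move=> uh; have [x hx|c hc ->] := @mean_value f2 f3 0 u.
    by apply: d3; have [] := btw _ _ uh hx.
  rewrite subr0 normrM ler_wpM2r//; apply: fM.
  by have [] := btw _ _ uh hc.
have s1 u : `|u| <= `|h| -> `|f1 u - f1 0 - f2 0 * u| <= M * `|u| ^+ 2.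
  move=> uh; have [x hx|c hc] :=
      @mean_value (fun v => f1 v - f2 0 * v) (fun v => f2 v - f2 0) 0 u.
    have dx := d2 _ (btw _ _ uh hx).2.
    apply: is_deriveB; rewrite -[X in is_derive _ _ _ X]mulr1.
    exact: is_deriveZ.
  rewrite mulr0 !subr0 => e.
  have -> : f1 u - f1 0 - f2 0 * u = (f2 c - f2 0) * u by rewrite -e; ring.
  have [h1 h2] := btw _ _ uh hc.
  rewrite normrM expr2 mulrA ler_wpM2r//.
  apply: le_trans (s2 _ h2) _; exact: ler_wpM2l.
have [x hx|c hc] := @mean_value (fun v => f v - f1 0 * v - f2 0 / 2 * v ^+ 2)
   (fun v => f1 v - f1 0 - f2 0 * v) 0 h.
  have dx := d1 _ (btw _ _ (lexx _) hx).2.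
  apply: is_deriveB; first apply: is_deriveB.
    by rewrite -[X in is_derive _ _ _ X]mulr1; apply: is_deriveZ.
  apply: is_derive_eq.
  by rewrite /GRing.scale/= !mulr1; field.
rewrite expr0n/= !mulr0 !subr0 => e.
have -> : f h - (f 0 + f1 0 * h + f2 0 / 2 * h ^+ 2) =
  (f1 c - f1 0 - f2 0 * c) * h by rewrite -e; ring.
have [h1 h2] := btw _ _ (lexx _) hc.
rewrite normrM exprS mulrA mulrAC ler_wpM2r//.
apply: le_trans (s1 _ h2) _; apply: ler_wpM2l => //.
by rewrite ler_pXn2r ?nnegrE.
Qed.

Lemma taylor2 (f f1 f2 : R -> R) (s M : R) : 0 <= s ->
  (forall u : R, 0 <= u <= s -> is_derive u 1 f (f1 u)) ->
  (forall u : R, 0 <= u <= s -> is_derive u 1 f1 (f2 u)) ->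
  (forall u : R, 0 <= u <= s -> `|f2 u| <= M) ->
  f 0 + f1 0 * s - M * s ^+ 2 <= f s.
Proof.
move=> s0 d1 d2 fM.
have M0 : 0 <= M by apply: le_trans (fM 0 _); rewrite ?lexx.
have [x|c] := @mean_value f f1 0 s.
  by rewrite min_l// max_r//; exact: d1.
rewrite min_l// max_r// subr0 => /andP[c0 cs] e.
have [x|b] := @mean_value f1 f2 0 c.
  rewrite min_l// max_r// => /andP[x0 xc]; apply: d2.
  by rewrite x0 (le_trans xc).
rewrite min_l// max_r// subr0 => /andP[b0 bc] e'.
have := fM b; rewrite b0 (le_trans bc cs) => /(_ isT).
rewrite ler_norml => /andP[h1 h2].
have -> : f s = f 0 + f1 0 * s + f2 b * c * s by rewrite -e' -(subrK (f 0) (f s)) e; ring.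
rewrite lerD2l -mulNr expr2 mulrA.
rewrite ler_wpM2r//.
have : - M * s <= - M * c by rewrite !mulNr lerN2 ler_wpM2l.
by move=> h3; apply: le_trans h3 _; rewrite ler_wpM2r.
Qed.

End mean_value.

(** * The standard normal distribution function *)

Section standard_normal.
Context {R : realType}.
Implicit Types x z : R.

Notation Phi := (@std_normal_cdf R).

Definition normal_peak1 : R := normal_peak 1.

Definition gauss x : R := expR (- (x ^+ 2 / 2)).

Lemma normal_peak1_gt0 : 0 < normal_peak1.
Proof. exact: normal_peak_gt0. Qed.

Lemma normal_peak1_le1 : normal_peak1 <= 1.
Proof.
rewrite /normal_peak1 /normal_peak invf_le1.
  rewrite expr1n mul1r -[leLHS]sqrtr1 ler_sqrt.
    by rewrite mulr2n; have := pi_ge2 R; lra.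
  by rewrite mulrn_wge0// pi_ge0.
by rewrite sqrtr_gt0 expr1n mul1r pmulrn_lgt0// pi_gt0.
Qed.

Lemma gauss_gt0 x : 0 < gauss x. Proof. exact: expR_gt0. Qed.

Lemma gaussN x : gauss (- x) = gauss x.
Proof. by rewrite /gauss sqrrN. Qed.

Lemma normal_pdf01E x : normal_pdf 0 1 x = normal_peak1 * gauss x.
Proof.
rewrite normal_pdfE// /normal_fun /gauss subr0 expr1n; congr (_ * expR _).
by rewrite mulNr.
Qed.

Lemma Phi_prob x : (Phi x)%:E = normal_prob (0 : R) 1 `]-oo, x].
Proof. by rewrite /std_normal_cdf fineK// fin_num_measure. Qed.

Lemma Phi_ge0 x : 0 <= Phi x.
Proof. by rewrite -lee_fin Phi_prob. Qed.

Lemma Phi_le1 x : Phi x <= 1.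
Proof. by rewrite -lee_fin Phi_prob probability_le1. Qed.

Lemma is_derive_Phi x : is_derive x 1 Phi (normal_peak1 * gauss x).
Proof.
have [||||d e] := @continuous_FTC1 R (normal_pdf 0 1) -oo%O x (x + 1).
- by rewrite ltrDl.
- by apply: integrableS (integrable_normal_pdf _ _).
- by rewrite ltNyr.
- exact: continuous_normal_pdf.
by rewrite -normal_pdf01E -e derive1E; exact: DeriveDef.
Qed.

Lemma continuous_Phi : continuous Phi.
Proof.
move=> x; apply: differentiable_continuous; apply/derivable1_diffP.
by have [] := is_derive_Phi x.
Qed.

Lemma measurable_Phi : measurable_fun setT Phi.
Proof. by apply: continuous_measurable_fun; exact: continuous_Phi. Qed.

Lemma Phi_cvgNy : Phi x @[x --> -oo%R] --> (0 : R).
Proof.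
have mid : measurable_fun setT (idfun : measurableTypeR R -> R).
  exact: measurable_id.
pose X : {mfun measurableTypeR R >-> R} :=
  HB.pack (idfun : measurableTypeR R -> R)
  (isMeasurableFun.Build _ _ _ _ (idfun : measurableTypeR R -> R) mid).
have := @cvg_cdfNy0 _ _ _ (normal_prob (0 : R) 1) X.
rewrite (_ : cdf _ = EFin \o Phi); first by move/fine_cvgP => [].
by apply/funext => x; rewrite /= Phi_prob.
Qed.

Lemma Phi_cvgy : Phi x @[x --> +oo%R] --> (1 : R).
Proof.
have mid : measurable_fun setT (idfun : measurableTypeR R -> R).
  exact: measurable_id.
pose X : {mfun measurableTypeR R >-> R} :=
  HB.pack (idfun : measurableTypeR R -> R)
  (isMeasurableFun.Build _ _ _ _ (idfun : measurableTypeR R -> R) mid).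
have := @cvg_cdfy1 _ _ _ (normal_prob (0 : R) 1) X.
rewrite (_ : cdf _ = EFin \o Phi); first by move/fine_cvgP => [].
by apply/funext => x; rewrite /= Phi_prob.
Qed.

Lemma PhiN x : Phi (- x) = 1 - Phi x.
Proof.
pose s x := Phi x + Phi (- x).
have ds (y : R) : is_derive y 1 s 0.
  have d1 := is_derive_Phi y.
  have d2 : is_derive y 1 (Phi \o -%R) (normal_peak1 * gauss (- y) * -1).
    by apply: is_derive1_comp; exact: is_derive_Phi.
  have d3 := is_deriveD d1 d2.
  by apply: (is_derive_eq d3); rewrite gaussN mulrN1 subrr.
have sc y : s y = s x by apply: is_derive_0_is_cst => z; exact: ds.
have s1 : s y @[y --> +oo%R] --> (1 : R).
  rewrite -[X in _ --> X]addr0; apply: cvgD; first exact: Phi_cvgy.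
  by have := Phi_cvgNy; rewrite cvgNy_compNP.
have s2 : s y @[y --> +oo%R] --> s x.
  by rewrite (_ : s = cst (s x)); [exact: cvg_cst|apply/funext => y /=].
have : s x = 1 by apply: cvg_unique s1.
by rewrite /s => <-; rewrite addrC addKr.
Qed.

Lemma is_derive_gauss x : is_derive x 1 gauss (- x * gauss x).
Proof.
have d : is_derive x 1 (fun y : R => - (y ^+ 2 / 2)) (- x).
  by apply: is_derive_eq; rewrite /GRing.scale/= !mulr1; field.
by have := is_derive1_comp (is_derive_expR _) d; rewrite mulrC.
Qed.

(** Below [1] the right-hand side is at least [1].  Beyond [1] the function
    [Phi (- x) - gauss x] increases to its limit [0]. *)
Lemma Phi_le2gauss z : 0 <= z -> Phi (- z) <= 2 * gauss z.
Proof.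
move=> z0; have [z1|z1] := leP z 1.
  apply: le_trans (Phi_le1 _) _; rewrite -ler_pdivrMl// mulr1.
  have h : 1 - z ^+ 2 / 2 <= gauss z by rewrite /gauss expR_ge1Dx.
  apply: le_trans h; have : z ^+ 2 <= 1 by rewrite exprn_ile1.
  lra.
pose h x := Phi (- x) - gauss x.
have hd x : is_derive x 1 h ((x - normal_peak1) * gauss x).
  have d1 : is_derive x 1 (Phi \o -%R) (normal_peak1 * gauss (- x) * -1).
    by apply: is_derive1_comp; exact: is_derive_Phi.
  have := is_deriveB d1 (is_derive_gauss x).
  by move=> d; apply: (is_derive_eq d); rewrite gaussN; ring.
have hz : h z <= 0.
  have PhiN0 : Phi (- y) @[y --> +oo%R] --> (0 : R).
    by have := Phi_cvgNy; rewrite cvgNy_compNP.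
  apply: (cvgr_to_ge PhiN0).
  near=> y; have zy : z <= y by near: y; apply: nbhs_pinfty_ge; exact: num_real.
  have [c] := @mean_value _ h _ z y (fun x _ => hd x).
  rewrite min_l// max_r// => /andP[zc cy] e.
  apply: (@le_trans _ _ (h y)).
    rewrite -subr_ge0 e mulr_ge0 ?subr_ge0// mulr_ge0 ?(ltW (gauss_gt0 _))//.
    rewrite subr_ge0 (le_trans normal_peak1_le1)// (le_trans _ zc)// ltW//.
  by rewrite /h gerBl ltW// gauss_gt0.
have := gauss_gt0 z; move: hz; rewrite /h; lra.
Unshelve. all: by end_near. Qed.

(** Mills' lower bound, from the mass of [[x, x + 1/x]]. *)
Lemma Phi_ge_gauss x : 1 <= x ->
  normal_peak1 * expR (- 2) * gauss x / x <= Phi (- x).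
Proof.
move=> x1; have x0 : 0 < x by rewrite (lt_le_trans ltr01).
have [c] := @mean_value _ Phi _ x (x + x^-1) (fun y _ => is_derive_Phi y).
have xi : 0 < x^-1 by rewrite invr_gt0.
have xi1 : x^-1 <= 1 by rewrite invf_le1.
have xx : x <= x + x^-1 by rewrite lerDl ltW.
rewrite min_l// max_r// [x + x^-1 - x]addrC addKr => /andP[xc cx] e.
rewrite PhiN; apply: (@le_trans _ _ (Phi (x + x^-1) - Phi x)); last first.
  by rewrite lerD2r Phi_le1.
rewrite e ler_pM2r// -mulrA ler_pM2l ?normal_peak1_gt0//.
rewrite /gauss -expRD ler_expR -opprD lerN2.
have : c ^+ 2 <= (x + x^-1) ^+ 2.
  by rewrite ler_pXn2r ?nnegrE// (le_trans (ltW x0))// (le_trans xc).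
have -> : (x + x^-1) ^+ 2 = x ^+ 2 + 2 + x^-1 ^+ 2 by field; rewrite gt_eqF.
have : x^-1 ^+ 2 <= 1 by rewrite exprn_ile1// ltW.
lra.
Qed.

End standard_normal.

(** * The kernels and their derivatives *)

Section derivative_rules.
Context {R : realType}.
Implicit Types f g : R -> R.

Lemma is_derive_shiftl f (a u l : R) :
  is_derive (a + u) 1 f l -> is_derive u 1 (fun v => f (a + v)) l.
Proof.
move=> d; have e : is_derive u 1 (fun v : R => a + v) 1.
  have e := is_deriveD (is_derive_cst a u 1) (is_derive_id u (1 : R)).
  by apply: (is_derive_eq e); rewrite add0r.
by have := is_derive1_comp d e; rewrite mulr1.
Qed.

Lemma is_derive_div f g (x f' g' : R) : g x != 0 ->
  is_derive x 1 f f' -> is_derive x 1 g g' ->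
  is_derive x 1 (fun y => f y / g y) ((f' * g x - f x * g') / g x ^+ 2).
Proof.
move=> g0 df dg; have dV := is_deriveV g0 dg.
have := is_deriveM df dV => d; apply: (is_derive_eq d).
by rewrite /GRing.scale/=; field.
Qed.

Lemma is_derive_ln_comp g (x g' : R) : 0 < g x -> is_derive x 1 g g' ->
  is_derive x 1 (fun y => ln (g y)) (g' / g x).
Proof.
move=> g0 dg; have := is_derive1_comp (is_derive1_ln g0) dg.
by rewrite mulrC.
Qed.

Lemma is_derive_expR_1 g (x g1 : R) : is_derive x 1 g g1 ->
  is_derive x 1 (fun y => expR (g y)) (g1 * expR (g x)).
Proof.
by move=> dg; have := is_derive1_comp (is_derive_expR (g x)) dg; rewrite mulrC.
Qed.

Lemma is_derive_expR_2 g (g1 : R -> R) (x g2 : R) :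
  is_derive x 1 g (g1 x) -> is_derive x 1 g1 g2 ->
  is_derive x 1 (fun y => g1 y * expR (g y)) ((g2 + g1 x ^+ 2) * expR (g x)).
Proof.
move=> d1 d2; have := is_deriveM d2 (is_derive_expR_1 d1) => d.
by apply: (is_derive_eq d); rewrite /GRing.scale/=; ring.
Qed.

Lemma is_derive_expR_3 g (g1 g2 : R -> R) (x g3 : R) :
  is_derive x 1 g (g1 x) -> is_derive x 1 g1 (g2 x) -> is_derive x 1 g2 g3 ->
  is_derive x 1 (fun y => (g2 y + g1 y ^+ 2) * expR (g y))
    ((g3 + 3 * g1 x * g2 x + g1 x ^+ 3) * expR (g x)).
Proof.
move=> d1 d2 d3.
have d4 : is_derive x 1 (fun y => g2 y + g1 y ^+ 2) (g3 + 2 * g1 x * g2 x).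
  by apply: is_derive_eq; rewrite /GRing.scale/=; ring.
have := is_deriveM d4 (is_derive_expR_1 d1) => d.
by apply: (is_derive_eq d); rewrite /GRing.scale/=; ring.
Qed.

End derivative_rules.

Section kernels.
Context {R : realType}.
Variable lam : R.
Implicit Types t y b : R.

(** The tilt [lam * y + lam ^ 2 * t / 2] turns the heat equation into one with
    drift [lam]: seen through it, a profile moves along the lines on which this
    is constant. *)
Definition drifted t y : R := y + lam * t.

Definition spread t y : R := t + drifted t y ^+ 2.

(** The kernels are defined through their logarithms, so that all derivatives
    are polynomials in the derivatives of the logarithm times the kernel. *)
Definition log_tail b t y : R :=
  lam * y + lam ^+ 2 * t / 2 + b * ln t - ln (spread t y).

(** The exponential tilt [lam * y + lam ^+ 2 * t / 2] times a profile with
    polynomial tails, slowly varying enough to survive jumps that only have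
    exponential moments. *)
Definition tail_kernel b t y : R := expR (log_tail b t y).

Definition log_heat t y : R := - ln t / 2 - y ^+ 2 / (2 * t).

Definition heat_kernel t y : R := expR (log_heat t y).

Lemma spread_gt0 t y : 0 < t -> 0 < spread t y.
Proof. by move=> t0; rewrite ltr_wpDr// sqr_ge0. Qed.

Definition tail_y1 t y := lam - 2 * drifted t y / spread t y.
Definition tail_y2 t y := - 2 / spread t y + 4 * drifted t y ^+ 2 / spread t y ^+ 2.
Definition tail_y3 t y := 12 * drifted t y / spread t y ^+ 2
  - 16 * drifted t y ^+ 3 / spread t y ^+ 3.
Definition tail_t1 b t y := lam ^+ 2 / 2 + b / t - (1 + 2 * lam * drifted t y) / spread t y.
Definition tail_t2 b t y := - b / t ^+ 2 - 2 * lam ^+ 2 / spread t y +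
  (1 + 2 * lam * drifted t y) ^+ 2 / spread t y ^+ 2.

Lemma is_derive_drifted_y t y : is_derive y 1 (drifted t) 1.
Proof. by rewrite /drifted/=; apply: is_derive_eq; rewrite addr0. Qed.

Lemma is_derive_drifted_t t y : is_derive t 1 (drifted^~ y) lam.
Proof. by rewrite /drifted/=; apply: is_derive_eq; rewrite /GRing.scale/=; ring. Qed.

Lemma is_derive_spread_y t y : is_derive y 1 (spread t) (2 * drifted t y).
Proof.
have d := is_derive_drifted_y t y.
by rewrite /spread/=; apply: is_derive_eq; rewrite /GRing.scale/=; ring.
Qed.

Lemma is_derive_spread_t t y : is_derive t 1 (spread^~ y) (1 + 2 * lam * drifted t y).
Proof.
have d := is_derive_drifted_t t y.
by rewrite /spread/=; apply: is_derive_eq; rewrite /GRing.scale/=; ring.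
Qed.

Lemma tail_dy1 b t y : 0 < t -> is_derive y 1 (log_tail b t) (tail_y1 t y).
Proof.
move=> t0; have s0 := spread_gt0 y t0.
have d := is_derive_ln_comp s0 (is_derive_spread_y t y).
by rewrite /log_tail/=; apply: is_derive_eq; rewrite /GRing.scale/= /tail_y1; ring.
Qed.

Lemma tail_dy2 t y : 0 < t -> is_derive y 1 (tail_y1 t) (tail_y2 t y).
Proof.
move=> t0; have s0 : spread t y != 0 by rewrite gt_eqF// spread_gt0.
have d1 := is_derive_drifted_y t y; have d2 := is_derive_spread_y t y.
have d3 : is_derive y 1 (fun y => 2 * drifted t y) 2.
  by apply: is_derive_eq; rewrite /GRing.scale/=; ring.
have d := @is_derive_div _ _ (spread t) y _ _ s0 d3 d2.
rewrite /tail_y1/=; apply: is_derive_eq; rewrite /GRing.scale/= /tail_y2; by field.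
Qed.

Lemma tail_dy3 t y : 0 < t -> is_derive y 1 (tail_y2 t) (tail_y3 t y).
Proof.
move=> t0; have s0 : spread t y != 0 by rewrite gt_eqF// spread_gt0.
have d1 := is_derive_drifted_y t y; have d2 := is_derive_spread_y t y.
have d3 := is_deriveV s0 d2.
have d4 : is_derive y 1 (fun y => drifted t y ^+ 2) (2 * drifted t y).
  by apply: is_derive_eq; rewrite /GRing.scale/=; ring.
have d5 : is_derive y 1 (fun y => spread t y ^+ 2) (2 * spread t y * (2 * drifted t y)).
  by apply: is_derive_eq; rewrite /GRing.scale/=; ring.
have s20 : spread t y ^+ 2 != 0 by rewrite expf_neq0.
have d6 : is_derive y 1 (fun y => 4 * drifted t y ^+ 2) (8 * drifted t y).
  by apply: is_derive_eq; rewrite /GRing.scale/=; ring.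
have d := @is_derive_div _ _ (fun y => spread t y ^+ 2) y _ _ s20 d6 d5.
rewrite /tail_y2/=; apply: is_derive_eq; rewrite /GRing.scale/= /tail_y3; by field.
Qed.

Lemma tail_dt1 b t y : 0 < t -> is_derive t 1 (log_tail b ^~ y) (tail_t1 b t y).
Proof.
move=> t0; have s0 := spread_gt0 y t0.
have d := @is_derive_ln_comp _ (spread^~ y) t _ s0 (is_derive_spread_t t y).
have d2 := is_derive1_ln t0.
rewrite /log_tail/=; apply: is_derive_eq; rewrite /GRing.scale/= /tail_t1; by field;
 rewrite !gt_eqF.
Qed.

Lemma tail_dt2 b t y : 0 < t -> is_derive t 1 (tail_t1 b ^~ y) (tail_t2 b t y).
Proof.
move=> t0; have s0 : spread t y != 0 by rewrite gt_eqF// spread_gt0.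
have d1 := is_derive_drifted_t t y; have d2 := is_derive_spread_t t y.
have d3 : is_derive t 1 (fun t => 1 + 2 * lam * drifted t y) (2 * lam ^+ 2).
  by apply: is_derive_eq; rewrite /GRing.scale/=; ring.
have d := @is_derive_div _ _ (spread^~ y) t _ _ s0 d3 d2.
have t1 : t != 0 by rewrite gt_eqF.
have dV := is_deriveV t1 (is_derive_id t 1).
rewrite /tail_t1/=; apply: is_derive_eq; rewrite /GRing.scale/= /tail_t2.
by field; rewrite ?s0 ?t1.
Qed.

Definition heat_y1 t y := - y / t.
Definition heat_t1 t y := - 1 / (2 * t) + y ^+ 2 / (2 * t ^+ 2).
Definition heat_t2 t y := 1 / (2 * t ^+ 2) - y ^+ 2 / t ^+ 3.

Lemma heat_dy1 t y : 0 < t -> is_derive y 1 (log_heat t) (heat_y1 t y).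
Proof.
move=> t0; rewrite /log_heat/=; apply: is_derive_eq; rewrite /GRing.scale/= /heat_y1.
by field; rewrite gt_eqF.
Qed.

Lemma heat_dy2 t y : 0 < t -> is_derive y 1 (heat_y1 t) (- 1 / t).
Proof.
move=> t0; rewrite /heat_y1/=; apply: is_derive_eq; rewrite /GRing.scale/=.
by field; rewrite gt_eqF.
Qed.

Lemma heat_dt1 t y : 0 < t -> is_derive t 1 (log_heat ^~ y) (heat_t1 t y).
Proof.
move=> t0; have d2 := is_derive1_ln t0.
have t1 : 2 * t != 0 by rewrite gt_eqF// mulr_gt0.
have d3 : is_derive t 1 (fun t => 2 * t) 2.
  by apply: is_derive_eq; rewrite /GRing.scale/=; ring.
have dV := is_deriveV t1 d3.
rewrite /log_heat/=; apply: is_derive_eq; rewrite /GRing.scale/= /heat_t1.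
by field; rewrite gt_eqF.
Qed.

Lemma heat_dt2 t y : 0 < t -> is_derive t 1 (heat_t1 ^~ y) (heat_t2 t y).
Proof.
move=> t0; have t1 : 2 * t != 0 by rewrite gt_eqF// mulr_gt0.
have d3 : is_derive t 1 (fun t => 2 * t) 2.
  by apply: is_derive_eq; rewrite /GRing.scale/=; ring.
have dV := is_deriveV t1 d3.
have t2 : 2 * t ^+ 2 != 0 by rewrite gt_eqF// mulr_gt0// exprn_gt0.
have d4 : is_derive t 1 (fun t => 2 * t ^+ 2) (4 * t).
  by apply: is_derive_eq; rewrite /GRing.scale/=; ring.
have dV2 := @is_deriveV _ (fun t => 2 * t ^+ 2) t _ 1 t2 d4.
rewrite /heat_t1/=; apply: is_derive_eq; rewrite /GRing.scale/= /heat_t2.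
by field; rewrite gt_eqF.
Qed.

End kernels.

(** * Functions of time and space with their derivatives *)

Section jets.
Context {R : realType}.

Lemma measurable_inv : measurable_fun setT (@GRing.inv R).
Proof.
rewrite -(setUv [set (0 : R)]); apply/measurable_funU => //.
  exact: measurableC.
split; first exact: measurable_fun_set1.
apply: open_continuous_measurable_fun.
  by apply: closed_openC; exact: closed_eq.
by move=> x; rewrite inE/= => /eqP x0; exact: inv_continuous.
Qed.

Lemma measurable_funV d (T : measurableType d) (f : T -> R) :
  measurable_fun setT f -> measurable_fun setT (fun w => (f w)^-1).
Proof. by move=> mf; exact: (measurableT_comp measurable_inv). Qed.

(** Joint measurability, phrased so that it applies to any pair of measurable
    functions on any sigma-algebra. *)
Definition jointly_measurable (f : R -> R -> R) : Prop :=
  forall d (T : measurableType d) (a b : T -> R),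
  measurable_fun setT a -> measurable_fun setT b ->
  measurable_fun setT (fun w => f (a w) (b w)).

(** A function of time and space bundled with the derivatives that one step of the
    comparison needs, as explicit functions. *)
Record jet := Jet {
  jet_val :> R -> R -> R;
  jet_y : R -> R -> R; jet_yy : R -> R -> R; jet_yyy : R -> R -> R;
  jet_t : R -> R -> R; jet_tt : R -> R -> R }.

Definition is_jet (J : jet) : Prop :=
  [/\ jointly_measurable J, jointly_measurable (jet_y J),
      jointly_measurable (jet_yy J) &
  forall t y : R, 0 < t ->
  [/\ is_derive y 1 (J t) (jet_y J t y),
      is_derive y 1 (jet_y J t) (jet_yy J t y),
      is_derive y 1 (jet_yy J t) (jet_yyy J t y),
      is_derive t 1 (J ^~ y) (jet_t J t y) &
      is_derive t 1 (jet_t J ^~ y) (jet_tt J t y)]].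

Definition jet_cst (c : R) : jet :=
  let z := fun _ _ => 0 in Jet (fun _ _ => c) z z z z z.

Definition jet_lin (J : jet) (c : R) (K : jet) : jet :=
  let l (f g : R -> R -> R) t y := f t y + c * g t y in
  Jet (l J K) (l (jet_y J) (jet_y K)) (l (jet_yy J) (jet_yy K))
    (l (jet_yyy J) (jet_yyy K)) (l (jet_t J) (jet_t K)) (l (jet_tt J) (jet_tt K)).

Lemma is_jet_cst c : is_jet (jet_cst c).
Proof.
by split=> [d T a b ma mb|d T a b ma mb|d T a b ma mb|t y t0]; last by split;
  exact: is_derive_cst.
Qed.

Lemma is_derive_lin (f g : R -> R) (x c f' g' : R) :
  is_derive x 1 f f' -> is_derive x 1 g g' ->
  is_derive x 1 (fun y => f y + c * g y) (f' + c * g').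
Proof. by move=> df dg; apply: is_derive_eq. Qed.

Lemma is_jet_lin J c K : is_jet J -> is_jet K -> is_jet (jet_lin J c K).
Proof.
move=> [j1 j2 j3 j4] [k1 k2 k3 k4]; split=> [d T a b ma mb|d T a b ma mb|d T a b ma mb|t y t0] /=.
- by apply: measurable_funD; [exact: j1|apply: measurable_funM => //; exact: k1].
- by apply: measurable_funD; [exact: j2|apply: measurable_funM => //; exact: k2].
- by apply: measurable_funD; [exact: j3|apply: measurable_funM => //; exact: k3].
- have [? ? ? ? ?] := j4 t y t0; have [? ? ? ? ?] := k4 t y t0.
  by split; exact: is_derive_lin.
Qed.

Variable lam : R.

Definition tail_jet (b : R) : jet :=
  let F := tail_kernel lam b in
  Jet F (fun t y => tail_y1 lam t y * F t y)
    (fun t y => (tail_y2 lam t y + tail_y1 lam t y ^+ 2) * F t y)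
    (fun t y => (tail_y3 lam t y + 3 * tail_y1 lam t y * tail_y2 lam t y
       + tail_y1 lam t y ^+ 3) * F t y)
    (fun t y => tail_t1 lam b t y * F t y)
    (fun t y => (tail_t2 lam b t y + tail_t1 lam b t y ^+ 2) * F t y).

Lemma measurable_drifted : jointly_measurable (drifted lam).
Proof.
by move=> d T a b ma mb; apply: measurable_funD => //; exact: measurable_funM.
Qed.

Lemma measurable_spread : jointly_measurable (spread lam).
Proof.
move=> d T a b ma mb; apply: measurable_funD => //; apply: measurable_funX.
exact: measurable_drifted.
Qed.

Lemma is_jet_tail b : is_jet (tail_jet b).
Proof.
have mF : jointly_measurable (tail_kernel lam b).
  move=> d T a b' ma mb; apply: measurableT_comp => //.
  apply: measurable_funB; last first.
    by apply: measurableT_comp => //; exact: measurable_spread.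
  apply: measurable_funD; last first.
    by apply: measurable_funM => //; exact: measurableT_comp.
  by apply: measurable_funD; repeat apply: measurable_funM => //.
have m1 : jointly_measurable (tail_y1 lam).
  move=> d T a b' ma mb; apply: measurable_funB => //; apply: measurable_funM.
    by apply: measurable_funM => //; exact: measurable_drifted.
  by apply: measurable_funV; exact: measurable_spread.
have m2 : jointly_measurable (tail_y2 lam).
  move=> d T a b' ma mb; apply: measurable_funD; apply: measurable_funM => //.
  - by apply: measurable_funV; exact: measurable_spread.
  - apply: measurable_funM => //; apply: measurable_funX; exact: measurable_drifted.
  - by apply: measurable_funV; apply: measurable_funX; exact: measurable_spread.
split=> [d T a b' ma mb|d T a b' ma mb|d T a b' ma mb|t y t0] /=.
- exact: mF.
- by apply: measurable_funM; [exact: m1|exact: mF].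
- apply: measurable_funM; last exact: mF.
  by apply: measurable_funD; [exact: m2|apply: measurable_funX; exact: m1].
- split.
  + exact (is_derive_expR_1 (tail_dy1 lam b y t0)).
  + exact (is_derive_expR_2 (g1 := tail_y1 lam t) (tail_dy1 lam b y t0) (tail_dy2 lam y t0)).
  + exact (is_derive_expR_3 (g1 := tail_y1 lam t) (g2 := tail_y2 lam t)
      (tail_dy1 lam b y t0) (tail_dy2 lam y t0) (tail_dy3 lam y t0)).
  + exact (is_derive_expR_1 (tail_dt1 lam b y t0)).
  + exact (is_derive_expR_2 (g1 := tail_t1 lam b ^~ y)
      (tail_dt1 lam b y t0) (tail_dt2 lam b y t0)).
Qed.

(** The heat kernel solves the heat equation exactly; the growing factor [ln t]
    makes it gain [heat_kernel t y / t]. *)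
Definition log_heat_jet : jet :=
  let p := @heat_kernel R in
  let p_t t y := heat_t1 t y * p t y in
  Jet (fun t y => ln t * p t y)
    (fun t y => ln t * (heat_y1 t y * p t y))
    (fun t y => ln t * ((- 1 / t + heat_y1 t y ^+ 2) * p t y))
    (fun t y => ln t * ((0 + 3 * heat_y1 t y * (- 1 / t) + heat_y1 t y ^+ 3) * p t y))
    (fun t y => t^-1 * p t y + ln t * p_t t y)
    (fun t y => - t ^- 2 * p t y + 2 * t^-1 * p_t t y
       + ln t * ((heat_t2 t y + heat_t1 t y ^+ 2) * p t y)).

Lemma measurable_heat : jointly_measurable (@heat_kernel R).
Proof.
move=> d T a b ma mb; apply: measurableT_comp => //; apply: measurable_funB.
  apply: measurable_funM => //; apply: measurableT_comp => //.
  exact: measurableT_comp.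
apply: measurable_funM; first exact: measurable_funX.
by apply: measurable_funV; exact: measurable_funM.
Qed.

Lemma measurable_heat_y1 : jointly_measurable (@heat_y1 R).
Proof.
move=> d T a b ma mb; apply: measurable_funM; last exact: measurable_funV.
exact: measurableT_comp.
Qed.

Lemma is_derive_scaleM (f g : R -> R) (x f' g' : R) :
  is_derive x 1 f f' -> is_derive x 1 g g' ->
  is_derive x 1 (fun y => f y * g y) (f' * g x + f x * g').
Proof.
move=> df dg; apply: (is_derive_eq (is_deriveM df dg)).
by rewrite /GRing.scale/=; ring.
Qed.

Lemma is_derive_cstM (c : R) (f : R -> R) (x f' : R) :
  is_derive x 1 f f' -> is_derive x 1 (fun y => c * f y) (c * f').
Proof. by move=> df; apply: is_derive_eq. Qed.

Lemma is_jet_log_heat : is_jet log_heat_jet.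
Proof.
have mln d (T : measurableType d) (a : T -> R) : measurable_fun setT a ->
    measurable_fun setT (fun w => ln (a w)) by move=> ma; exact: measurableT_comp.
split=> [d T a b ma mb|d T a b ma mb|d T a b ma mb|t y t0] /=.
- by apply: measurable_funM; [exact: mln|exact: measurable_heat].
- apply: measurable_funM; first exact: mln.
  by apply: measurable_funM; [exact: measurable_heat_y1|exact: measurable_heat].
- apply: measurable_funM; first exact: mln.
  apply: measurable_funM; last exact: measurable_heat.
  apply: measurable_funD; first by apply: measurable_funM => //; exact: measurable_funV.
  by apply: measurable_funX; exact: measurable_heat_y1.
- have dln := is_derive1_ln t0.
  have d1 := is_derive_expR_1 (heat_dt1 y t0).
  have d2 := is_derive_expR_2 (g1 := @heat_t1 R ^~ y) (heat_dt1 y t0) (heat_dt2 y t0).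
  split.
  + exact: is_derive_cstM (is_derive_expR_1 (heat_dy1 y t0)).
  + exact: is_derive_cstM (is_derive_expR_2 (g1 := heat_y1 t) (heat_dy1 y t0) (heat_dy2 y t0)).
  + exact: is_derive_cstM (is_derive_expR_3 (g1 := heat_y1 t)
      (g2 := fun=> -1 / t) (heat_dy1 y t0) (heat_dy2 y t0) (is_derive_cst (-1 / t) y 1)).
  + exact: is_derive_scaleM dln d1.
  + have tn0 : t != 0 by rewrite gt_eqF.
    have dV := is_deriveV tn0 (is_derive_id t (1 : R)).
    have := is_deriveD (is_derive_scaleM dV d1) (is_derive_scaleM dln d2).
    move=> d; apply: (is_derive_eq d).
    by rewrite /GRing.scale/= /heat_kernel; ring.
Qed.

Lemma sqrt_expR_ln (t : R) : 0 < t -> Num.sqrt t = expR (ln t / 2).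
Proof.
move=> t0; rewrite -{1}(lnK t0) [in LHS](_ : ln t = ln t / 2 + ln t / 2).
  by rewrite expRD -expr2 sqrtr_sqr gtr0_norm// expR_gt0.
by field.
Qed.

Lemma heat_kernelE (t y : R) : 0 < t ->
  heat_kernel t y = gauss (y / Num.sqrt t) / Num.sqrt t.
Proof.
move=> t0; rewrite /heat_kernel /log_heat expRD mulrC; congr (_ * _); last first.
  by rewrite mulNr expRN -sqrt_expR_ln.
rewrite /gauss expr_div_n sqr_sqrtr ?(ltW t0)//; congr expR.
by field; rewrite gt_eqF.
Qed.

Definition Phi_jet : jet :=
  let c : R := @normal_peak1 R in
  let p := @heat_kernel R in
  Jet (fun t y => std_normal_cdf (y / Num.sqrt t))
    (fun t y => c * p t y)
    (fun t y => c * (heat_y1 t y * p t y))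
    (fun t y => c * ((- 1 / t + heat_y1 t y ^+ 2) * p t y))
    (fun t y => c * (2^-1 * (heat_y1 t y * p t y)))
    (fun t y => c * (2^-1 * ((y / t ^+ 2 + heat_y1 t y * heat_t1 t y) * p t y))).

Lemma is_jet_Phi : is_jet Phi_jet.
Proof.
have msq d (T : measurableType d) (a : T -> R) : measurable_fun setT a ->
    measurable_fun setT (fun w => Num.sqrt (a w)).
  move=> ma; apply: (measurableT_comp _ ma).
  by apply: continuous_measurable_fun; exact: sqrt_continuous.
split=> [d T a b ma mb|d T a b ma mb|d T a b ma mb|t y t0] /=.
- apply: (measurableT_comp measurable_Phi); apply: measurable_funM => //.
  by apply: measurable_funV; exact: msq.
- by apply: measurable_funM => //; exact: measurable_heat.
- apply: measurable_funM => //.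
  by apply: measurable_funM; [exact: measurable_heat_y1|exact: measurable_heat].
- have s0 : 0 < Num.sqrt t by rewrite sqrtr_gt0.
  have sn0 : Num.sqrt t != 0 by rewrite gt_eqF.
  have sE : Num.sqrt t ^+ 2 = t by rewrite sqr_sqrtr// ltW.
  split.
  + have d1 : is_derive y 1 (fun y => y / Num.sqrt t) (Num.sqrt t)^-1.
      by apply: is_derive_eq; rewrite /GRing.scale/=; ring.
    have := @is_derive1_comp _ _ (fun y => y / Num.sqrt t) y _ _
      (is_derive_Phi (y / Num.sqrt t)) d1.
    by rewrite heat_kernelE// mulrA.
  + exact: is_derive_cstM (is_derive_expR_1 (heat_dy1 y t0)).
  + exact: is_derive_cstM (is_derive_expR_2 (g1 := heat_y1 t) (heat_dy1 y t0) (heat_dy2 y t0)).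
  + have ds := is_derive1_sqrt t0.
    have dV := is_deriveV sn0 ds.
    have dd : is_derive t 1 (fun t => y / Num.sqrt t) (- y / (2 * t * Num.sqrt t)).
      apply: (is_derive_eq (is_derive_cstM y dV)).
      by rewrite /GRing.scale/= -{3}sE; field; rewrite sn0.
    have := @is_derive1_comp _ _ (fun t => y / Num.sqrt t) t _ _
      (is_derive_Phi (y / Num.sqrt t)) dd.
    move=> d; apply: (is_derive_eq d).
    rewrite heat_kernelE// /heat_y1; field; by rewrite sn0 gt_eqF.
  + apply: is_derive_cstM; apply: is_derive_cstM.
    have d1 := is_derive_expR_1 (heat_dt1 y t0).
    have tn0 : t != 0 by rewrite gt_eqF.
    have dV := is_deriveV tn0 (is_derive_id t (1 : R)).
    have d2 := is_derive_scaleM (is_derive_cstM (- y) dV) d1.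
    apply: (is_derive_eq d2); rewrite /GRing.scale/= /heat_y1 /heat_kernel.
    by field; rewrite tn0.
Qed.

End jets.

(** * Bounds on the kernels and on the barrier *)

Section barrier_bounds.
Context {R : realType}.

(** The third derivative of [exp g] divided by [exp g], when each derivative of
    [g] costs one power of [m]. *)
Lemma cubic_bound (g1 g2 g3 m c2 c3 : R) : `|g1| <= m ->
  `|g2| <= c2 * m ^+ 2 -> `|g3| <= c3 * m ^+ 3 ->
  `|g3 + 3 * g1 * g2 + g1 ^+ 3| <= (c3 + 3 * c2 + 1) * m ^+ 3.
Proof.
move=> h1 h2 h3; have m0 : 0 <= m := le_trans (normr_ge0 _) h1.
apply: le_trans (ler_normD _ _) _; apply: le_trans (lerD (ler_normD _ _) (lexx _)) _.
rewrite normrX !normrM ger0_norm//.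
have e1 : `|g1| * `|g2| <= m * (c2 * m ^+ 2) by apply: ler_pM.
have e2 : `|g1| ^+ 3 <= m ^+ 3 by rewrite ler_pXn2r ?nnegrE.
have e3 : m * (c2 * m ^+ 2) = c2 * m ^+ 3 by ring.
by rewrite e3 in e1; move: h3 e1 e2; rewrite -mulrA; lra.
Qed.

Lemma quadratic_bound (g1 g2 m c1 c2 : R) : `|g1| <= c1 * m -> 0 <= m ->
  `|g2| <= c2 * m ^+ 2 -> `|g2 + g1 ^+ 2| <= (c2 + c1 ^+ 2) * m ^+ 2.
Proof.
move=> h1 m0 h2; apply: le_trans (ler_normD _ _) _.
rewrite mulrDl -exprMn; apply: lerD => //; rewrite normrX.
by rewrite ler_pXn2r ?nnegrE// (le_trans (normr_ge0 _) h1).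
Qed.

Variables (lam t y : R).
Hypotheses (lam0 : 0 <= lam) (lam1 : lam <= 1) (t1 : 1 <= t).

Let q := drifted lam t y.
Let D := spread lam t y.
Let k : R := (Num.sqrt t)^-1.
Let m := lam + k.
Let s := `|q| * k.
Let G := tail_kernel lam (- 2^-1) t y.
Let p := heat_kernel t y.

Let t0 : 0 < t. Proof. exact: lt_le_trans t1. Qed.
Let D0 : 0 < D. Proof. exact: spread_gt0. Qed.
Let k0 : 0 < k. Proof. by rewrite invr_gt0 sqrtr_gt0. Qed.
Let kE : k ^+ 2 = t^-1. Proof. by rewrite exprVn sqr_sqrtr// ltW. Qed.
Let tk : t * k ^+ 2 = 1. Proof. by rewrite kE divff// gt_eqF. Qed.
Let k1 : k <= 1.
Proof. by rewrite invf_le1 ?sqrtr_gt0// -[leLHS]sqrtr1 ler_sqrt// ltW. Qed.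
Let m0 : 0 < m. Proof. by rewrite ltr_wpDl. Qed.
Let m2 : m <= 2. Proof. by rewrite /m; have := lerD lam1 k1. Qed.
Let s0 : 0 <= s. Proof. by rewrite mulr_ge0// ltW. Qed.
Let sE : s ^+ 2 = q ^+ 2 / t. Proof. by rewrite exprMn real_normK ?num_real// kE. Qed.
Let DE : D = t * (1 + s ^+ 2).
Proof. by rewrite sE mulrDr mulr1 mulrCA divff ?mulr1// gt_eqF. Qed.
Let G0 : 0 < G. Proof. exact: expR_gt0. Qed.
Let p0 : 0 < p. Proof. exact: expR_gt0. Qed.

Let DV : D^-1 <= k ^+ 2.
Proof. by rewrite kE lef_pV2 ?posrE// DE ler_pMr// lerDl sqr_ge0. Qed.

Let qD : `|q / D| <= k / 2.
Proof.
rewrite normrM normfV (gtr0_norm D0) ler_pdivrMr// DE.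
rewrite [leRHS](_ : _ = (t * k ^+ 2) * ((1 + s ^+ 2) / 2) / k); last first.
  by field; rewrite gt_eqF.
rewrite tk mul1r ler_pdivlMr// -/s; have := sqr_ge0 (s - 1); rewrite sqrrB1; nra.
Qed.

Let qD2 : (q / D) ^+ 2 <= k ^+ 2 / 4.
Proof.
rewrite -real_normK ?num_real//.
apply: (@le_trans _ _ ((k / 2) ^+ 2)).
  by rewrite ler_pXn2r ?nnegrE// divr_ge0// ltW.
by rewrite le_eqVlt; apply/orP; left; apply/eqP; field.
Qed.

Let k_m : k <= m. Proof. by rewrite lerDr. Qed.
Let km2 : k ^+ 2 <= m ^+ 2. Proof. by rewrite ler_pXn2r ?nnegrE ?(ltW k0) ?(ltW m0). Qed.
Let km3 : k ^+ 3 <= m ^+ 3. Proof. by rewrite ler_pXn2r ?nnegrE ?(ltW k0) ?(ltW m0). Qed.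

(** All tail kernels are multiples of the one with exponent [- 1 / 2], which
    carries the same power of [t] as the heat kernel. *)
Lemma tail_half : tail_kernel lam (2^-1) t y = t * G.
Proof.
rewrite -[in RHS](lnK t0) -expRD; congr expR; rewrite /log_tail; by field.
Qed.

Lemma tail_3half : tail_kernel lam (3 / 2) t y = t ^+ 2 * G.
Proof.
rewrite expr2 -[in RHS](lnK t0) -!expRD; congr expR; rewrite /log_tail; by field.
Qed.

(** Completing the square: the tilted Gaussian is the heat kernel, seen from the
    drifted origin. *)
Lemma heat_tail : p = t * G * ((1 + s ^+ 2) * expR (- (s ^+ 2 / 2))).
Proof.
rewrite mulrACA mulrA -DE -[D]lnK// mulrAC -mulrA -!expRD; congr expR.
rewrite /log_tail /log_heat -/D sE /q /drifted; field; by rewrite gt_eqF.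
Qed.

Lemma poly_gauss_le : (1 + s) ^+ 4 * ((1 + s ^+ 2) * expR (- (s ^+ 2 / 2))) <= 864.
Proof.
have h1 : (1 + s) ^+ 2 <= 2 * (1 + s ^+ 2).
  by have := sqr_ge0 (s - 1); rewrite sqrrB1; nra.
have w0 := sqr_ge0 s; set w := s ^+ 2 in h1 w0 *.
have h2 : (1 + s) ^+ 4 <= 4 * (1 + w) ^+ 2.
  rewrite (_ : 4 = 2 * 2)%N// exprM [leRHS](_ : _ = (2 * (1 + w)) ^+ 2); last by ring.
  by rewrite ler_pXn2r ?nnegrE ?sqr_ge0// mulr_ge0// addr_ge0.
have h3 : (1 + w) ^+ 3 <= 216 * expR (w / 2).
  have e : 1 + w / 6 <= expR (w / 6) by exact: expR_ge1Dx.
  have -> : expR (w / 2) = expR (w / 6) ^+ 3.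
    by rewrite -expRM_natl; congr expR; field.
  have : (1 + w / 6) ^+ 3 <= expR (w / 6) ^+ 3.
    by rewrite ler_pXn2r ?nnegrE ?expR_ge0// addr_ge0// divr_ge0.
  have -> : (1 + w / 6) ^+ 3 = (6 + w) ^+ 3 / 216 by field.
  have e4 : (1 + w) ^+ 3 <= (6 + w) ^+ 3.
    by rewrite ler_pXn2r ?nnegrE ?addr_ge0// lerD2r ler1n.
  by move: e4; lra.
rewrite expRN mulrA ler_pdivrMr ?expR_gt0//.
apply: (@le_trans _ _ (4 * (1 + w) ^+ 3)); last first.
  by move: h3; lra.
by rewrite [leRHS](_ : _ = 4 * (1 + w) ^+ 2 * (1 + w)); [rewrite ler_pM2r// ltr_wpDr|ring].
Qed.

Let P := 1 + s.
Let P1 : 1 <= P. Proof. by rewrite lerDl. Qed.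
Let P0 : 0 < P. Proof. exact: lt_le_trans P1. Qed.

Lemma poly_heat_le n : (n <= 4)%N -> P ^+ n * p <= 864 * (t * G).
Proof.
move=> n4; apply: (@le_trans _ _ (P ^+ 4 * p)).
  by rewrite ler_pM2r//; apply: ler_weXn2l.
rewrite heat_tail mulrCA mulrC ler_pM2r ?mulr_gt0//.
exact: poly_gauss_le.
Qed.

Let M := m * P.
Let M0 : 0 < M. Proof. exact: mulr_gt0. Qed.

(** The derivatives of the heat kernel bring factors [M = m * (1 + s)], which are
    not bounded; the Gaussian decay of [heat_kernel] against [G] absorbs the
    powers of [1 + s]. *)
Lemma growth_heat_le n : (n <= 4)%N -> M ^+ n * p <= 864 * (m ^+ n * (t * G)).
Proof.
move=> n4; rewrite /M exprMn -mulrA [leRHS]mulrCA ler_pM2l ?exprn_gt0//.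
exact: poly_heat_le.
Qed.

Lemma tail_y1_le : `|tail_y1 lam t y| <= m.
Proof.
rewrite /tail_y1 -/q -/D; apply: le_trans (ler_normB _ _) _.
rewrite ger0_norm// lerD2l -mulrA normrM ger0_norm//; move: qD; lra.
Qed.

Lemma tail_y2_le : `|tail_y2 lam t y| <= 2 * m ^+ 2.
Proof.
rewrite /tail_y2 -/q -/D.
have -> : - 2 / D + 4 * q ^+ 2 / D ^+ 2 = 4 * (q / D) ^+ 2 - 2 * D^-1.
  by field; rewrite gt_eqF.
have h1 : 0 < D^-1 by rewrite invr_gt0.
have h2 := sqr_ge0 (q / D).
by rewrite ler_norml; move: qD2 DV km2; lra.
Qed.

Lemma tail_y3_le : `|tail_y3 lam t y| <= 8 * m ^+ 3.
Proof.
rewrite /tail_y3 -/q -/D.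
have -> : 12 * q / D ^+ 2 - 16 * q ^+ 3 / D ^+ 3 =
   (q / D) * (12 * D^-1 - 16 * (q / D) ^+ 2).
  by field; rewrite gt_eqF.
rewrite normrM.
have h1 : 0 < D^-1 by rewrite invr_gt0.
have h2 := sqr_ge0 (q / D).
have h : `|12 * D^-1 - 16 * (q / D) ^+ 2| <= 12 * k ^+ 2.
  by rewrite ler_norml; move: qD2 DV; lra.
apply: le_trans (ler_pM _ _ qD h) _ => //.
rewrite [leLHS](_ : _ = 6 * k ^+ 3); last by field.
by move: km3; have := exprn_ge0 3 (ltW k0); lra.
Qed.

Lemma tail_t1_le (b : R) : 0 <= b <= 3 / 2 -> `|tail_t1 lam b t y| <= 3 * m ^+ 2.
Proof.
move=> /andP[b0 b1]; rewrite /tail_t1 -/q -/D.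
have -> : lam ^+ 2 / 2 + b / t - (1 + 2 * lam * q) / D =
   lam ^+ 2 / 2 + b * k ^+ 2 - D^-1 - 2 * lam * (q / D).
  by rewrite kE; field; rewrite !gt_eqF.
have h1 : 0 < D^-1 by rewrite invr_gt0.
move: qD; rewrite ler_norml => /andP[c1 c2].
have e1 : 2 * lam * (q / D) <= lam * k by have := ler_wpM2l lam0 c2; lra.
have e2 : - (lam * k) <= 2 * lam * (q / D) by have := ler_wpM2l lam0 c1; lra.
have e3 : 0 <= b * k ^+ 2 <= 3 / 2 * k ^+ 2 by rewrite mulr_ge0 ?sqr_ge0// ler_wpM2r ?sqr_ge0.
have -> : m ^+ 2 = lam ^+ 2 + 2 * (lam * k) + k ^+ 2 by rewrite /m; ring.
have := sqr_ge0 lam; have := mulr_ge0 lam0 (ltW k0).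
move: e3 DV => /andP[] ; rewrite ler_norml; lra.
Qed.

Lemma tail_t2_le (b : R) : 0 <= b <= 3 / 2 -> `|tail_t2 lam b t y| <= 5 * (m ^+ 2) ^+ 2.
Proof.
move=> /andP[b0 b1]; rewrite /tail_t2 -/q -/D.
have -> : - b / t ^+ 2 - 2 * lam ^+ 2 / D + (1 + 2 * lam * q) ^+ 2 / D ^+ 2 =
   (D^-1 + 2 * lam * (q / D)) ^+ 2 - b * (k ^+ 2) ^+ 2 - 2 * lam ^+ 2 * D^-1.
  by rewrite kE; field; rewrite !gt_eqF.
have h1 : 0 < D^-1 by rewrite invr_gt0.
have lk0 := mulr_ge0 lam0 (ltW k0).
have c : `|D^-1 + 2 * lam * (q / D)| <= k ^+ 2 + lam * k.
  move: qD; rewrite ler_norml => /andP[c1 c2].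
  have e1 : 2 * lam * (q / D) <= lam * k by have := ler_wpM2l lam0 c2; lra.
  have e2 : - (lam * k) <= 2 * lam * (q / D) by have := ler_wpM2l lam0 c1; lra.
  by have := sqr_ge0 k; move: DV; rewrite ler_norml; lra.
have c' : (D^-1 + 2 * lam * (q / D)) ^+ 2 <= (k ^+ 2 + lam * k) ^+ 2.
  rewrite -real_normK ?num_real// ler_pXn2r ?nnegrE//.
  by rewrite addr_ge0// sqr_ge0.
have c'' := sqr_ge0 (D^-1 + 2 * lam * (q / D)).
have e3 : 0 <= b * (k ^+ 2) ^+ 2 <= 3 / 2 * (k ^+ 2) ^+ 2.
  by rewrite mulr_ge0 ?sqr_ge0// ler_wpM2r ?sqr_ge0.
have e4 : 0 <= lam ^+ 2 * D^-1 <= lam ^+ 2 * k ^+ 2.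
  by rewrite mulr_ge0 ?sqr_ge0 ?(ltW h1)// ler_wpM2l ?sqr_ge0.
have k2 : k ^+ 2 + lam * k <= m ^+ 2.
  by rewrite /m sqrrD; have := sqr_ge0 lam; nra.
have k4 : (k ^+ 2 + lam * k) ^+ 2 <= (m ^+ 2) ^+ 2.
  by rewrite ler_pXn2r ?nnegrE ?sqr_ge0// addr_ge0// sqr_ge0.
have k5 : (k ^+ 2) ^+ 2 <= (m ^+ 2) ^+ 2 by rewrite ler_pXn2r ?nnegrE ?sqr_ge0.
have k6 : lam ^+ 2 * k ^+ 2 <= (m ^+ 2) ^+ 2.
  rewrite [leRHS]expr2 ler_pM ?sqr_ge0// ler_pXn2r ?nnegrE// ?(ltW m0)//.
  by rewrite lerDl ltW.
move: e3 e4 => /andP[? ?] /andP[? ?]; rewrite ler_norml; lra.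
Qed.

Let yt : `|y / t| <= M.
Proof.
have -> : y / t = q / t - lam.
  by rewrite /q /drifted; field; rewrite gt_eqF.
apply: le_trans (ler_normB _ _) _; rewrite (ger0_norm lam0) normrM normfV (gtr0_norm t0).
rewrite -kE expr2 mulrA -/s /M /m /P; have := mulr_ge0 lam0 s0; have := k0; lra.
Qed.

Let kM : k ^+ 2 <= M ^+ 2.
Proof.
have kM1 : k <= M by apply: le_trans k_m _; rewrite /M ler_peMr// ltW.
by rewrite ler_pXn2r ?nnegrE ?(ltW k0) ?(ltW M0).
Qed.

Lemma heat_y1_le : `|heat_y1 t y| <= M.
Proof. by rewrite /heat_y1 mulNr normrN. Qed.

Lemma heat_y2_le : `|- 1 / t| <= 1 * M ^+ 2.
Proof. by rewrite mulN1r normrN -kE ger0_norm ?sqr_ge0// mul1r. Qed.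

Lemma heat_t1_le : `|heat_t1 t y| <= 1 * M ^+ 2.
Proof.
have -> : heat_t1 t y = ((y / t) ^+ 2 - k ^+ 2) / 2.
  by rewrite kE /heat_t1; field; rewrite gt_eqF.
have h : (y / t) ^+ 2 <= M ^+ 2.
  by rewrite -real_normK ?num_real// ler_pXn2r ?nnegrE// ltW.
by have := sqr_ge0 (y / t); have := sqr_ge0 k; move: kM; rewrite ler_norml; lra.
Qed.

Lemma heat_t2_le : `|heat_t2 t y| <= 2 * (M ^+ 2) ^+ 2.
Proof.
have -> : heat_t2 t y = (k ^+ 2) ^+ 2 / 2 - k ^+ 2 * (y / t) ^+ 2.
  by rewrite kE /heat_t2; field; rewrite gt_eqF.
have h : (y / t) ^+ 2 <= M ^+ 2.
  by rewrite -real_normK ?num_real// ler_pXn2r ?nnegrE// ltW.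
have h1 : k ^+ 2 * (y / t) ^+ 2 <= (M ^+ 2) ^+ 2 by rewrite [leRHS]expr2 ler_pM ?sqr_ge0.
have h2 : (k ^+ 2) ^+ 2 <= (M ^+ 2) ^+ 2 by rewrite ler_pXn2r ?nnegrE ?sqr_ge0.
have := mulr_ge0 (sqr_ge0 k) (sqr_ge0 (y / t)); have := sqr_ge0 (k ^+ 2).
by rewrite ler_norml; lra.
Qed.

(** The unit in which the errors of one step are measured: the barrier gains a
    quarter of it over the heat equation ([barrier_jet_supersolution]). *)
Definition source : R := (1 + lam ^+ 2 * t) * G.

Let A := 1 + lam ^+ 2 * t.
Let A1 : 1 <= A. Proof. by rewrite lerDl mulr_ge0 ?sqr_ge0// ltW. Qed.

Let m2t : m ^+ 2 * t <= 2 * A.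
Proof.
have := sqr_ge0 (lam - k); rewrite sqrrB => h.
have : m ^+ 2 <= 2 * lam ^+ 2 + 2 * k ^+ 2 by rewrite /m sqrrD; lra.
by move/(ler_wpM2r (ltW t0)); have := tk; rewrite /A; lra.
Qed.

Let heat_term_le X (c : R) n : (n <= 4)%N -> 0 <= c -> `|X| <= c * M ^+ n ->
  `|X * p| <= c * (864 * (m ^+ n * (t * G))).
Proof.
move=> n4 c0 h; rewrite normrM (gtr0_norm p0).
apply: (@le_trans _ _ (c * M ^+ n * p)); first by rewrite ler_pM2r.
by rewrite -mulrA; apply: ler_wpM2l => //; exact: growth_heat_le.
Qed.

Let m2tG : m ^+ 2 * (t * G) <= 2 * source.
Proof. by rewrite mulrA /source mulrA ler_pM2r. Qed.

Let heat_yy_le : `|- 1 / t + heat_y1 t y ^+ 2| <= 2 * M ^+ 2.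
Proof.
have h : `|heat_y1 t y| <= 1 * M by rewrite mul1r heat_y1_le.
have := quadratic_bound h (ltW M0) heat_y2_le.
by rewrite expr1n -natr1 addrC.
Qed.

Let heat_tt_le : `|heat_t2 t y + heat_t1 t y ^+ 2| <= 3 * M ^+ 4.
Proof.
have := quadratic_bound heat_t1_le (sqr_ge0 M) heat_t2_le.
by rewrite expr1n -exprM (_ : 2 + 1 = 3 :> R)//; ring.
Qed.

Lemma Phi_jet_yyy_le : `|jet_yyy Phi_jet t y| <= 4000 * source.
Proof.
rewrite /= normrM (gtr0_norm normal_peak1_gt0).
have h := heat_term_le (isT : (2 <= 4)%N) (ler0n _ 2) heat_yy_le.
have S0 : 0 <= source by rewrite mulr_ge0 ?(ltW G0)// (le_trans ler01).
apply: (@le_trans _ _ (1 * `|(- 1 / t + heat_y1 t y ^+ 2) * p|)).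
  by rewrite ler_wpM2r// normal_peak1_le1.
by move: h m2tG; rewrite mul1r; lra.
Qed.

Lemma Phi_jet_tt_le : `|jet_tt Phi_jet t y| <= 4000 * source.
Proof.
rewrite /= normrM (gtr0_norm normal_peak1_gt0).
have h1 : `|y / t ^+ 2 + heat_y1 t y * heat_t1 t y| <= 2 * M ^+ 3.
  have -> : y / t ^+ 2 = y / t * k ^+ 2 by rewrite kE; field; rewrite gt_eqF.
  apply: le_trans (ler_normD _ _) _.
  have e1 : `|y / t * k ^+ 2| <= M * M ^+ 2.
    by rewrite normrM ler_pM// ger0_norm// sqr_ge0.
  have e2 : `|heat_y1 t y * heat_t1 t y| <= M * (1 * M ^+ 2).
    by rewrite normrM ler_pM// ?heat_y1_le ?heat_t1_le.
  have -> : 2 * M ^+ 3 = M * M ^+ 2 + M * (1 * M ^+ 2) by ring.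
  exact: lerD.
have h := heat_term_le (isT : (3 <= 4)%N) (ler0n _ 2) h1.
have S0 : 0 <= source by rewrite mulr_ge0 ?(ltW G0)// (le_trans ler01).
set X := _ * heat_kernel t y; apply: (@le_trans _ _ (1 * `|2^-1 * X|)).
  by rewrite ler_wpM2r// normal_peak1_le1.
rewrite mul1r normrM ger0_norm//.
have e3 : m ^+ 3 * (t * G) <= 2 * (2 * source).
  by rewrite exprS -mulrA ler_pM// ?(ltW m0)// mulr_ge0 ?sqr_ge0// mulr_ge0 ?ltW.
by move: h; rewrite /X; lra.
Qed.

Variable K : R.
Hypothesis K0 : 0 <= K.

Definition barrier_jet : @jet R :=
  jet_lin (jet_lin (tail_jet lam 2^-1) (lam ^+ 2) (tail_jet lam (3 / 2)))
    K (@log_heat_jet R).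

(** The relative size of the error that the barrier itself makes. *)
Definition defect : R := (lam + (Num.sqrt t)^-1) * (1 + lam ^+ 2 * t + K * (1 + ln t)).

Let ln0 : 0 <= ln t. Proof. exact: ln_ge0. Qed.

Let b1 : 0 <= (2^-1 : R) <= 3 / 2. Proof. by apply/andP; split; lra. Qed.
Let b2 : 0 <= (3 / 2 : R) <= 3 / 2. Proof. by apply/andP; split; lra. Qed.

Lemma barrier_jet_yyy_le : `|jet_yyy barrier_jet t y| <= 20000 * (defect * source).
Proof.
rewrite /= tail_half tail_3half.
have h := cubic_bound tail_y1_le tail_y2_le tail_y3_le.
set Y := tail_y3 lam t y + _ + _ in h *.
have h1 : `|0 + 3 * heat_y1 t y * (- 1 / t) + heat_y1 t y ^+ 3| <= 4 * M ^+ 3.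
  have z : `|0 : R| <= 0 * M ^+ 3 by rewrite mul0r normr0.
  have := cubic_bound heat_y1_le heat_y2_le z.
  by rewrite (_ : 0 + 3 * 1 + 1 = 4 :> R)//; ring.
have {}h1 := heat_term_le (isT : (3 <= 4)%N) (ler0n _ 4) h1.
set Z := _ * heat_kernel t y.
have -> : Y * (t * G) + lam ^+ 2 * (Y * (t ^+ 2 * G)) + K * (ln t * Z) =
   Y * (t * A * G) + K * ln t * Z by rewrite /A; ring.
have KL : 0 <= K * ln t by rewrite mulr_ge0.
have TA0 : 0 <= t * A * G by rewrite !mulr_ge0 ?ltW// (lt_le_trans ltr01).
apply: le_trans (ler_normD _ _) _; rewrite (normrM Y) (normrM (K * ln t)).
rewrite (ger0_norm KL) (ger0_norm TA0).
have X0 : 0 <= m ^+ 3 * (t * G) by rewrite !mulr_ge0 ?exprn_ge0 ?ltW.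
have e1 : `|Y| * (t * A * G) <= 15 * (m ^+ 3 * (t * G)) * A.
  rewrite [leRHS](_ : _ = 15 * m ^+ 3 * (t * A * G)); last by ring.
  rewrite ler_wpM2r//.
  by apply: le_trans h _; rewrite le_eqVlt; apply/orP; left; apply/eqP; ring.
have e2 : K * ln t * `|Z| <= K * ln t * (4 * (864 * (m ^+ 3 * (t * G)))).
  by rewrite ler_wpM2l// mulr_ge0.
apply: le_trans (lerD e1 e2) _.
apply: (@le_trans _ _ (3456 * (m ^+ 3 * (t * G)) * (A + K * (1 + ln t)))).
  have := mulr_ge0 X0 KL; have := mulr_ge0 X0 (le_trans ler01 A1).
  by have := mulr_ge0 X0 K0; lra.
have m3 : m ^+ 3 * (t * G) <= m * (2 * source).
  by rewrite exprS -mulrA ler_pM2l.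
have B0 : 0 <= A + K * (1 + ln t).
  by rewrite addr_ge0 ?(le_trans ler01 A1)// mulr_ge0// addr_ge0.
have S0 : 0 <= source by rewrite mulr_ge0 ?(ltW G0)// (le_trans ler01).
apply: (@le_trans _ _ (3456 * (m * (2 * source)) * (A + K * (1 + ln t)))).
  have := ler_wpM2r B0 m3; lra.
have -> : defect = m * (A + K * (1 + ln t)) by [].
have : 0 <= m * (A + K * (1 + ln t)) * source.
  exact: mulr_ge0 (mulr_ge0 (ltW m0) B0) S0.
lra.
Qed.

Lemma barrier_jet_tt_le : `|jet_tt barrier_jet t y| <= 20000 * (defect * source).
Proof.
rewrite /= tail_half tail_3half.
have h := quadratic_bound (tail_t1_le b1) (sqr_ge0 m) (tail_t2_le b1).
have h' := quadratic_bound (tail_t1_le b2) (sqr_ge0 m) (tail_t2_le b2).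
set Y := tail_t2 lam 2^-1 t y + _ in h *.
set Y' := tail_t2 lam (3 / 2) t y + _ in h' *.
have h1 : `|- t ^- 2 + 2 * t^-1 * heat_t1 t y + ln t *
    (heat_t2 t y + heat_t1 t y ^+ 2)| <= 3 * (1 + ln t) * M ^+ 4.
  have e1 : `|- t ^- 2| <= M ^+ 4.
    rewrite normrN -exprVn -kE ger0_norm ?sqr_ge0// (exprM M 2 2).
    by rewrite ler_pXn2r ?nnegrE ?sqr_ge0.
  have e2 : `|2 * t^-1 * heat_t1 t y| <= 2 * M ^+ 4.
    rewrite -mulrA normrM ger0_norm// ler_pM2l// normrM -kE.
    rewrite (ger0_norm (sqr_ge0 k)) (exprM M 2 2) [leRHS]expr2.
    by rewrite ler_pM ?sqr_ge0//; have := heat_t1_le; rewrite mul1r.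
  have e3 : `|ln t * (heat_t2 t y + heat_t1 t y ^+ 2)| <= ln t * (3 * M ^+ 4).
    by rewrite normrM (ger0_norm ln0) ler_wpM2l.
  apply: le_trans (ler_normD _ _) _; apply: le_trans (lerD (ler_normD _ _) (lexx _)) _.
  apply: le_trans (lerD (lerD e1 e2) e3) _.
  by rewrite le_eqVlt; apply/orP; left; apply/eqP; ring.
have {}h1 := heat_term_le (isT : (4 <= 4)%N) (mulr_ge0 (ler0n _ 3) (addr_ge0 ler01 ln0)) h1.
set Z := _ * p in h1.
have -> : Y * (t * G) + lam ^+ 2 * (Y' * (t ^+ 2 * G)) + K * (- t ^- 2 * heat_kernel t y +
   2 * t^-1 * (heat_t1 t y * heat_kernel t y) +
   ln t * ((heat_t2 t y + heat_t1 t y ^+ 2) * heat_kernel t y)) =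
   Y * (t * G) + Y' * (lam ^+ 2 * t * (t * G)) + K * Z by rewrite /Z /p; ring.
apply: le_trans (ler_normD _ _) _; apply: le_trans (lerD (ler_normD _ _) (lexx _)) _.
have tG0 : 0 <= t * G by rewrite mulr_ge0 ?ltW.
have L0 : 0 <= lam ^+ 2 * t by rewrite mulr_ge0 ?sqr_ge0// ltW.
rewrite [in X in X + _ + _]normrM [in X in _ + X + _]normrM [in X in _ + X]normrM.
rewrite (ger0_norm K0) (ger0_norm tG0) (ger0_norm (mulr_ge0 L0 tG0)).
have X0 : 0 <= m ^+ 4 * (t * G) by rewrite mulr_ge0// exprn_ge0// ltW.
have m4 : (m ^+ 2) ^+ 2 = m ^+ 4 by rewrite -exprM.
have e1 : `|Y| * (t * G) <= 14 * (m ^+ 4 * (t * G)).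
  rewrite mulrA ler_wpM2r//; apply: le_trans h _.
  by rewrite -m4 le_eqVlt; apply/orP; left; apply/eqP; ring.
have e1' : `|Y'| * (lam ^+ 2 * t * (t * G)) <= 14 * (m ^+ 4 * (t * G)) * (lam ^+ 2 * t).
  rewrite [leRHS](_ : _ = 14 * m ^+ 4 * (lam ^+ 2 * t * (t * G))); last by ring.
  apply: ler_wpM2r; first exact: mulr_ge0.
  apply: le_trans h' _.
  by rewrite -m4 le_eqVlt; apply/orP; left; apply/eqP; ring.
have e2 := ler_wpM2l K0 h1.
apply: le_trans (lerD (lerD e1 e1') e2) _.
have KL : 0 <= K * (1 + ln t) by rewrite mulr_ge0// addr_ge0.
apply: (@le_trans _ _ (2592 * (m ^+ 4 * (t * G)) * (A + K * (1 + ln t)))).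
  have := mulr_ge0 X0 KL; have := mulr_ge0 X0 L0; rewrite /A; move: X0; lra.
have m4' : m ^+ 4 * (t * G) <= m * (4 * source).
  rewrite exprS -mulrA ler_pM2l//.
  have : m * (m ^+ 2 * (t * G)) <= 2 * (2 * source).
    by rewrite ler_pM// ?(ltW m0)// mulr_ge0 ?sqr_ge0.
  by rewrite mulrA -exprS; lra.
have B0 : 0 <= A + K * (1 + ln t) by rewrite addr_ge0 ?(le_trans ler01 A1).
have S0 : 0 <= source by rewrite mulr_ge0 ?(ltW G0)// (le_trans ler01).
apply: (@le_trans _ _ (2592 * (m * (4 * source)) * (A + K * (1 + ln t)))).
  have := ler_wpM2r B0 m4'; lra.
have -> : defect = m * (A + K * (1 + ln t)) by [].
have : 0 <= m * (A + K * (1 + ln t)) * source.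
  exact: mulr_ge0 (mulr_ge0 (ltW m0) B0) S0.
lra.
Qed.

(** The tail kernels gain everywhere except at distance of order [Num.sqrt t]
    from the drifted origin, where the heat kernel with its growing factor
    [ln t] takes over; [14] is where the two regimes meet. *)
Lemma barrier_jet_supersolution : expR 7 <= K ->
  jet_yy barrier_jet t y / 2 + source / 4 <= jet_t barrier_jet t y.
Proof.
move=> K7; rewrite /= tail_half tail_3half.
have D1 : t + q ^+ 2 != 0 by rewrite gt_eqF.
have tn : t != 0 by rewrite gt_eqF.
pose a2 := (q / D) ^+ 2.
rewrite -subr_ge0 [leRHS](_ : _ = K * (t^-1 * p) + (2^-1 / t - 4 * a2) * (t * G) +
   lam ^+ 2 * ((3 / 2 / t - 4 * a2) * (t ^+ 2 * G)) - source / 4); last first.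
  rewrite /source /a2 /p /heat_t1 /heat_y1 /tail_t1 /tail_y1 /tail_y2 -/q -/D.
  by field; rewrite tn gt_eqF.
have e1 : 0 <= lam ^+ 2 * ((3 / 2 / t - 4 * a2) * (t ^+ 2 * G)) - lam ^+ 2 * t * G / 2.
  have : 0 <= lam ^+ 2 * (t ^+ 2 * G) * (k ^+ 2 - 4 * a2).
    apply: mulr_ge0; last by rewrite subr_ge0; move: qD2; rewrite /a2; lra.
    by apply: mulr_ge0; [exact: sqr_ge0|apply: mulr_ge0; [exact: sqr_ge0|exact: ltW]].
  rewrite kE [leRHS](_ : _ = lam ^+ 2 * ((3 / 2 / t - 4 * a2) * (t ^+ 2 * G)) -
    lam ^+ 2 * t * G / 2)//.
  by field.
have a2E : a2 * t = s ^+ 2 / (1 + s ^+ 2) ^+ 2.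
  have w1 : 1 + s ^+ 2 != 0 by rewrite gt_eqF// ltr_wpDr// sqr_ge0.
  have qE : q ^+ 2 = s ^+ 2 * t by rewrite sE; field.
  by rewrite /a2 DE expr_div_n qE; field; rewrite tn w1.
have e2 : 4^-1 * G <= K * (t^-1 * p) + (2^-1 / t - 4 * a2) * (t * G).
  have -> : K * (t^-1 * p) + (2^-1 / t - 4 * a2) * (t * G) =
     (K * ((1 + s ^+ 2) * expR (- (s ^+ 2 / 2))) + 2^-1 - 4 * (a2 * t)) * G.
    by rewrite heat_tail; field.
  rewrite ler_pM2r// a2E.
  have w0 := sqr_ge0 s; set w := s ^+ 2 in w0 *.
  have w1 : 0 < (1 + w) ^+ 2 by rewrite exprn_gt0// ltr_wpDr.
  have [w14|w14] := leP 14 w.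
    have : w / (1 + w) ^+ 2 <= 16^-1 by rewrite ler_pdivrMr//; nra.
    have : 0 <= K * ((1 + w) * expR (- (w / 2))).
      by rewrite !mulr_ge0 ?expR_ge0// addr_ge0.
    by lra.
  have : w / (1 + w) ^+ 2 <= 4^-1.
    by rewrite ler_pdivrMr//; have := sqr_ge0 (w - 1); rewrite sqrrB1; nra.
  have : 1 <= K * ((1 + w) * expR (- (w / 2))).
    apply: (@le_trans _ _ (expR 7 * (1 * expR (- 7)))).
      by rewrite mul1r -expRD subrr expR0.
    rewrite ler_pM ?expR_ge0// ?mul1r ?expR_ge0//.
    apply: (@le_trans _ _ (1 * expR (- (w / 2)))).
      by rewrite mul1r ler_expR lerN2; lra.
    by rewrite ler_wpM2r ?expR_ge0// lerDl.
  by lra.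
have e3 : 0 <= lam ^+ 2 * t * G.
  by apply: mulr_ge0; [apply: mulr_ge0; [exact: sqr_ge0|exact: ltW]|exact: ltW].
by move: e1 e2 e3; rewrite /source; lra.
Qed.

End barrier_bounds.

(** * The change of a jet under one jump and one time step *)

Section one_step_bounds.
Context {R : realType}.
Implicit Types (lam t y u s : R) (J : @jet R).

Lemma expR_half_le2 : expR 2^-1 <= 2 :> R.
Proof.
have : 2^-1 <= expR (- 2^-1) :> R by apply: le_trans (expR_ge1Dx _); lra.
by rewrite expRN lef_pV2 ?posrE ?expR_gt0.
Qed.

Lemma tail_kernelE lam b t y : 0 < t ->
  tail_kernel lam b t y =
  expR (lam * y + lam ^+ 2 * t / 2 + b * ln t) / spread lam t y.
Proof.
move=> t0; rewrite /tail_kernel /log_tail expRD; congr (_ * _).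
by rewrite expRN lnK// posrE spread_gt0.
Qed.

Lemma source_ge0 lam t y : 0 < t -> 0 <= source lam t y.
Proof.
move=> t0; rewrite /source mulr_ge0 ?expR_ge0//.
by rewrite addr_ge0// mulr_ge0 ?sqr_ge0// ltW.
Qed.

(** The tail profile is polynomial, so a jump by [u] changes the source by a
    polynomial in [u] times the tilt; [exp_moment] integrates this.  A Gaussian
    profile would change by too much. *)
Lemma source_jump lam t y u : 0 <= lam -> 1 <= t ->
  source lam t (y + u) <= 2 * (1 + u ^+ 2) * expR (lam * `|u|) * source lam t y.
Proof.
move=> lam0 t1; have t0 : 0 < t := lt_le_trans ltr01 t1.
rewrite /source [leRHS]mulrCA ler_wpM2l//.
  by rewrite addr_ge0// mulr_ge0 ?sqr_ge0// ltW.
rewrite !tail_kernelE//.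
set q := drifted lam t y.
have qu : drifted lam t (y + u) = q + u by rewrite /q /drifted; ring.
have D0 := spread_gt0 lam y t0; have Du0 := spread_gt0 lam (y + u) t0.
have h : spread lam t y <= 2 * (1 + u ^+ 2) * spread lam t (y + u).
  rewrite /spread qu -/q.
  have := sqr_ge0 (q + 2 * u); have := mulr_ge0 (sqr_ge0 u) (sqr_ge0 (q + u)).
  have : 0 <= u ^+ 2 * (t - 1) by rewrite mulr_ge0 ?sqr_ge0// subr_ge0.
  by have := sqr_ge0 u; lra.
rewrite ler_pdivrMr// -mulrA (mulrC _ (spread lam t (y + u))) mulrA.
have -> : lam * (y + u) + lam ^+ 2 * t / 2 + - 2^-1 * ln t =
   lam * u + (lam * y + lam ^+ 2 * t / 2 + - 2^-1 * ln t) by ring.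
set e := lam * y + _ + _; rewrite expRD.
have h1 : expR (lam * u) <= expR (lam * `|u|).
  by rewrite ler_expR ler_wpM2l// ler_norm.
apply: (@le_trans _ _ (expR (lam * `|u|) * expR e)).
  by rewrite ler_wpM2r ?expR_ge0.
rewrite -!mulrA mulrCA; rewrite mulrA mulrC mulrA.
rewrite [leRHS](_ : _ = (expR (lam * `|u|) * expR e) *
   (2 * (1 + u ^+ 2) * spread lam t (y + u) / spread lam t y)); last by ring.
by rewrite ler_peMr ?mulr_ge0 ?expR_ge0// ler_pdivlMr// mul1r.
Qed.

Lemma source_time lam t y s : 0 <= lam -> 1 <= t -> 0 <= s ->
  lam ^+ 2 * s <= 1 -> lam * s <= 1 ->
  source lam (t + s) y <= 16 * source lam t y.
Proof.
move=> lam0 t1 s0 ls1 ls2; have t0 : 0 < t := lt_le_trans ltr01 t1.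
have ts0 : 0 < t + s by rewrite ltr_wpDr.
rewrite /source !tail_kernelE//.
have D0 := spread_gt0 lam y t0; have Ds0 := spread_gt0 lam y ts0.
have h : spread lam t y <= 4 * spread lam (t + s) y.
  rewrite /spread; set q := drifted lam (t + s) y.
  have -> : drifted lam t y = q - lam * s by rewrite /q /drifted; ring.
  have l0 : 0 <= lam * s by rewrite mulr_ge0.
  have : (lam * s) ^+ 2 <= 1 by rewrite exprn_ile1.
  have := sqr_ge0 (q + lam * s); have := sqr_ge0 q; lra.
have l0 : 0 <= lam ^+ 2 * t by rewrite mulr_ge0 ?sqr_ge0// ltW.
have l1 : 0 <= lam ^+ 2 * s by rewrite mulr_ge0 ?sqr_ge0.
have e1 : 1 + lam ^+ 2 * (t + s) <= 2 * (1 + lam ^+ 2 * t) by move: l0 l1 ls1; lra.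
set a := lam * y + lam ^+ 2 * t / 2 + - 2^-1 * ln t.
have e3 : expR (lam * y + lam ^+ 2 * (t + s) / 2 + - 2^-1 * ln (t + s)) <= 2 * expR a.
  apply: (@le_trans _ _ (expR (2^-1 + a))); last first.
    by rewrite expRD ler_wpM2r ?expR_ge0// expR_half_le2.
  have lnts : ln t <= ln (t + s) by rewrite ler_ln ?posrE// lerDl.
  by rewrite ler_expR /a; move: lnts ls1; lra.
have e4 : (spread lam (t + s) y)^-1 <= 4 / spread lam t y.
  by rewrite ler_pdivlMr// mulrC ler_pdivrMr.
rewrite [leRHS](_ : _ = 2 * (1 + lam ^+ 2 * t) * (2 * expR a * (4 / spread lam t y))).
  apply: ler_pM => //.
  - by rewrite addr_ge0// mulr_ge0 ?sqr_ge0// ltW.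
  - by rewrite mulr_ge0 ?expR_ge0// invr_ge0 ltW.
  - by rewrite ler_pM ?expR_ge0// invr_ge0 ltW.
by field; rewrite gt_eqF.
Qed.

(** The prefactor left when half of the exponential rate [mu] is used for the tilt
    and the other half for the polynomial [2 * (1 + v ^ 2) * v]. *)
Definition jump_constant (mu : R) : R := 4 / mu + 432 / mu ^+ 3.

Lemma jump_constant_ge0 mu : 0 < mu -> 0 <= jump_constant mu.
Proof.
move=> m0; exact: addr_ge0 (divr_ge0 (ler0n _ 4) (ltW m0))
  (divr_ge0 (ler0n _ 432) (exprn_ge0 _ (ltW m0))).
Qed.

Lemma jump_weight_le lam mu u : 0 < mu -> lam <= mu / 2 ->
  2 * (1 + u ^+ 2) * expR (lam * `|u|) * `|u| <= jump_constant mu * expR (mu * `|u|).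
Proof.
move=> m0 lm; rewrite -real_normK ?num_real//.
set v := `|u|; have v0 : 0 <= v by exact: normr_ge0.
pose a := mu / 2 * v; have a0 : 0 <= a by rewrite mulr_ge0// divr_ge0// ltW.
have h1 : expR (lam * v) <= expR a by rewrite ler_expR ler_wpM2r.
have -> : expR (mu * v) = expR a * expR a by rewrite -expRD /a; congr expR; field.
have ea : a <= expR a by apply: le_trans (expR_ge1Dx _); rewrite lerDr.
have ea3 : a ^+ 3 <= 27 * expR a.
  have -> : expR a = expR (a / 3) ^+ 3 by rewrite -expRM_natl; congr expR; field.
  have : a / 3 <= expR (a / 3) by apply: le_trans (expR_ge1Dx _); rewrite lerDr.
  move=> e; have : (a / 3) ^+ 3 <= expR (a / 3) ^+ 3.
    by rewrite ler_pXn2r ?nnegrE ?expR_ge0// divr_ge0.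
  by rewrite expr_div_n; lra.
have vE : v = 2 / mu * a by rewrite /a; field; rewrite gt_eqF.
have key : 2 * (1 + v ^+ 2) * v <= jump_constant mu * expR a.
  have -> : 2 * (1 + v ^+ 2) * v = 4 / mu * a + 16 / mu ^+ 3 * a ^+ 3.
    by rewrite {1 2}vE; field; rewrite gt_eqF.
  have c1 : 0 <= 4 / mu by rewrite divr_ge0// ltW.
  have c2 : 0 <= 16 / mu ^+ 3 := divr_ge0 (ler0n _ 16) (exprn_ge0 _ (ltW m0)).
  have := lerD (ler_wpM2l c1 ea) (ler_wpM2l c2 ea3).
  by move/le_trans; apply; rewrite /jump_constant le_eqVlt; apply/orP; left; apply/eqP; ring.
rewrite mulrAC [leRHS]mulrA; apply: ler_pM => //.
by rewrite !mulr_ge0// addr_ge0// sqr_ge0.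
Qed.

(** The bounds under which the values of a jet along the process form a
    supermartingale. *)
Definition controlled lam (t0 T0 M th : R) J : Prop := forall t y, t0 <= t <= T0 ->
  [/\ `|jet_yyy J t y| <= M * source lam t y,
      `|jet_tt J t y| <= M * source lam t y &
      jet_yy J t y / 2 + th * source lam t y <= jet_t J t y].

Section controlled_jet.
Variables (J : @jet R) (lam t0 T0 M th mu : R).
Hypotheses (jJ : is_jet J) (cJ : controlled lam t0 T0 M th J).
Hypotheses (lam0 : 0 <= lam) (t01 : 1 <= t0) (M0 : 0 <= M) (mu0 : 0 < mu).
Hypothesis lam_mu : lam <= mu / 2.

(** Taylor expansion in space.  The remainder is estimated by the source at the
    starting point, and this has to hold for jumps of any size. *)
Lemma jump_bound t y h : t0 <= t <= T0 ->
  J t (y + h) <= J t y + jet_y J t y * h + jet_yy J t y / 2 * h ^+ 2 +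
    M * jump_constant mu * source lam t y * (h ^+ 2 * expR (mu * `|h|)).
Proof.
move=> tT; have [_ _ _ dJ] := jJ.
have t1 : 1 <= t by apply: le_trans t01 _; case/andP: tT.
have t0' : 0 < t := lt_le_trans ltr01 t1.
pose B := M * (2 * (1 + h ^+ 2) * expR (lam * `|h|) * source lam t y).
have h1 : `|J t (y + h) - (J t (y + 0) + jet_y J t (y + 0) * h +
    jet_yy J t (y + 0) / 2 * h ^+ 2)| <= B * `|h| ^+ 3.
  apply: (@taylor3 _ (fun v => J t (y + v)) (fun v => jet_y J t (y + v))
    (fun v => jet_yy J t (y + v)) (fun v => jet_yyy J t (y + v)) h B).
  - by move=> u _; apply: is_derive_shiftl; have [] := dJ t (y + u) t0'.
  - by move=> u _; apply: is_derive_shiftl; have [] := dJ t (y + u) t0'.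
  - by move=> u _; apply: is_derive_shiftl; have [] := dJ t (y + u) t0'.
  - move=> u uh; have [h1 _ _] := cJ (y + u) tT; apply: le_trans h1 _.
    rewrite /B ler_wpM2l//; apply: le_trans (source_jump y u lam0 t1) _.
    rewrite ler_wpM2r ?source_ge0//; apply: ler_pM; rewrite ?expR_ge0//.
    + by rewrite mulr_ge0// addr_ge0// sqr_ge0.
    + rewrite ler_pM2l// lerD2l -(real_normK (num_real u)) -(real_normK (num_real h)).
      by rewrite ler_pXn2r ?nnegrE.
    + by rewrite ler_expR ler_wpM2l.
rewrite addr0 in h1; have {}h1 := le_trans (ler_norm _) h1.
rewrite lerBlDl in h1; apply: le_trans h1 _; rewrite lerD2l.
have := ler_wpM2l (mulr_ge0 M0 (source_ge0 lam y t0')) (jump_weight_le h mu0 lam_mu).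
move=> h2; have := ler_wpM2r (sqr_ge0 h) h2.
rewrite /B (exprSr _ 2) real_normK ?num_real//.
by move=> h3; rewrite -subr_ge0; move: h3; rewrite -subr_ge0 => h3; apply: le_trans h3 _;
  rewrite le_eqVlt; apply/orP; left; apply/eqP; ring.
Qed.

(** Taylor expansion in time; the gain [th] over the heat equation pays for the
    second order term, and what is left of it for the remainder of [jump_bound]. *)
Lemma time_bound t y s : t0 <= t -> 0 <= s -> t + s <= T0 ->
  lam ^+ 2 * s <= 1 -> lam * s <= 1 ->
  J t y + s * (jet_yy J t y / 2) + s * ((th - 16 * M * s) * source lam t y)
    <= J (t + s) y.
Proof.
move=> tt0 s0 tsT ls1 ls2; have [_ _ _ dJ] := jJ.
have t1 : 1 <= t := le_trans t01 tt0.
have t0' : 0 < t := lt_le_trans ltr01 t1.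
have tT : t0 <= t <= T0 by rewrite tt0/= (le_trans _ tsT)// lerDl.
have h1 : J (t + 0) y + jet_t J (t + 0) y * s -
    M * (16 * source lam t y) * s ^+ 2 <= J (t + s) y.
  apply: (@taylor2 _ (fun v => J (t + v) y) (fun v => jet_t J (t + v) y)
    (fun v => jet_tt J (t + v) y) s (M * (16 * source lam t y)) s0).
  - move=> u /andP[u0 _]; have tu : 0 < t + u by rewrite ltr_wpDr.
    by apply: (is_derive_shiftl (f := J ^~ y)); have [] := dJ (t + u) y tu.
  - move=> u /andP[u0 _]; have tu : 0 < t + u by rewrite ltr_wpDr.
    by apply: (is_derive_shiftl (f := jet_t J ^~ y)); have [] := dJ (t + u) y tu.
  - move=> u /andP[u0 us]; have [|_ h2 _] := cJ (t := t + u) y.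
      by rewrite (le_trans tt0) ?lerDl//= (le_trans _ tsT)// lerD2l.
    apply: le_trans h2 _; rewrite ler_wpM2l// source_time//.
      by apply: le_trans ls1; rewrite ler_wpM2l ?sqr_ge0.
    by apply: le_trans ls2; rewrite ler_wpM2l.
rewrite addr0 in h1; apply: le_trans h1.
have [_ _ h] := cJ y tT.
have := ler_wpM2r s0 h; lra.
Qed.

End controlled_jet.

End one_step_bounds.
(** * The supermartingale inequality for one increment *)

Section exhaustion.
Context d (T : measurableType d) (R : realType) (P : probability T R).
Local Open Scope ereal_scope.

(** No integrability is known for the values of a jet along the process, so the
    inequality of one step is proved on sets where everything is bounded. *)
Lemma le_integral_exhaustion (F : (set T)^nat) (f : T -> \bar R) (c : \bar R) :
  nondecreasing_seq F -> (forall m, measurable (F m)) ->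
  measurable_fun setT f -> (forall w, 0 <= f w) ->
  {ae P, forall w, exists m, F m w} ->
  (forall m, \int[P]_(w in F m) f w <= c) -> \int[P]_w f w <= c.
Proof.
move=> ndF mF mf f0 [N [mN N0 FN]] Fc.
have mU : measurable (\bigcup_m F m) by exact: bigcup_measurable.
have UN : P (~` \bigcup_m F m) = 0.
  apply: subset_measure0 N0 => //; first exact: measurableC.
  by move=> w /= Fw; apply: FN => /= -[m Fm]; apply: Fw; exists m.
rewrite (ge0_negligible_integral (measurableC mU))// setDE setTI setCK.
have h := @ge0_nondecreasing_set_cvg_integral _ _ _ F f P ndF mF.
have {}h := h (fun i => measurable_funTS mf) (fun i w _ => f0 w).
rewrite -(cvg_lim _ h)//; apply: lime_le; first by apply/cvg_ex; eexists; exact: h.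
exact: nearW.
Qed.

End exhaustion.

Section one_step.
Context d (T : measurableType d) (R : realType) (P : probability T R).
Variables (G : set (set T)) (sG : sigma_algebra [set: T] G).
Hypothesis GT : G `<=` measurable.

Variables (X : T -> R) (H : R).
Hypothesis mX : measurable_fun setT X.
Hypothesis iX2 : P.-integrable setT (fun w => (X w ^+ 2)%:E).
Hypothesis H0 : 0 < H.
Hypothesis X0 : {ae P, forall w, condexp P G X w = 0}.
Hypothesis bern : forall k, (3 <= k)%N ->
    P.-integrable [set: T] (fun w => (X w ^+ k)%:E) /\
    {ae P, forall w, `|condexp P G (fun v => X v ^+ k) w| <=
      2^-1 * k`!%:R * H ^+ (k - 2) * condexp P G (fun v => X v ^+ 2) w}.

Let s2 := condexp P G (fun v => X v ^+ 2).
Let mu := exp_moment_rate H.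

Let mu0 : 0 < mu. Proof. by rewrite invr_gt0 mulr_gt0. Qed.

Let ms2 : measurable_wrt G s2.
Proof. exact: measurable_condexp. Qed.

Let is2 : P.-integrable setT (EFin \o s2).
Proof. exact: integrable_condexp. Qed.

Variables (J : @jet R) (lam t0 T0 M th : R).
Hypotheses (jJ : is_jet J) (cJ : controlled lam t0 T0 M th J).
Hypothesis J_ge0 : forall t y, t0 <= t <= T0 -> 0 <= J t y.
Hypotheses (lam0 : 0 <= lam) (t01 : 1 <= t0) (t0T : t0 <= T0) (M0 : 0 <= M).
Hypothesis lam_mu : lam <= mu / 2.
Hypothesis lam_H2 : lam ^+ 2 * (12 * H ^+ 2) <= 1.
Hypothesis lam_H : lam * (12 * H ^+ 2) <= 1.
Hypothesis thM : 6 * (M * jump_constant mu) + 16 * M * (12 * H ^+ 2) <= th.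

(** The remaining time lies in [[t0, T0]] only almost surely; clamping it makes
    the values of the jet nonnegative everywhere. *)
Definition clamp (t : R) := Num.max t0 (Num.min t T0).

Lemma clamp_itv t : t0 <= clamp t <= T0.
Proof. by rewrite le_max lexx/= ge_max t0T ge_min lexx orbT. Qed.

Lemma clamp_id t : t0 <= t -> t <= T0 -> clamp t = t.
Proof. by move=> h1 h2; rewrite /clamp min_l// max_r. Qed.

Lemma measurable_clamp d' (S : measurableType d') (f : S -> R) :
  measurable_fun setT f -> measurable_fun setT (fun w => clamp (f w)).
Proof. by move=> mf; apply: measurable_maxr => //; exact: measurable_minr. Qed.

Lemma measurable_source : jointly_measurable (source lam).
Proof.
move=> d' S a b ma mb; apply: measurable_funM.
  by apply: measurable_funD => //; exact: measurable_funM.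
by have [jt _ _ _] := is_jet_tail lam (- 2^-1); exact: jt.
Qed.

Variables (tau Y : T -> R).
Hypotheses (mtau : measurable_wrt G tau) (mY : measurable_wrt G Y).
Hypothesis tau_range : {ae P, forall w, t0 <= tau w - s2 w /\ tau w <= T0}.

Let Q w := X w ^+ 2 * expR (mu * `|X w|).

Let mQ : measurable_fun setT Q.
Proof.
apply: measurable_funM; first exact: measurable_funX.
by apply: measurableT_comp => //; apply: measurable_funM => //; exact: measurableT_comp.
Qed.

Let Q0 w : 0 <= Q w.
Proof. by rewrite mulr_ge0 ?sqr_ge0 ?expR_ge0. Qed.

Let m1 : measurable_wrt G (cst 1 : T -> R).
Proof. exact: measurable_cst. Qed.

Let iQ : P.-integrable setT (EFin \o Q).
Proof.
apply/integrableP; split; first exact/measurable_EFinP.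
have h w : 0 <= (cst 1 : T -> R) w <= 1 by rewrite /= ler01 lexx.
apply: le_lt_trans (ltry _); apply: le_trans (exp_moment sG GT mX iX2 H0 bern m1 h).
rewrite le_eqVlt; apply/orP; left; apply/eqP; apply: eq_integral => w _ /=.
by rewrite mul1r ger0_norm.
Qed.

Let t' w := clamp (tau w - s2 w).
Let c0 w := J (t' w) (Y w).
Let c1 w := jet_y J (t' w) (Y w).
Let c2 w := jet_yy J (t' w) (Y w) / 2.
Let c3 w := M * jump_constant mu * source lam (t' w) (Y w).
Let v0 w := J (clamp (tau w)) (Y w).

Let mt' : measurable_wrt G t'.
Proof. by apply: measurable_clamp; exact: measurable_funB. Qed.

Let mc0 : measurable_wrt G c0.
Proof. by have [j _ _ _] := jJ; exact: j. Qed.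
Let mc1 : measurable_wrt G c1.
Proof. by have [_ j _ _] := jJ; exact: j. Qed.
Let mc2 : measurable_wrt G c2.
Proof. by have [_ _ j _] := jJ; apply: measurable_funM => //; exact: j. Qed.
Let mc3 : measurable_wrt G c3.
Proof. by apply: measurable_funM => //; exact: measurable_source. Qed.
Let mv0 : measurable_wrt G v0.
Proof. by have [j _ _ _] := jJ; apply: j => //; exact: measurable_clamp. Qed.

Let good w : bool :=
  [&& t0 <= tau w - s2 w, tau w <= T0, 0 <= s2 w & s2 w <= 12 * H ^+ 2].

Let bounded (m : nat) w : bool :=
  [&& `|c0 w| <= m%:R, `|c1 w| <= m%:R, `|c2 w| <= m%:R, `|c3 w| <= m%:R &
      `|v0 w| <= m%:R].

Let A m := [set w | good w && bounded m w].

Let GA m : G (A m).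
Proof.
have mG (b : T -> bool) :
    measurable_fun [set: g_sigma_algebraType G] (b : g_sigma_algebraType G -> bool) ->
    G [set w | b w].
  move=> mb; have := mb measurableT [set true] I.
  rewrite setTI (measurable_g_measurableTypeE sG).
  by congr G; apply/seteqP; split=> w /=.
have ml (f g : T -> R) : measurable_wrt G f -> measurable_wrt G g ->
    measurable_fun [set: g_sigma_algebraType G]
      (fun w : g_sigma_algebraType G => (f w <= g w) : bool).
  by move=> mf mg; exact: measurable_fun_ler.
have mcst (r : R) : measurable_wrt G (fun=> r) by exact: measurable_cst.
have mn (f : T -> R) : measurable_wrt G f -> measurable_wrt G (fun w => `|f w|).
  by move=> mf; rewrite /measurable_wrt; exact: measurableT_comp.
apply: mG; rewrite /good /bounded.
do ?[apply: measurable_and]; apply: ml => //; try exact: mn.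
exact: measurable_funB.
Qed.

Let pointwise m w : A m w ->
  J (t' w) (Y w + X w) <= c0 w + c1 w * X w + c2 w * X w ^+ 2 + c3 w * Q w.
Proof.
move=> _; apply: (jump_bound jJ cJ lam0 t01 M0 mu0 lam_mu).
exact: clamp_itv.
Qed.

Let averaged m w : A m w -> c0 w + c2 w * s2 w + c3 w * 6 * s2 w <= v0 w.
Proof.
move=> /andP[/and4P[h1 h2 h3 h4] _].
have h5 : tau w - s2 w <= T0 by rewrite (le_trans _ h2)// gerBl.
have h6 : t0 <= tau w by rewrite (le_trans h1)// gerBl.
rewrite /v0 /c0 /c2 /c3 /t' !clamp_id//.
have e : tau w = (tau w - s2 w) + s2 w by rewrite subrK.
have b1 : lam ^+ 2 * s2 w <= 1 by apply: le_trans lam_H2; rewrite ler_wpM2l ?sqr_ge0.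
have b2 : lam * s2 w <= 1 by apply: le_trans lam_H; rewrite ler_wpM2l.
have := time_bound jJ cJ lam0 t01 M0 (Y w) h1 h3 (_ : _ <= T0) b1 b2.
rewrite -e => /(_ h2); apply: le_trans.
have S0 : 0 <= source lam (tau w - s2 w) (Y w).
  by apply: source_ge0; apply: lt_le_trans h1; apply: lt_le_trans t01.
have : 0 <= s2 w * source lam (tau w - s2 w) (Y w) *
    (th - 16 * M * s2 w - 6 * (M * jump_constant mu)).
  apply: mulr_ge0; first exact: mulr_ge0.
  have : 16 * M * s2 w <= 16 * M * (12 * H ^+ 2) by rewrite ler_wpM2l// mulr_ge0.
  by move: thM; lra.
by lra.
Qed.

(** On [A m] the coefficients of the expansion in [X] are bounded and
    [G]-measurable.  Integration removes the linear term, turns [X ^ 2] into the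
    conditional variance [s2] and the remainder into at most [6 * s2] times its
    coefficient; [time_bound] for a step of length [s2] dominates the result. *)
Lemma one_step :
  (\int[P]_w (J (clamp (tau w - s2 w)) (Y w + X w))%:E <=
   \int[P]_w (J (clamp (tau w)) (Y w))%:E)%E.
Proof.
have mTJ' : measurable_fun setT (fun w => J (t' w) (Y w + X w)).
  have [j _ _ _] := jJ; apply: j; first exact: (measurable_wrtW sG GT mt').
  by apply: measurable_funD => //; exact: (measurable_wrtW sG GT mY).
apply: (@le_integral_exhaustion _ _ _ _ A).
- apply/nondecreasing_seqP => m; apply/subsetPset => w.
  rewrite /A/= => /andP[-> h]/=.
  have le : m%:R <= m.+1%:R :> R by rewrite ler_nat.
  by case/and5P: h => a0 a1 a2 a3 a4; apply/and5P; split; apply: le_trans le.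
- by move=> m; exact: GT.
- exact/measurable_EFinP.
- by move=> w; rewrite lee_fin J_ge0// clamp_itv.
- have h1 := condexp_sqr_ge0 H0 bern.
  have h2 := condexp_sqr_le sG GT iX2 H0 bern.
  apply: filterS3 tau_range h1 h2 => w [e1 e2] e3 e4.
  pose B := `|c0 w| + `|c1 w| + `|c2 w| + `|c3 w| + `|v0 w|.
  exists (Num.truncn B).+1; rewrite /A /= /good e1 e2 e3 e4/=.
  have hB := ltW (truncnS_gt B).
  have n0 := normr_ge0 (c0 w); have n1 := normr_ge0 (c1 w).
  have n2 := normr_ge0 (c2 w); have n3 := normr_ge0 (c3 w).
  have n4 := normr_ge0 (v0 w).
  by apply/and5P; split; apply: le_trans hB; rewrite /B; lra.
move=> m.
have mA : measurable (A m) := GT (GA m).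
pose I : T -> R := \1_(A m).
have mI : measurable_wrt G I := measurable_wrt_indic sG (GA m).
have I01 w : 0 <= I w <= 1 by rewrite /I indicE; case: (_ \in _); rewrite /= ?lexx ?ler01.
pose x0 w := I w * c0 w; pose x1 w := I w * c1 w.
pose x2 w := I w * c2 w; pose x3 w := I w * c3 w.
have mx0 : measurable_wrt G x0 by exact: measurable_funM.
have mx1 : measurable_wrt G x1 by exact: measurable_funM.
have mx2 : measurable_wrt G x2 by exact: measurable_funM.
have mx3 : measurable_wrt G x3 by exact: measurable_funM.
have IA (f : T -> R) w : (A m w -> `|f w| <= m%:R) -> `|I w * f w| <= m%:R.
  move=> h; rewrite /I indicE; have [|_] := boolP (w \in A m).
    by rewrite inE mul1r.
  by rewrite mul0r normr0.
have b0 w : `|x0 w| <= m%:R by apply: IA => /andP[_ /and5P[]].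
have b1 w : `|x1 w| <= m%:R by apply: IA => /andP[_ /and5P[]].
have b2 w : `|x2 w| <= m%:R by apply: IA => /andP[_ /and5P[]].
have b3 w : `|x3 w| <= m%:R by apply: IA => /andP[_ /and5P[]].
have bv w : `|I w * v0 w| <= m%:R by apply: IA => /andP[_ /and5P[]].
have x3_ge0 w : 0 <= x3 w.
  apply: mulr_ge0; first by have /andP[] := I01 w.
  rewrite mulr_ge0 ?(mulr_ge0 M0) ?jump_constant_ge0// source_ge0//.
  apply: lt_le_trans (_ : t0 <= _); first exact: lt_le_trans t01.
  by have /andP[] := clamp_itv (tau w - s2 w).
have i1 : P.-integrable setT (EFin \o (cst 1 : T -> R)).
  exact: finite_measure_integrable_cst.
have W (f : T -> R) (mf : measurable_wrt G f) : measurable_fun setT f.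
  exact: (measurable_wrtW sG GT mf).
have ix0 : P.-integrable setT (EFin \o x0).
  rewrite (_ : x0 = (fun w => x0 w * cst 1 w)).
    exact: integrableM_bounded (W _ mx0) b0 i1.
  by apply/funext => w; rewrite /= mulr1.
have ix1 := integrableM_bounded (W _ mx1) b1 (integrable_of_sqr mX iX2).
have ix2 := integrableM_bounded (W _ mx2) b2 iX2.
have ix2s := integrableM_bounded (W _ mx2) b2 is2.
have ix3 := integrableM_bounded (W _ mx3) b3 iQ.
have ix3s := integrableM_bounded (W _ mx3) b3 is2.
have iv : P.-integrable setT (EFin \o (fun w => I w * v0 w)).
  have mIv : measurable_fun setT (fun w => I w * v0 w).
    by apply: W; exact: measurable_funM.
  rewrite (_ : (fun w => I w * v0 w) = (fun w => I w * v0 w * cst 1 w)).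
    exact: integrableM_bounded mIv bv i1.
  by apply/funext => w; rewrite /= mulr1.
pose U w := x0 w + x1 w * X w + x2 w * X w ^+ 2 + x3 w * Q w.
have iU : P.-integrable setT (EFin \o U).
  by do 3?[apply: integrable_EFinD => //].
have IJ_le w : 0 <= I w * J (t' w) (Y w + X w) <= U w.
  rewrite /U /x0 /x1 /x2 /x3 /I indicE; have [|_] := boolP (w \in A m).
    rewrite inE !mul1r => Aw; rewrite J_ge0 ?clamp_itv//=; exact: (@pointwise m).
  by rewrite !mul0r !addr0 lexx.
have iJ : P.-integrable setT (EFin \o (fun w => I w * J (t' w) (Y w + X w))).
  apply: (le_integrable measurableT _ _ iU).
    by apply/measurable_EFinP; apply: measurable_funM => //; exact: W.
  move=> w _ /=; rewrite lee_fin; have /andP[h1 h2] := IJ_le w.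
  by rewrite !ger0_norm// (le_trans h1).
have step1 : \int[P]_w (I w * J (t' w) (Y w + X w)) <= \int[P]_w U w.
  by apply: le_Rintegral => // w _; have /andP[] := IJ_le w.
have step2 : \int[P]_w U w = \int[P]_w x0 w + \int[P]_w (x2 w * s2 w) +
    \int[P]_w (x3 w * Q w).
  rewrite /U RintegralD//; last by do 2?[apply: integrable_EFinD => //].
  rewrite RintegralD//; last exact: integrable_EFinD.
  rewrite RintegralD// (condexp_mean0 sG GT mX iX2 X0 mx1 b1) addr0.
  by rewrite (condexp_var sG GT iX2 mx2 b2).
have step3 : \int[P]_w (x3 w * Q w) <= 6 * \int[P]_w (x3 w * s2 w).
  rewrite -lee_fin; have b3' w : 0 <= x3 w <= m%:R.
    by rewrite x3_ge0/= (le_trans (ler_norm _)).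
  apply: le_trans (exp_moment sG GT mX iX2 H0 bern mx3 b3').
  by rewrite /Rintegral fineK//; exact: integrable_fin_num.
have step4 : \int[P]_w x0 w + \int[P]_w (x2 w * s2 w) + 6 * \int[P]_w (x3 w * s2 w)
    <= \int[P]_w (I w * v0 w).
  rewrite -RintegralZl// -RintegralD// -RintegralD//; last 2 first.
  - exact: integrable_EFinD.
  - exact: integrable_EFinZ.
  apply: le_Rintegral => //.
    by apply: integrable_EFinD; [exact: integrable_EFinD|exact: integrable_EFinZ].
  move=> w _; rewrite /x0 /x2 /x3 /I indicE; have [|_] := boolP (w \in A m).
    rewrite inE !mul1r => /(@averaged m); lra.
  by rewrite !mul0r mulr0 !addr0.
have total : \int[P]_w (I w * J (t' w) (Y w + X w)) <= \int[P]_w (I w * v0 w).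
  by apply: le_trans step1 _; rewrite step2; apply: le_trans step4; rewrite lerD2l.
have -> : (\int[P]_(w in A m) (J (t' w) (Y w + X w))%:E =
    \int[P]_w (I w * J (t' w) (Y w + X w))%:E)%E.
  rewrite integral_mkcond; apply: eq_integral => w _.
  by rewrite patchE /I indicE; case: (_ \in _); rewrite ?mul1r ?mul0r.
apply: (@le_trans _ _ (\int[P]_w (I w * v0 w))%:E).
  rewrite -lee_fin in total; apply: le_trans total.
  by rewrite /Rintegral fineK//; exact: (integrable_fin_num measurableT iJ).
rewrite /Rintegral fineK; last exact: (integrable_fin_num measurableT iv).
have v0_ge0 w : 0 <= v0 w by rewrite J_ge0// clamp_itv.
apply: ge0_le_integral => //.
- by move=> w _; rewrite lee_fin mulr_ge0//; have /andP[] := I01 w.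
- exact: measurable_int iv.
- by apply/measurable_EFinP; exact: W.
- by move=> w _; rewrite lee_fin ler_piMl//; have /andP[] := I01 w.
Qed.

End one_step.

(** * Comparison along the martingale *)

Section martingale_comparison.
Context d (T : measurableType d) (R : realType) (P : probability T R).

Lemma measurable_wrt_sub (G1 G2 : set (set T)) (f : T -> R) :
  sigma_algebra [set: T] G1 -> sigma_algebra [set: T] G2 -> G1 `<=` G2 ->
  measurable_wrt G1 f -> measurable_wrt G2 f.
Proof.
move=> s1 s2 G12 mf _ B mB; rewrite setTI (measurable_g_measurableTypeE s2).
by apply: G12; exact: measurable_wrt_preimage.
Qed.

Variables (n : nat) (F : nat -> set (set T)) (eta : nat -> T -> R) (H N : R).
Hypothesis mart : martingale_differences P n F eta.
Hypothesis bern : bernstein_condition P n F eta H.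
Hypothesis vdev : bounded_variance_deviation P n F eta N.
Hypothesis H0 : 0 < H.

Let s2 j := condexp P (F j.-1) (fun v => eta j v ^+ 2).
Let S i w := \sum_(1 <= j < i.+1) eta j w.
Let V i w := \sum_(1 <= j < i.+1) s2 j w.

Let sF i : (i <= n)%N -> sigma_algebra [set: T] (F i).
Proof. by case: mart => _ h _ _ /h[]. Qed.

Let FT i : (i <= n)%N -> F i `<=` measurable.
Proof. by case: mart => _ h _ _ /h[]. Qed.

Let Fmono i : (i < n)%N -> F i `<=` F i.+1.
Proof. by case: mart => _ _ h _; exact: h. Qed.

Let meta i : (1 <= i <= n)%N -> measurable_wrt (F i) (eta i).
Proof. by case: mart => _ _ _ h /h[]. Qed.

Let metaT i : (1 <= i <= n)%N -> measurable_fun setT (eta i).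
Proof.
move=> i1n; have /andP[_ iln] := i1n.
exact: (measurable_wrtW (sF iln) (FT iln) (meta i1n)).
Qed.

Let ieta2 i : (1 <= i <= n)%N ->
  P.-integrable setT (fun w => (eta i w ^+ 2)%:E).
Proof. by case: mart => _ _ _ h /h[]. Qed.

Let eta0 i : (1 <= i <= n)%N -> {ae P, forall w, condexp P (F i.-1) (eta i) w = 0}.
Proof. by case: mart => _ _ _ h /h[]. Qed.

Let SS i w : S i.+1 w = S i w + eta i.+1 w.
Proof. by rewrite /S big_nat_recr. Qed.

Let VS i w : V i.+1 w = V i w + s2 i.+1 w.
Proof. by rewrite /V big_nat_recr. Qed.

Let S_0 w : S 0 w = 0. Proof. by rewrite /S big_geq. Qed.
Let V_0 w : V 0 w = 0. Proof. by rewrite /V big_geq. Qed.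

Let mS i : (i <= n)%N -> measurable_wrt (F i) (S i).
Proof.
elim: i => [|i IH] iln.
  by rewrite (_ : S 0 = cst 0); [exact: measurable_cst|apply/funext => w; rewrite S_0].
rewrite (_ : S i.+1 = (fun w => S i w + eta i.+1 w)); last first.
  by apply/funext => w; rewrite SS.
apply: measurable_funD; last exact: meta.
apply: (measurable_wrt_sub (sF (ltnW iln)) (sF iln) (Fmono iln)).
exact: IH (ltnW iln).
Qed.

Lemma measurable_martingale_sum :
  measurable_fun setT (fun w => \sum_(1 <= j < n.+1) eta j w).
Proof.
exact: (measurable_wrtW (sF (leqnn n)) (FT (leqnn n)) (mS (leqnn n))).
Qed.

Let ms2 i : (i < n)%N -> measurable_wrt (F i) (s2 i.+1).
Proof.
move=> iln; apply: measurable_condexp; [exact: sF (ltnW iln)|exact: FT (ltnW iln)|].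
exact: ieta2.
Qed.

Let mV i : (i <= n)%N -> measurable_wrt (F i) (V i).
Proof.
elim: i => [|i IH] iln.
  by rewrite (_ : V 0 = cst 0); [exact: measurable_cst|apply/funext => w; rewrite V_0].
rewrite (_ : V i.+1 = (fun w => V i w + s2 i.+1 w)); last first.
  by apply/funext => w; rewrite VS.
apply: (measurable_wrt_sub (sF (ltnW iln)) (sF iln) (Fmono iln)).
apply: measurable_funD; last exact: ms2.
exact: IH (ltnW iln).
Qed.

Let s2_ge0 : {ae P, forall w, forall i, (i < n)%N -> 0 <= s2 i.+1 w}.
Proof.
apply: ae_foralln => i; have [iln|nli] := ltnP i n; last first.
  by apply: aeW => w.
have h := condexp_sqr_ge0 H0 (fun k => @bern i.+1 k iln).
by apply: filterS h => w h _.
Qed.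

Let V_range : {ae P, forall w, (forall i, (i <= n)%N -> 0 <= V i w <= V n w) /\
   (n%:R - N ^+ 2 <= V n w <= n%:R + N ^+ 2)}.
Proof.
apply: filterS2 s2_ge0 vdev => w h1 h2; split; last first.
  by move: h2; rewrite -/(V n w) ler_distl.
have mono i j : (i <= j)%N -> (j <= n)%N -> V i w <= V j w.
  elim: j => [|j IH]; first by rewrite leqn0 => /eqP ->.
  rewrite leq_eqVlt => /orP[/eqP ->//|ij] jn; apply: (le_trans (IH ij (ltnW jn))).
  by rewrite VS lerDl h1.
by move=> i iln; rewrite mono// -(V_0 w) mono.
Qed.

Variables (J : @jet R) (lam t0 M th : R).
Let T0 := n%:R + N ^+ 2 + t0.
Hypotheses (jJ : is_jet J) (cJ : controlled lam t0 T0 M th J).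
Hypothesis J_ge0 : forall t y, t0 <= t <= T0 -> 0 <= J t y.
Hypotheses (lam0 : 0 <= lam) (t01 : 1 <= t0) (M0 : 0 <= M).
Hypothesis lam_mu : lam <= exp_moment_rate H / 2.
Hypothesis lam_H2 : lam ^+ 2 * (12 * H ^+ 2) <= 1.
Hypothesis lam_H : lam * (12 * H ^+ 2) <= 1.
Hypothesis thM : 6 * (M * jump_constant (exp_moment_rate H)) +
  16 * M * (12 * H ^+ 2) <= th.

Let t0T : t0 <= T0.
Proof. by rewrite lerDr addr_ge0// sqr_ge0. Qed.

Lemma comparison_integral (y0 : R) i : (i <= n)%N ->
  (\int[P]_w (J (clamp t0 T0 (T0 - V i w)) (y0 + S i w))%:E <= (J T0 y0)%:E)%E.
Proof.
elim: i => [|i IH] iln.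
  rewrite (eq_integral (cst (J T0 y0)%:E)) ?integral_cst//; last first.
    by move=> w _; rewrite V_0 S_0 subr0 addr0 clamp_id.
  by rewrite [X in (_ * X <= _)%E](_ : _ = 1%E) ?mule1//; exact: probability_setT.
have iln' := ltnW iln; have i1 : (1 <= i.+1 <= n)%N by [].
have mtau : measurable_wrt (F i) (fun w => T0 - V i w).
  by apply: measurable_funB; [exact: measurable_cst|exact: mV].
have mY : measurable_wrt (F i) (fun w => y0 + S i w).
  by apply: measurable_funD; [exact: measurable_cst|exact: mS].
have rng : {ae P, forall w, t0 <= T0 - V i w - s2 i.+1 w /\ T0 - V i w <= T0}.
  apply: filterS V_range => w [h1 /andP[_ h2]].
  have /andP[v0 _] := h1 i iln'; have /andP[_ v1] := h1 i.+1 iln.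
  rewrite VS in v1; split; last by rewrite gerBl.
  by rewrite /T0; lra.
have := one_step (sF iln') (FT iln') (metaT i1) (ieta2 i1) H0 (eta0 i1)
  (fun k => @bern i.+1 k i1) jJ cJ J_ge0 lam0 t01 t0T M0 lam_mu lam_H2 lam_H thM
  mtau mY rng.
move=> h; apply: le_trans (IH iln'); apply: le_trans h.
rewrite le_eqVlt; apply/orP; left; apply/eqP; apply: eq_integral => w _.
by rewrite VS SS opprD !addrA.
Qed.

(** The variance condition leaves a final time in [[t0, t0 + 2 * N ^ 2]], where the
    jet dominates the indicator of the event. *)
Lemma comparison_probability (y0 : R) (B : set R) : measurable B ->
  (forall t y, t0 <= t <= t0 + 2 * N ^+ 2 -> B y -> 1 <= J t y) ->
  (P [set w | B (y0 + \sum_(1 <= j < n.+1) eta j w)%R] <= (J T0 y0)%:E)%E.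
Proof.
move=> mB JB; apply: le_trans (comparison_integral y0 (leqnn n)).
have mSn : measurable_fun setT (fun w => y0 + S n w).
  apply: measurable_funD => //.
  exact: (measurable_wrtW (sF (leqnn n)) (FT (leqnn n)) (mS (leqnn n))).
have mVn : measurable_fun setT (fun w => T0 - V n w).
  apply: measurable_funB => //.
  exact: (measurable_wrtW (sF (leqnn n)) (FT (leqnn n)) (mV (leqnn n))).
set E := mkset _; have mE : measurable E.
  by rewrite -[E]setTI; exact: mSn.
rewrite -(setIT E) -integral_indic//; apply: ae_ge0_le_integral => //.
- exact/measurable_EFinP/measurable_indic.
- by move=> w _; rewrite lee_fin J_ge0// clamp_itv.
- have [j _ _ _] := jJ; apply/measurable_EFinP; apply: j => //.
  exact: measurable_clamp.
- apply: filterS V_range => w [_ /andP[h1 h2]] _; rewrite lee_fin indicE.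
  have [|_] := boolP (w \in E); last by rewrite J_ge0// clamp_itv.
  rewrite inE => Ew; apply: JB => //.
  have e1 : t0 <= T0 - V n w by rewrite /T0; lra.
  have N0 := sqr_ge0 N; have n0 : 0 <= n%:R :> R by [].
  have e2 : T0 - V n w <= t0 + 2 * N ^+ 2 by rewrite /T0; lra.
  apply/andP; split; first by rewrite le_max lexx.
  by rewrite ge_max lerDl mulr_ge0//= ge_min e2.
Qed.

End martingale_comparison.

(** * The approximations of the two tail events *)

Section approximating_jets.
Context {R : realType}.
Implicit Types (lam t y B K x : R) (e : bool).

(** [e = true] bounds the right tail from above and [e = false] bounds the
    complementary event from above. *)
Definition signed_Phi_jet e : @jet R :=
  if e then Phi_jet else jet_lin (jet_cst 1) (-1) Phi_jet.

Definition approx_jet e lam B K : @jet R :=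
  jet_lin (signed_Phi_jet e) B (barrier_jet lam K).

Lemma is_jet_approx e lam B K : is_jet (approx_jet e lam B K).
Proof.
apply: is_jet_lin.
  by case: e; [exact: is_jet_Phi|apply: is_jet_lin; [exact: is_jet_cst|exact: is_jet_Phi]].
by apply: is_jet_lin; [apply: is_jet_lin; exact: is_jet_tail|exact: is_jet_log_heat].
Qed.

(** The first of the three summands of the barrier is enough to dominate the
    Gaussian tail at the final time. *)
Lemma barrier_ge_tail lam t y K : 1 <= t -> 0 <= K ->
  t * tail_kernel lam (- 2^-1) t y <= barrier_jet lam K t y.
Proof.
move=> t1 K0; rewrite /= -(tail_half lam y t1) -addrA lerDl addr_ge0//.
  by rewrite mulr_ge0 ?sqr_ge0 ?expR_ge0.
by rewrite !mulr_ge0 ?ln_ge0 ?expR_ge0.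
Qed.

Lemma barrier_ge0 lam t y K : 1 <= t -> 0 <= K -> 0 <= barrier_jet lam K t y.
Proof.
move=> t1 K0; apply: le_trans (barrier_ge_tail lam y t1 K0).
by rewrite mulr_ge0 ?expR_ge0// (le_trans ler01).
Qed.

Lemma signed_Phi_val e t y :
  signed_Phi_jet e t y = std_normal_cdf ((if e then y else - y) / Num.sqrt t).
Proof. by case: e => //=; rewrite [- y / _]mulNr PhiN mulN1r. Qed.

Lemma approx_jetE e lam B K t y : approx_jet e lam B K t y =
  std_normal_cdf ((if e then y else - y) / Num.sqrt t) +
  B * barrier_jet lam K t y.
Proof. by rewrite -signed_Phi_val. Qed.

Lemma approx_ge0 e lam t y B K : 1 <= t -> 0 <= K -> 0 <= B ->
  0 <= approx_jet e lam B K t y.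
Proof.
move=> t1 K0 B0; rewrite approx_jetE addr_ge0 ?Phi_ge0//.
by rewrite mulr_ge0// barrier_ge0.
Qed.

Lemma norm_lin_le (a b c c1 c2 B : R) : 0 <= B ->
  `|a| <= c1 * c -> `|b| <= c2 * c -> `|a + B * b| <= (c1 + B * c2) * c.
Proof.
move=> B0 h1 h2; apply: le_trans (ler_normD _ _) _; rewrite normrM (ger0_norm B0).
by rewrite mulrDl -mulrA lerD// ler_wpM2l.
Qed.

(** [Phi (y / sqrt t)] satisfies the heat equation exactly, so the whole gain comes
    from the barrier. *)
Lemma approx_controlled e lam B K dlt t0 T0 :
  0 <= lam -> lam <= 1 -> 1 <= t0 -> 0 <= B -> expR 7 <= K ->
  (forall t, t0 <= t <= T0 -> defect lam t K <= dlt) ->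
  controlled lam t0 T0 (4000 + B * (20000 * dlt)) (B / 4) (approx_jet e lam B K).
Proof.
move=> lam0 lam1 t01 B0 K7 hd t y tT.
have K0 : 0 <= K := le_trans (expR_ge0 _) K7.
have t1 : 1 <= t by apply: le_trans t01 _; case/andP: tT.
have S0 : 0 <= source lam t y by apply: source_ge0; exact: lt_le_trans t1.
have dS : 20000 * (defect lam t K * source lam t y) <= 20000 * dlt * source lam t y.
  by rewrite -mulrA; apply: ler_wpM2l; [exact: ler0n|apply: ler_wpM2r => //; exact: hd].
have nz (z : R) : `|0 + -1 * z| = `|z| by rewrite add0r mulN1r normrN.
have b1 := le_trans (barrier_jet_yyy_le y lam0 t1 K0) dS.
have b2 := le_trans (barrier_jet_tt_le y lam0 lam1 t1 K0) dS.
have p1 := Phi_jet_yyy_le y lam0 t1.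
have p2 := Phi_jet_tt_le y lam0 lam1 t1.
have b3 := barrier_jet_supersolution lam y t1 K0 K7.
split.
- by apply: norm_lin_le b1 => //; case: e => //=; rewrite nz.
- by apply: norm_lin_le b2 => //; case: e => //=; rewrite nz.
- have eP : jet_yy (signed_Phi_jet e) t y / 2 = jet_t (signed_Phi_jet e) t y.
    by clear; case: e; rewrite /= ?add0r; field.
  have -> : jet_t (approx_jet e lam B K) t y = jet_t (signed_Phi_jet e) t y +
    B * jet_t (barrier_jet lam K) t y by [].
  have -> : jet_yy (approx_jet e lam B K) t y = jet_yy (signed_Phi_jet e) t y +
    B * jet_yy (barrier_jet lam K) t y by [].
  by rewrite -eP; move: (ler_wpM2l B0 b3); clear; lra.
Qed.

(** At the final time the distribution function falls short of [1] by at most a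
    Gaussian tail, which the barrier covers when [B] is large compared with the
    square root of that time. *)
Lemma approx_terminal e lam t t1 y B K : 0 <= lam -> lam <= 1 ->
  1 <= t -> t <= t1 -> 0 <= K -> 1728 * Num.sqrt t1 <= B ->
  (if e then 0 < y else y <= 0) -> 1 <= approx_jet e lam B K t y.
Proof.
move=> lam0 lam1 t1' tt1 K0 hB hy.
have t0 : 0 < t := lt_le_trans ltr01 t1'.
have s0 : 0 < Num.sqrt t by rewrite sqrtr_gt0.
rewrite approx_jetE.
have y'0 : 0 <= (if e then y else - y).
  by case: e hy => h; rewrite ?oppr_ge0// ltW.
have gE : gauss ((if e then y else - y) / Num.sqrt t) = Num.sqrt t * heat_kernel t y.
  rewrite heat_kernelE// mulrCA divff ?gt_eqF// mulr1; case: e {hy y'0} => //.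
  by rewrite mulNr gaussN.
move: (if e then y else - y) y'0 gE => y' y'0 gE.
have h := Phi_le2gauss (divr_ge0 y'0 (ltW s0)).
rewrite PhiN gE in h.
have hh := growth_heat_le y lam0 t1' (isT : (0 <= 4)%N).
rewrite !expr0 !mul1r in hh.
have hW := barrier_ge_tail lam y t1' K0.
have G0 : 0 <= t * tail_kernel lam (- 2^-1) t y.
  by rewrite mulr_ge0 ?expR_ge0// ltW.
have st : Num.sqrt t <= Num.sqrt t1 by rewrite ler_sqrt// (le_trans _ tt1)// ltW.
have B0 : 0 <= B by apply: le_trans hB; rewrite mulr_ge0 ?sqrtr_ge0 ?ler0n.
have e1 : 2 * (Num.sqrt t * heat_kernel t y) <= B * (t * tail_kernel lam (- 2^-1) t y).
  have : 1728 * Num.sqrt t <= B by apply: le_trans hB; rewrite ler_wpM2l ?ler0n.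
  by move=> /(ler_wpM2r G0); move: (ler_wpM2l (ltW s0) hh); clear; lra.
have e2 := ler_wpM2l B0 hW.
by move: h e1 e2; clear; lra.
Qed.

End approximating_jets.

(** * Values at the starting point *)

Section starting_values.
Context {R : realType}.
Implicit Types (x n e K lam t a eps : R).

Variables (n e x : R).
Hypotheses (n0 : 0 < n) (e0 : 0 <= e) (x0 : 0 <= x) (en : e <= n).
Hypothesis xe : x ^+ 2 * e / n <= 1.

Let T := n + e.
Let lam := x / Num.sqrt n.
Let y := - (x * Num.sqrt n).

Let T0 : 0 < T. Proof. by rewrite ltr_wpDr. Qed.
Let sn0 : 0 < Num.sqrt n. Proof. by rewrite sqrtr_gt0. Qed.
Let snE : Num.sqrt n ^+ 2 = n. Proof. by rewrite sqr_sqrtr// ltW. Qed.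
Let sT0 : 0 < Num.sqrt T. Proof. by rewrite sqrtr_gt0. Qed.
Let sTE : Num.sqrt T ^+ 2 = T. Proof. by rewrite sqr_sqrtr// ltW. Qed.
Let snT : Num.sqrt n <= Num.sqrt T.
Proof. by rewrite ler_sqrt ?lerDl// ltW. Qed.
Let lam2 : lam ^+ 2 = x ^+ 2 / n. Proof. by rewrite expr_div_n snE. Qed.

Let sTV : (Num.sqrt T)^-1 <= (Num.sqrt n)^-1.
Proof. by rewrite lef_pV2 ?posrE. Qed.

(** The surplus [e] of the initial time over [n] changes the exponent
    [x ^ 2 / 2] by at most [1 / 2]. *)
Lemma gauss_start : gauss (y / Num.sqrt T) <= 2 * gauss x.
Proof.
rewrite /gauss; apply: (@le_trans _ _ (expR (2^-1 - x ^+ 2 / 2))).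
  rewrite ler_expR expr_div_n sTE sqrrN exprMn snE.
  have h : x ^+ 2 - x ^+ 2 * n / T <= x ^+ 2 * e / n.
    have -> : x ^+ 2 - x ^+ 2 * n / T = x ^+ 2 * e / T by rewrite /T; field; rewrite gt_eqF.
    apply: ler_wpM2l; first by rewrite mulr_ge0 ?sqr_ge0.
    by rewrite lef_pV2 ?posrE// lerDl.
  by move: h xe; lra.
by rewrite expRD ler_wpM2r ?expR_ge0// expR_half_le2.
Qed.

Lemma tilt_start : expR (lam * y + lam ^+ 2 * T / 2) <= 2 * gauss x.
Proof.
rewrite /gauss; apply: (@le_trans _ _ (expR (2^-1 - x ^+ 2 / 2))).
  rewrite ler_expR lam2.
  have -> : lam * y = - x ^+ 2 by rewrite /lam /y; field; rewrite gt_eqF.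
  have -> : x ^+ 2 / n * T / 2 = x ^+ 2 / 2 + x ^+ 2 * e / n / 2.
    by rewrite /T; field; rewrite gt_eqF.
  by move: xe; lra.
by rewrite expRD ler_wpM2r ?expR_ge0// expR_half_le2.
Qed.

(** At the starting point the optimal tilt [lam = x / sqrt n] makes the tail kernels
    as small as the normal density at [x]; this is the reason for its choice. *)
Lemma barrier_start K : 1 <= n -> 0 <= K ->
  barrier_jet lam K T y <=
  2 * gauss x / Num.sqrt n * (1 + 2 * x ^+ 2 + K * ln T).
Proof.
move=> n1 K0; have T1 : 1 <= T by rewrite (le_trans n1)// lerDl.
have lnT : 0 <= ln T by rewrite ln_ge0.
have g0 := ltW (gauss_gt0 x).
have h1 : T * tail_kernel lam (- 2^-1) T y <= 2 * gauss x / Num.sqrt n.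
  rewrite tail_kernelE//.
  have -> : expR (lam * y + lam ^+ 2 * T / 2 + - 2^-1 * ln T) =
      expR (lam * y + lam ^+ 2 * T / 2) / Num.sqrt T.
    rewrite expRD; congr (_ * _); rewrite sqrt_expR_ln// -expRN; congr expR.
    by ring.
  rewrite mulrCA; apply: (@le_trans _ _ (expR (lam * y + lam ^+ 2 * T / 2) / Num.sqrt T)).
    rewrite ler_piMr// ?mulr_ge0 ?expR_ge0 ?invr_ge0 ?(ltW sT0)//.
    by rewrite ler_pdivrMr ?spread_gt0// mul1r lerDl sqr_ge0.
  apply: ler_pM => //; rewrite ?expR_ge0 ?invr_ge0 ?(ltW sT0)//.
  exact: tilt_start.
have h2 : heat_kernel T y <= 2 * gauss x / Num.sqrt n.
  rewrite heat_kernelE//; apply: ler_pM => //.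
  - exact: ltW (gauss_gt0 _).
  - exact: gauss_start.
have lT : lam ^+ 2 * T <= 2 * x ^+ 2.
  rewrite lam2 /T mulrAC ler_pdivrMr//.
  have : x ^+ 2 * (n + e) <= x ^+ 2 * (n + n) by rewrite ler_wpM2l ?sqr_ge0// lerD2l.
  by lra.
have lT0 : 0 <= lam ^+ 2 * T by rewrite mulr_ge0 ?sqr_ge0// ltW.
rewrite /= (tail_half lam y T1) (tail_3half lam y T1).
set G := tail_kernel _ _ _ _ in h1 *; set C := 2 * gauss x / Num.sqrt n in h1 h2 *.
have C0 : 0 <= C by rewrite divr_ge0 ?(ltW sn0)// mulr_ge0.
have -> : T * G + lam ^+ 2 * (T ^+ 2 * G) + K * (ln T * heat_kernel T y) =
  (1 + lam ^+ 2 * T) * (T * G) + K * ln T * heat_kernel T y by ring.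
rewrite [leRHS](_ : _ = (1 + 2 * x ^+ 2) * C + K * ln T * C); last by ring.
apply: lerD; last by rewrite ler_wpM2l// mulr_ge0.
apply: ler_pM => //.
- by rewrite addr_ge0.
- by rewrite mulr_ge0 ?expR_ge0// ltW.
- by rewrite lerD2l.
Qed.

Lemma Phi_start :
  0 <= std_normal_cdf (y / Num.sqrt T) - std_normal_cdf (- x) <= 2 * gauss x * (x * e / n).
Proof.
pose r := Num.sqrt n / Num.sqrt T.
have r0 : 0 < r by rewrite divr_gt0.
have r1 : r <= 1 by rewrite ler_pdivrMr// mul1r.
have yE : y / Num.sqrt T = - (x * r) by rewrite /y /r mulNr mulrA.
have xr : x * r <= x by rewrite ler_piMr.
have [c] := @mean_value _ (@std_normal_cdf R) _ (- x) (y / Num.sqrt T) (fun z _ => is_derive_Phi z).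
rewrite yE min_l ?max_r ?lerN2// => /andP[c1 c2] ->.
have d0 : 0 <= - (x * r) - - x by rewrite opprK addrC subr_ge0.
apply/andP; split.
  by rewrite mulr_ge0// mulr_ge0 ?(ltW normal_peak1_gt0)// ltW// gauss_gt0.
apply: ler_pM => //.
- by rewrite mulr_ge0 ?(ltW normal_peak1_gt0)// ltW// gauss_gt0.
- apply: (@le_trans _ _ (gauss c)).
    by rewrite ler_piMl ?normal_peak1_le1// ltW// gauss_gt0.
  apply: le_trans gauss_start; rewrite yE gaussN /gauss ler_expR lerN2.
  rewrite ler_pM2r// -[c ^+ 2]sqrrN ler_pXn2r ?nnegrE ?mulr_ge0 ?(ltW r0)//.
    by rewrite lerNr.
  by rewrite oppr_ge0 (le_trans c2)// oppr_le0 mulr_ge0 ?(ltW r0).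
- rewrite opprK addrC -{1}[x]mulr1 -mulrBr -mulrA ler_wpM2l//.
  apply: (@le_trans _ _ (1 - r ^+ 2)).
    by rewrite lerD2l lerN2 expr2 ler_piMl// ltW.
  rewrite /r expr_div_n snE sTE.
  have -> : 1 - n / T = e / T by rewrite /T; field; rewrite gt_eqF.
  by rewrite ler_wpM2l// lef_pV2 ?posrE// lerDl.
Qed.

End starting_values.

(** * Smallness of the defect *)

Section constants.
Context {R : realType}.
Implicit Types (x n K lam t a eps : R).

Lemma ln_double n : 0 < n -> ln (2 * n) <= 1 + ln n.
Proof.
move=> n0; rewrite lnM ?posrE// lerD2r.
by apply: le_trans (le_ln1Dx _) _; lra.
Qed.

(** The part of the defect that does not vanish with [x ^ 3 / sqrt n] is small for
    large remaining time; stopping the clock at [t0] makes it small throughout. *)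
Lemma log_defect_small K eps : 0 <= K -> 0 < eps -> exists2 t0 : R, 1 <= t0 &
  forall t, t0 <= t -> (Num.sqrt t)^-1 * (1 + K * (1 + ln t)) <= eps.
Proof.
move=> K0 eps0; pose v := 1 + (1 + 5 * K) / eps.
have c0 : 0 <= (1 + 5 * K) / eps by rewrite divr_ge0 ?(ltW eps0)// addr_ge0// mulr_ge0.
have v1 : 1 <= v by rewrite lerDl.
have v0 : 0 < v := lt_le_trans ltr01 v1.
exists (v ^+ 4); first exact: exprn_ege1.
move=> t vt; have t0 : 0 < t by apply: lt_le_trans vt; rewrite exprn_gt0.
pose u := Num.sqrt (Num.sqrt t).
have uE : u ^+ 2 = Num.sqrt t by rewrite sqr_sqrtr// sqrtr_ge0.
have uE4 : u ^+ 4 = t by rewrite (exprM u 2 2) uE sqr_sqrtr// ltW.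
have u0 : 0 < u by rewrite !sqrtr_gt0.
have vu : v <= u.
  by rewrite -(ler_pXn2r (n := 4)) ?nnegrE ?(ltW u0) ?(ltW v0)// uE4.
have u1 : 1 <= u := le_trans v1 vu.
have lnu : ln t <= 4 * u.
  by rewrite -uE4 lnXn// -[leLHS]mulr_natl ler_pM2l// ltW// ln_sublinear.
have h : 1 + K * (1 + ln t) <= (1 + 5 * K) * u.
  have : K * (1 + ln t) <= K * (u + 4 * u) by rewrite ler_wpM2l// lerD.
  by move: u1; lra.
rewrite -uE mulrC ler_pdivrMr ?exprn_gt0//; apply: le_trans h _.
rewrite expr2 mulrA ler_pM2r//.
have : eps * v <= eps * u by rewrite ler_pM2l.
apply: le_trans; rewrite /v mulrDr mulr1 mulrCA divff ?gt_eqF// mulr1.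
by rewrite lerDr ltW.
Qed.

(** The remaining terms of the defect are multiples of [x ^ 3 / sqrt n]; the
    hypothesis on [ln n] absorbs the logarithm. *)
Lemma defect_le n x t a eps K : 1 <= n -> 1 <= x -> 1 <= t -> t <= 2 * n ->
  0 <= K -> 0 <= a -> ln n <= a * x ^+ 2 ->
  (Num.sqrt t)^-1 * (1 + K * (1 + ln t)) <= eps ->
  defect (x / Num.sqrt n) t K <= eps + x ^+ 3 / Num.sqrt n * (5 + K * (2 + a)).
Proof.
move=> n1 x1 t1 tn K0 a0 lnn ht.
have n0 : 0 < n := lt_le_trans ltr01 n1.
have t0 : 0 < t := lt_le_trans ltr01 t1.
have x0 : 0 <= x := le_trans ler01 x1.
set lam := x / Num.sqrt n; set k := (Num.sqrt t)^-1.
have sn0 : 0 < Num.sqrt n by rewrite sqrtr_gt0.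
have snE : Num.sqrt n ^+ 2 = n by rewrite sqr_sqrtr// ltW.
have st0 : 0 < Num.sqrt t by rewrite sqrtr_gt0.
have stE : Num.sqrt t ^+ 2 = t by rewrite sqr_sqrtr// ltW.
have lam0 : 0 <= lam by rewrite divr_ge0// ltW.
have x2 : 1 <= x ^+ 2 by rewrite exprn_ege1.
set kap := x ^+ 3 / Num.sqrt n.
have kapE : kap = lam * x ^+ 2 by rewrite /kap /lam; ring.
have kap0 : 0 <= kap by rewrite kapE mulr_ge0// sqr_ge0.
have lamk : lam <= kap by rewrite kapE ler_peMr.
have s2 : Num.sqrt t <= 2 * Num.sqrt n.
  rewrite -(ler_pXn2r (n := 2)) ?nnegrE ?mulr_ge0 ?sqrtr_ge0//.
  by rewrite exprMn snE stE; move: tn n0; lra.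
have e1 : k * (lam ^+ 2 * t) <= 2 * kap.
  have -> : k * (lam ^+ 2 * t) = lam ^+ 2 * Num.sqrt t.
    by rewrite /k -{2}stE; field; rewrite gt_eqF.
  apply: (@le_trans _ _ (lam ^+ 2 * (2 * Num.sqrt n))); first by rewrite ler_wpM2l ?sqr_ge0.
  have -> : lam ^+ 2 * (2 * Num.sqrt n) = 2 * (lam * x).
    by rewrite /lam; field; rewrite gt_eqF.
  rewrite ler_pM2l// kapE ler_wpM2l// expr2 ler_peMr//.
have e2 : lam * (lam ^+ 2 * t) <= 2 * kap.
  apply: (@le_trans _ _ (lam * (lam ^+ 2 * (2 * n)))).
    by rewrite ler_wpM2l// ler_wpM2l ?sqr_ge0.
  rewrite le_eqVlt; apply/orP; left; apply/eqP.
  by rewrite /lam /kap -{3}snE; field; rewrite gt_eqF.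
have lnt : 1 + ln t <= (2 + a) * x ^+ 2.
  have : ln t <= 1 + ln n.
    apply: le_trans (ln_double n0); rewrite ler_ln ?posrE// mulr_gt0//.
  by move: lnn x2; lra.
have e3 : lam * (K * (1 + ln t)) <= K * (2 + a) * kap.
  have := ler_wpM2l (mulr_ge0 lam0 K0) lnt.
  by rewrite kapE; lra.
have -> : defect lam t K = k * (1 + K * (1 + ln t)) + k * (lam ^+ 2 * t) +
   lam + lam * (lam ^+ 2 * t) + lam * (K * (1 + ln t)) by rewrite /defect -/k; ring.
by move: ht e1 e2 e3 lamk; rewrite -/k; lra.
Qed.

End constants.

(** * The right tail *)

Section right_tail.
Context {R : realType}.

(** The argument below only uses that these constants depend on nothing. *)
Lemma approx_constants : exists c1 c2 c3 : R, [/\ 0 <= c1, 0 < c2, 0 <= c3,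
  forall e lam B K dlt t0 T0, 0 <= lam -> lam <= 1 -> 1 <= t0 -> 0 <= B ->
    expR 7 <= K -> (forall t, t0 <= t <= T0 -> defect lam t K <= dlt) ->
    controlled lam t0 T0 (c1 + B * (c2 * dlt)) (B / 4) (approx_jet e lam B K) &
  forall e lam t t1 y B K, 0 <= lam -> lam <= 1 -> 1 <= t -> t <= t1 ->
    0 <= K -> c3 * Num.sqrt t1 <= B -> (if e then 0 < y else y <= 0) ->
    1 <= approx_jet e lam B K t y].
Proof.
exists 4000, 20000, 1728; split; [exact: ler0n|by rewrite ltr0n|exact: ler0n| |].
- exact: approx_controlled.
- exact: approx_terminal.
Qed.

(** The order of choices matters: the terminal time [t0] makes the defect small
    enough for the barrier to absorb its own errors, then [B] is chosen to absorb
    those of [Phi] and to cover the terminal values, and [kap0] comes last. *)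
Lemma right_tail_estimate (H N a : R) : 0 < H -> 0 <= a ->
  exists C kap0 n1 : R, [/\ 0 <= C, 0 < kap0 &
  forall d (T : measurableType d) (P : probability T R) (n : nat)
    (F : nat -> set (set T)) (eta : nat -> T -> R),
  martingale_differences P n F eta -> bernstein_condition P n F eta H ->
  bounded_variance_deviation P n F eta N ->
  forall x : R, n1 <= n%:R -> 1 <= x -> ln n%:R <= a * x ^+ 2 ->
    x ^+ 3 / Num.sqrt n%:R <= kap0 ->
  `|fine (P [set w | x * Num.sqrt n%:R < \sum_(1 <= i < n.+1) eta i w])
     - std_normal_cdf (- x)| <= C * (gauss x * (x ^+ 2 / Num.sqrt n%:R))].
Proof.
move=> H0 a0.
pose mu := exp_moment_rate H; pose K : R := expR 7.
have mu0 : 0 < mu by rewrite invr_gt0 mulr_gt0.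
have K0 : 0 <= K by exact: expR_ge0.
pose L := 6 * jump_constant mu + 16 * (12 * H ^+ 2).
have L0 : 0 <= L.
  apply: addr_ge0; first by rewrite mulr_ge0 ?jump_constant_ge0.
  apply: mulr_ge0; first exact: ler0n.
  by apply: mulr_ge0; [exact: ler0n|exact: sqr_ge0].
have [c1 [c2 [c3 [c10 c20 c30 approx_ctrl approx_term]]]] := approx_constants.
(* With this defect the barrier loses at most half of its gain [B / 4] to its own
   errors; the first summand of [B] below covers the errors of [Phi] with the
   other half. *)
pose dlt := (8 * c2 * (L + 1))^-1.
have dlt0 : 0 < dlt by rewrite invr_gt0 !mulr_gt0// ltr_wpDl.
have [t0 t01 ht0] := @log_defect_small R K (dlt / 2) K0 (divr_gt0 dlt0 (ltr0Sn _ 1)).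
pose e := N ^+ 2 + t0.
have e0 : 0 <= e by rewrite addr_ge0 ?sqr_ge0// (le_trans ler01).
pose B := 8 * c1 * L + c3 * Num.sqrt (t0 + 2 * N ^+ 2).
have B0 : 0 <= B by rewrite addr_ge0// !mulr_ge0// ?sqrtr_ge0.
pose C2 := 5 + K * (2 + a).
have C20 : 0 <= C2 by rewrite addr_ge0// mulr_ge0// addr_ge0.
pose q := 1 + 2 * C2 / dlt + 2 / mu + 12 * H ^+ 2 + e.
have q1 : 0 <= 2 * C2 / dlt by rewrite divr_ge0 ?(ltW dlt0)// mulr_ge0.
have q2 : 0 <= 2 / mu by rewrite divr_ge0// ltW.
have q3 : 0 <= 12 * H ^+ 2 by rewrite mulr_ge0// sqr_ge0.
have q0 : 0 < q by rewrite /q; lra.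
pose M := c1 + B * (c2 * dlt).
have M0 : 0 <= M by rewrite addr_ge0// mulr_ge0// mulr_ge0// ltW.
have thM : 6 * (M * jump_constant mu) + 16 * M * (12 * H ^+ 2) <= B / 4.
  have -> : 6 * (M * jump_constant mu) + 16 * M * (12 * H ^+ 2) = M * L.
    by rewrite /L; ring.
  have h1 : c1 * L <= B / 8.
    have : 0 <= c3 * Num.sqrt (t0 + 2 * N ^+ 2) by rewrite mulr_ge0 ?sqrtr_ge0.
    by rewrite /B; lra.
  have h2 : c2 * dlt * L <= 8^-1.
    have -> : c2 * dlt * L = 8^-1 * (L / (L + 1)).
      by rewrite /dlt; field; rewrite !gt_eqF// ltr_wpDl.
    by rewrite ler_piMr// ler_pdivrMr ?mul1r ?lerDl// ltr_wpDl.
  have := ler_wpM2l B0 h2; move: h1; rewrite /M; lra.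
exists (B * (2 * (3 + K * (1 + a))) + 2 * e), q^-1, (1 + e); split.
- by rewrite addr_ge0 ?mulr_ge0// addr_ge0// mulr_ge0// addr_ge0.
- by rewrite invr_gt0.
move=> d T P n F eta mart bern vdev x n1 x1 lnx xk.
have n1' : 1 <= n%:R :> R by apply: le_trans n1; rewrite lerDl.
have en : e <= n%:R by apply: le_trans n1; rewrite lerDr.
have n0 : 0 < n%:R :> R := lt_le_trans ltr01 n1'.
have x0 : 0 <= x := le_trans ler01 x1.
have sn0 : 0 < Num.sqrt n%:R :> R by rewrite sqrtr_gt0.
have snE : Num.sqrt n%:R ^+ 2 = n%:R :> R by rewrite sqr_sqrtr.
have x21 : 1 <= x ^+ 2 by rewrite exprn_ege1.
pose lam := x / Num.sqrt n%:R.
have lam0 : 0 <= lam by rewrite divr_ge0// ltW.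
have lamq : lam <= q^-1.
  by apply: le_trans xk; rewrite ler_wpM2r ?invr_ge0 ?(ltW sn0)// exprS ler_peMr.
have qi (z : R) : 0 <= z -> z <= q -> q^-1 * z <= 1.
  by move=> z0 zq; rewrite mulrC ler_pdivrMr// mul1r.
have lam_le (z : R) : 0 <= z -> z <= q -> lam * z <= 1.
  by move=> z0 zq; apply: le_trans (qi z z0 zq); rewrite ler_wpM2r.
have lam1 : lam <= 1 by rewrite -[lam]mulr1; apply: lam_le => //; rewrite /q; lra.
have lam_mu : lam <= mu / 2.
  have := lam_le _ q2 (_ : _ <= q); rewrite /q => /(_ ltac:(lra)).
  by rewrite mulrA ler_pdivrMr// mul1r ler_pdivlMr.
have lam_H : lam * (12 * H ^+ 2) <= 1 by apply: lam_le => //; rewrite /q; lra.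
have lam_H2 : lam ^+ 2 * (12 * H ^+ 2) <= 1.
  by apply: le_trans lam_H; rewrite ler_wpM2r// expr2 ler_piMr.
have lam_e : lam * e <= 1 by apply: lam_le => //; rewrite /q; lra.
have xe : x ^+ 2 * e / n%:R <= 1.
  have -> : x ^+ 2 * e / n%:R = lam * (lam * e).
    by rewrite -[X in _ / X = _]snE /lam; field; rewrite gt_eqF.
  by rewrite (le_trans _ lam1)// ler_piMr.
pose T0 : R := n%:R + N ^+ 2 + t0.
have T0E : T0 = n%:R + e by rewrite /T0 -addrA.
have T02 : T0 <= 2 * n%:R by rewrite T0E; move: en; lra.
have dT t : t0 <= t <= T0 -> defect lam t K <= dlt.
  move=> /andP[h1 h2].
  have := defect_le n1' x1 (le_trans t01 h1) (le_trans h2 T02) K0 a0 lnx (ht0 t h1).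
  move/le_trans; apply; rewrite -/C2.
  have : 2 * C2 / dlt <= q by rewrite /q; lra.
  move/(qi _ q1); rewrite mulrA ler_pdivrMr// mul1r => h3.
  by have := ler_wpM2r C20 xk; lra.
have cJ b := approx_ctrl b _ _ _ _ _ _ lam0 lam1 t01 B0 (lexx K) dT.
rewrite -/M in cJ.
have J0 b t y : t0 <= t <= T0 -> 0 <= approx_jet b lam B K t y.
  by move=> /andP[h1 _]; apply: approx_ge0 => //; exact: le_trans h1.
pose y0 := - (x * Num.sqrt n%:R).
have cmp b (D : set R) (mD : measurable D) hD :=
  @comparison_probability _ _ _ P n F eta H N mart bern vdev H0
    (approx_jet b lam B K) lam t0 M (B / 4) (is_jet_approx b lam B K) (cJ b)
    (J0 b) lam0 t01 M0 lam_mu lam_H2 lam_H thM y0 D mD hD.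
have term b t y : t0 <= t <= t0 + 2 * N ^+ 2 -> (if b then 0 < y else y <= 0) ->
    1 <= approx_jet b lam B K t y.
  move=> /andP[h1 h2]; apply: (approx_term _ _ _ _ _ _ _ lam0 lam1 (le_trans t01 h1) h2 K0).
  by rewrite /B lerDr !mulr_ge0.
set S := fun w => \sum_(1 <= i < n.+1) eta i w.
set E := [set w | _ < _].
have mD1 : measurable (`]0, +oo[%classic : set R) by exact: measurable_itv.
have mD2 : measurable (`]-oo, 0]%classic : set R) by exact: measurable_itv.
have up := cmp true _ mD1; have lo := cmp false _ mD2.
have {}up := up (fun t y ht hy => term true t y ht
  ltac:(move: hy; rewrite /= in_itv/= andbT; exact)).
have {}lo := lo (fun t y ht hy => term false t y ht
  ltac:(move: hy; rewrite /= in_itv/=; exact)).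
have E1 : [set w | `]0, +oo[%classic (y0 + S w)] = E.
  by apply/seteqP; split=> w; rewrite /E /= in_itv/= andbT /y0 addrC subr_gt0.
have E2 : [set w | `]-oo, 0]%classic (y0 + S w)] = ~` E.
  apply/seteqP; split=> w; rewrite /E /= in_itv/= /y0 addrC subr_le0.
    by rewrite leNgt => /negP.
  by move=> /negP; rewrite -leNgt.
have mE : measurable E.
  rewrite -[E]setTI -E1; have mS := measurable_martingale_sum mart.
  have mS' : measurable_fun setT (fun w => y0 + S w) by exact: measurable_funD.
  exact: mS' measurableT _ mD1.
rewrite E1 in up; rewrite E2 in lo.
rewrite probability_setC// -/(approx_jet false lam B K) in lo.
have PE : P E = (fine (P E))%:E by rewrite fineK// fin_num_measure.
rewrite PE -/T0 lee_fin approx_jetE in up.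
rewrite PE -/T0 -EFinB lee_fin approx_jetE mulNr PhiN in lo.
set p := fine (P E) in up lo *.
have Wle := barrier_start n0 e0 en xe n1' K0.
have /andP[f1 f2] := Phi_start n0 e0 x0 xe.
rewrite -/lam -/y0 -T0E in Wle f1 f2.
set g := gauss x in Wle f2 *.
have g0 : 0 <= g by rewrite ltW// gauss_gt0.
have lnT : ln T0 <= (1 + a) * x ^+ 2.
  have : ln T0 <= 1 + ln n%:R.
    apply: le_trans (ln_double n0); rewrite ler_ln ?posrE ?mulr_gt0//.
    by rewrite T0E ltr_wpDr.
  by move: lnx x21; clear; lra.
have Wle2 : barrier_jet lam K T0 y0 <= 2 * (3 + K * (1 + a)) * (g * (x ^+ 2 / Num.sqrt n%:R)).
  apply: le_trans Wle _.
  have h : 1 + 2 * x ^+ 2 + K * ln T0 <= (3 + K * (1 + a)) * x ^+ 2.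
    by have := ler_wpM2l K0 lnT; move: x21; clear; lra.
  have c0 : 0 <= 2 * g / Num.sqrt n%:R by rewrite divr_ge0 ?(ltW sn0)// mulr_ge0.
  have := ler_wpM2l c0 h; move/le_trans; apply.
  by rewrite le_eqVlt; apply/orP; left; apply/eqP; ring.
have f3 : 2 * g * (x * e / n%:R) <= 2 * e * (g * (x ^+ 2 / Num.sqrt n%:R)).
  have -> : 2 * e * (g * (x ^+ 2 / Num.sqrt n%:R)) = 2 * g * (x * e / n%:R) * (x * Num.sqrt n%:R).
    by rewrite -[X in _ * (x * e / X) * _]snE; field; rewrite gt_eqF.
  rewrite ler_peMr//; first by rewrite !mulr_ge0// ?invr_ge0// ltW.
  rewrite -[leLHS]mulr1 ler_pM//.
  by rewrite -[leLHS]sqrtr1 ler_sqrt.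
have := ler_wpM2l B0 Wle2.
rewrite ler_norml; move: up lo f1 f2 f3; clear; lra.
Qed.

End right_tail.

(** * The left tail by reflection, and the relative error *)

Section reflection.
Context d (T : measurableType d) (R : realType) (P : probability T R).

(** The values of [condexp] are chosen versions, so even this holds only almost
    surely. *)
Lemma condexpN (G : set (set T)) (X : T -> R) :
  sigma_algebra [set: T] G -> G `<=` measurable ->
  P.-integrable setT (EFin \o X) ->
  {ae P, forall w, condexp P G (fun v => - X v) w = - condexp P G X w}.
Proof.
move=> sG GT iX; have NE (Z : T -> R) : (fun v => - Z v) = (fun v => -1 * Z v).
  by apply/funext => v; rewrite mulN1r.
have iN (Z : T -> R) : P.-integrable setT (EFin \o Z) ->
    P.-integrable setT (EFin \o (fun v => - Z v)).
  by move=> iZ; rewrite NE; exact: integrable_EFinZ.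
have cX := condexpP sG GT iX; have [mY iY XY] := cX.
apply: (is_condexp_uniq sG GT (condexpP sG GT (iN _ iX))).
split; [by apply: measurableT_comp|exact: iN|].
move=> A GA; have iA (Z : T -> R) : P.-integrable setT (EFin \o Z) ->
    (\int[P]_(w in A) (- Z w)%:E = - \int[P]_(w in A) (Z w)%:E)%E.
  move=> iZ; under eq_integral do rewrite -mulN1r EFinM.
  rewrite integralZl ?mulN1e//; first exact: GT.
  by apply: (integrableS measurableT) => //; exact: GT.
by rewrite !iA// XY.
Qed.

Variables (n : nat) (F : nat -> set (set T)) (eta : nat -> T -> R) (H N : R).

Let sqrN i : (fun v => (- eta i v) ^+ 2) = (fun v => eta i v ^+ 2).
Proof. by apply/funext => v; rewrite sqrrN. Qed.

Lemma martingale_differencesN : martingale_differences P n F eta ->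
  martingale_differences P n F (fun i w => - eta i w).
Proof.
move=> [F0 sF FF h]; split=> // i i1n; have [m i2 e0] := h i i1n.
have /andP[_ iln] := i1n.
have i1n' : (i.-1 <= n)%N by rewrite (leq_trans (leq_pred i)).
have [sG GT] := sF i.-1 i1n'.
have mT : measurable_fun setT (eta i).
  by have [sGi GTi] := sF i iln; exact: (measurable_wrtW sGi GTi m).
split.
- exact: measurableT_comp.
- by under eq_fun do rewrite sqrrN.
- apply: filterS2 (condexpN sG GT (integrable_of_sqr mT i2)) e0 => w -> ->.
  by rewrite oppr0.
Qed.

Lemma bernstein_conditionN : martingale_differences P n F eta ->
  bernstein_condition P n F eta H ->
  bernstein_condition P n F (fun i w => - eta i w) H.
Proof.
move=> [_ sF _ _] h i k i1n k3; have [ik b] := h i k i1n k3.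
have i1n' : (i.-1 <= n)%N.
  by case/andP: i1n => _ iln; rewrite (leq_trans (leq_pred i)).
have [sG GT] := sF i.-1 i1n'; rewrite sqrN.
have [ko|ke] := boolP (odd k); last first.
  have e : (fun v => (- eta i v) ^+ k) = (fun v => eta i v ^+ k).
    by apply/funext => v; rewrite exprNn -signr_odd (negbTE ke) mul1r.
  rewrite e; split=> //.
  by rewrite (_ : (fun w => _) = (fun w => (eta i w ^+ k)%:E))//; apply/funext => w;
    have /= -> := congr1 (@^~ w) e.
have e : (fun v => (- eta i v) ^+ k) = (fun v => - eta i v ^+ k).
  by apply/funext => v; rewrite exprNn -signr_odd ko mulN1r.
split.
  rewrite (_ : (fun w => _) = EFin \o (fun v => (- eta i v) ^+ k))// e.
  rewrite (_ : (fun v => _) = (fun v => -1 * eta i v ^+ k)).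
    exact: integrable_EFinZ.
  by apply/funext => v; rewrite mulN1r.
by rewrite e; apply: filterS2 (condexpN sG GT ik) b => w ->; rewrite normrN.
Qed.

Lemma bounded_variance_deviationN :
  bounded_variance_deviation P n F eta N ->
  bounded_variance_deviation P n F (fun i w => - eta i w) N.
Proof.
have E w : \sum_(1 <= i < n.+1) condexp P (F i.-1) (fun v => (- eta i v) ^+ 2) w =
    \sum_(1 <= i < n.+1) condexp P (F i.-1) (fun v => eta i v ^+ 2) w.
  by apply: eq_bigr => i _; rewrite sqrN.
by apply: filterS => w; rewrite E.
Qed.

End reflection.

(** Mills' ratio: [std_normal_cdf (- x)] is of order [gauss x / x], which costs one
    more power of [x]. *)
Lemma relative_error_le {R : realType} (C p x s : R) : 0 <= C -> 1 <= x -> 0 < s ->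
  `|p - std_normal_cdf (- x)| <= C * (gauss x * (x ^+ 2 / s)) ->
  `|p / std_normal_cdf (- x) - 1| <=
    C / (@normal_peak1 R * expR (- 2)) * (x ^+ 3 / s).
Proof.
move=> C0 x1 s0 h.
have x0 : 0 < x := lt_le_trans ltr01 x1.
set c := normal_peak1 * expR (- 2).
have c0 : 0 < c by rewrite mulr_gt0 ?normal_peak1_gt0 ?expR_gt0.
have D := Phi_ge_gauss x1; rewrite -/c in D.
have g0 := gauss_gt0 x.
set Q := std_normal_cdf (- x) in h D *.
have Q0 : 0 < Q by apply: lt_le_trans D; rewrite divr_gt0// mulr_gt0.
have -> : p / Q - 1 = (p - Q) / Q by field; rewrite gt_eqF.
rewrite normrM normfV (gtr0_norm Q0) ler_pdivrMr//; apply: le_trans h _.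
have e0 : 0 <= C / c * (x ^+ 3 / s).
  by rewrite mulr_ge0// divr_ge0 ?exprn_ge0// ltW.
have := ler_wpM2l e0 D; apply: le_trans.
rewrite le_eqVlt; apply/orP; left; apply/eqP.
by field; rewrite !gt_eqF.
Qed.

Theorem corollary2p4 (R : realType) (H N alpha : R) (b : nat -> R) :
  0 < H -> 0 <= N -> 0 < alpha ->
  (forall n, (1 <= n)%N -> 0 < b n) ->
  b n / (n%:R `^ 6^-1) @[n --> \oo] --> (0 : R) ->
  exists (C : R) (n0 : nat),
  forall (d : nat -> measure_display) (T : forall n, measurableType (d n))
    (P : forall n, probability (T n) R)
    (F : forall n, nat -> set (set (T n)))
    (eta : forall n, nat -> T n -> R),
  (forall n, (1 <= n)%N ->
    [/\ martingale_differences (P n) n (F n) (eta n),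
        bernstein_condition (P n) n (F n) (eta n) H &
        bounded_variance_deviation (P n) n (F n) (eta n) N]) ->
  forall (n : nat) (x : R), (1 <= n)%N -> (n0 <= n)%N ->
    alpha * Num.sqrt (ln n%:R) <= x -> x <= b n ->
    `|fine (P n [set w | \sum_(1 <= i < n.+1) eta n i w > x * Num.sqrt n%:R])
        / (1 - std_normal_cdf x) - 1|
      <= C * ((H + N) * (x ^+ 3 / Num.sqrt n%:R)) /\
    `|fine (P n [set w | \sum_(1 <= i < n.+1) eta n i w < - x * Num.sqrt n%:R])
        / std_normal_cdf (- x) - 1|
      <= C * ((H + N) * (x ^+ 3 / Num.sqrt n%:R)).
Proof.
move=> H0 N0 al0 b0 bcvg.
pose a := (alpha ^+ 2)^-1.
have a0 : 0 <= a by rewrite invr_ge0 sqr_ge0.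
have [C [kap0 [n1 [C0 kap00 est]]]] := @right_tail_estimate R H N a H0 a0.
pose r := Num.min 1 kap0.
have r0 : 0 < r by rewrite lt_min ltr01 kap00.
have [m1 _ hm1] : \forall n \near \oo, `|b n / (n%:R `^ 6^-1)| < r.
  by move/cvgrPdist_lt : bcvg => /(_ r r0); apply: filterS => n; rewrite sub0r normrN.
pose nn := Num.max n1 (expR a).
pose c : R := normal_peak1 * expR (- 2).
have c0 : 0 < c by rewrite mulr_gt0 ?normal_peak1_gt0 ?expR_gt0.
exists (C / c / H), (maxn m1 (Num.truncn nn).+1).
move=> d T P F eta hyp n x n1' nn0 alx xb.
have n0 : 0 < n%:R :> R by rewrite ltr0n.
have sn0 : 0 < Num.sqrt n%:R :> R by rewrite sqrtr_gt0.
move: nn0; rewrite geq_max => /andP[m1n tn].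
have nnn : nn <= n%:R.
  by apply: ltW; apply: lt_le_trans (truncnS_gt nn) _; rewrite ler_nat.
move: nnn; rewrite /nn ge_max => /andP[n1n en].
have an : a <= ln n%:R by rewrite -ler_expR lnK ?posrE.
have ln0 : 0 <= ln n%:R :> R := le_trans a0 an.
have alx0 : 0 <= alpha * Num.sqrt (ln n%:R) by rewrite mulr_ge0 ?sqrtr_ge0// ltW.
have x0 : 0 <= x := le_trans alx0 alx.
have alx2 : alpha ^+ 2 * ln n%:R <= x ^+ 2.
  rewrite -[X in _ * X <= _](sqr_sqrtr ln0) -exprMn.
  by rewrite ler_pXn2r ?nnegrE.
have al2 : 0 < alpha ^+ 2 by rewrite exprn_gt0.
have lnx : ln n%:R <= a * x ^+ 2 by rewrite /a ler_pdivlMl.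
have x1 : 1 <= x.
  rewrite -(ler_pXn2r (n := 2)) ?nnegrE// expr1n; apply: le_trans alx2.
  by rewrite -ler_pdivrMl// mulr1.
have xk : x ^+ 3 / Num.sqrt n%:R <= kap0.
  have hb := hm1 n m1n; rewrite /= in hb.
  have s6 : 0 < n%:R `^ 6^-1 :> R by rewrite powR_gt0.
  have s63 : (n%:R `^ 6^-1) ^+ 3 = Num.sqrt n%:R :> R.
    rewrite -powR_mulrn ?powR_ge0// -powRrM (_ : 6^-1 * 3 = 2^-1 :> R); last by field.
    by rewrite powR12_sqrt// ltW.
  have xb6 : x / (n%:R `^ 6^-1) <= r.
    apply: le_trans (ltW hb); apply: le_trans (ler_norm _).
    by rewrite ler_pM2r ?invr_gt0.
  rewrite -s63 -expr_div_n; apply: (@le_trans _ _ (r ^+ 3)).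
    by rewrite ler_pXn2r ?nnegrE ?(ltW r0)// divr_ge0// ltW.
  have r1 : r <= 1 by rewrite ge_min lexx.
  apply: (@le_trans _ _ r); first by rewrite exprS ler_piMr ?(ltW r0)// exprn_ile1 ?(ltW r0).
  by rewrite ge_min lexx orbT.
have [mart bern vdev] := hyp n n1'.
have fin (p : R) : `|p - std_normal_cdf (- x)| <= C * (gauss x * (x ^+ 2 / Num.sqrt n%:R)) ->
    `|p / std_normal_cdf (- x) - 1| <= C / c / H * ((H + N) * (x ^+ 3 / Num.sqrt n%:R)).
  move=> h; apply: le_trans (relative_error_le C0 x1 sn0 h) _; rewrite -/c.
  have z0 : 0 <= x ^+ 3 / Num.sqrt n%:R by rewrite divr_ge0 ?exprn_ge0// ltW.
  rewrite -[leRHS]mulrA ler_wpM2l ?divr_ge0 ?(ltW c0)// mulrA ler_peMl//.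
  by rewrite mulrC ler_pdivlMr// mul1r lerDl.
split.
  rewrite -PhiN; apply: fin.
  exact: est mart bern vdev x n1n x1 lnx xk.
apply: fin; have := est _ _ _ _ _ _ (martingale_differencesN mart)
  (bernstein_conditionN mart bern) (bounded_variance_deviationN vdev) x n1n x1 lnx xk.
congr (is_true (`| fine (P n _) - _ | <= _)).
apply/seteqP; split=> w /=.
  by rewrite sumrN ltrNr mulNr.
by rewrite sumrN ltrNr mulNr.
Qed.
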